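(* There is a smooth diffeomorphism $T$ of the sphere $S^4$ and a hyperbolic basic set $K$ for $T$ such that the following holds. Let $h$ be a holomorphic function defined on a neighbourhood of $0$ in $\mathbb{C}$, with power series expansion $h(z)=\sum_{k=0}^{+\infty}\alpha_kz^k$ of radius of convergence $\rho>1$ (possibly $\rho=+\infty$), and assume that $\alpha_k\ne-1$ for all $k\in\mathbb{N}$. Then there is a function $g:S^4\to\mathbb{C}$ such that $$\zeta_{T,g}(z)^{-1}=1-2z-z(1-z)h(z)$$ and $$d_{T,g}(z)=\prod_{k=0}^{+\infty}\left(\zeta_{T,g}\left(\frac z{4^{k+2}}\right)^{-1}\right)^{\frac{(k+1)(k+2)(k+3)}6}.$$ Moreover $g$ is $C^r$ for all integers $r$ strictly smaller than $\frac{\ln\rho}{\ln4}$, and, if $\alpha_k\in\left]-1,+\infty\right[$ for all integers $k \geq 0$, then $g$ is strictly positive on $K$.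
   Context: Conventions: $\mathbb{N}=\{0,1,2,\dots\}$; smooth means $C^\infty$. Hyperbolic basic set: for a smooth diffeomorphism $T:M\to M$ of a smooth manifold, a $T$-invariant compact set $K\subset M$ is a hyperbolic basic set for $T$ if (1) there is a Riemannian metric on a neighbourhood of $K$, for each $x\in K$ a splitting $T_xM=E^u_x\oplus E^s_x$ with $D_xT(E^i_x)=E^i_{Tx}$ ($i\in\{u,s\}$), and constants $\lambda>1$, $c>0$ with $\|D_xT^n|_{E^s_x}\|\le c\lambda^{-n}$ and $\|D_xT^{-n}|_{E^u_x}\|\le c\lambda^{-n}$ for all $n\in\mathbb{N}$, $x\in K$; (2) there is a neighbourhood $V$ of $K$ with $K=\bigcap_{n\in\mathbb{Z}}T^n(V)$; (3) $T|_K$ is transitive. With $g^{(n)}(x)=\prod_{k=0}^{n-1}g(T^kx)$, the weighted zeta function and the dynamical determinant are the formal power series $$\zeta_{T,g}(z)=\exp\left(\sum_{n\ge1}\frac1n\Big(\sum_{x\in K,\ T^nx=x}g^{(n)}(x)\Big)z^n\right),\qquad d_{T,g}(z)=\exp\left(-\sum_{n\ge1}\frac1n\Big(\sum_{x\in K,\ T^nx=x}\frac{g^{(n)}(x)}{|\det(I-D_xT^n)|}\Big)z^n\right).$$ The identities of the claim are identities of power series (holomorphic functions) near $0$; the infinite product converges. *)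

(* Defs.v *)
From HB Require Import structures.
From mathcomp Require Import all_boot all_order all_algebra.
From mathcomp Require Import all_classical all_reals all_analysis.
From mathcomp Require Import complex mxred.

Set Implicit Arguments.
Unset Strict Implicit.
Unset Printing Implicit Defensive.

Import Order.TTheory GRing.Theory Num.Theory.
Import numFieldNormedType.Exports.

Local Open Scope classical_set_scope.
Local Open Scope ring_scope.
Local Open Scope complex_scope.

Section Regularity.
Context {R : realType} {V W : normedModType R}.
Implicit Types (U A : set V) (f F : V -> W).

(* f is of class C^r on U (meaningful for U open). In finite dimension
   x |-> 'd f x is C^r iff x |-> 'd f x v is C^r for each v. *)
Fixpoint Cr (r : nat) U f : Prop :=
  match r with
  | 0 => forall x, U x -> {for x, continuous f}
  | r'.+1 => (forall x, U x -> differentiable f x) /\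
             forall v, Cr r' U (fun x => 'd f x v)
  end.

Definition Coo U f := forall r, Cr r U f.

Definition extends_locally (P : set V -> (V -> W) -> Prop) A f :=
  forall x, A x -> exists (U : set V) (F : V -> W),
    [/\ open U, U x, P U F & {in A `&` U, F =1 f}].

(* For A (an open subset of) an embedded submanifold these are the usual
   C^r and C^oo maps on A. *)
Definition Cr_on (r : nat) := extends_locally (Cr r).
Definition smooth_on := extends_locally Coo.

End Regularity.

Section Sphere.
Context {R : realType} {n : nat}.
Implicit Types (x v : 'rV[R]_n.+1) (K U : set 'rV[R]_n.+1).

(* the library norm on row vectors is the sup norm *)
Definition enorm x : R := Num.sqrt (\sum_i x 0 i ^+ 2).

Definition sphere : set 'rV[R]_n.+1 := [set x | enorm x = 1].

Definition radial x : 'rV[R]_n.+1 := (enorm x)^-1 *: x.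

(* The row space is the orthogonal complement of x, which is the tangent space
   of the sphere at x. *)
Definition tangent x : 'M[R]_n.+1 := kermx x^T.

(* Points off the sphere are irrelevant: maps of the sphere are represented by
   maps of the ambient space. *)
Record sphere_diffeo := SphereDiffeo {
  sd_fun :> 'rV[R]_n.+1 -> 'rV[R]_n.+1 ;
  sd_inv : 'rV[R]_n.+1 -> 'rV[R]_n.+1 ;
  sd_funS : {homo sd_fun : x / sphere x} ;
  sd_invS : {homo sd_inv : x / sphere x} ;
  sd_funK : forall x, sphere x -> sd_inv (sd_fun x) = x ;
  sd_invK : forall x, sphere x -> sd_fun (sd_inv x) = x ;
  sd_fun_smooth : smooth_on sphere sd_fun ;
  sd_inv_smooth : smooth_on sphere sd_inv
}.

Definition iterz (T : sphere_diffeo) (m : int) : 'rV[R]_n.+1 -> 'rV[R]_n.+1 :=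
  match m with
  | Posz k => iter k (sd_fun T)
  | Negz k => iter k.+1 (sd_inv T)
  end.

(* For v tangent at x, t |-> radial (x + t v) is a curve on the sphere with
   velocity v at t = 0, so v *m tangent_map T m x is the image of v by the
   tangent map of T^m at x. *)
Definition tangent_map (T : sphere_diffeo) (m : int) x : 'M[R]_n.+1 :=
  'J (iterz T m \o radial) x.

Definition sphere_nbhs K U :=
  U `<=` sphere /\ exists O, [/\ open O, K `<=` O & O `&` sphere `<=` U].

(* G x is the Gram matrix of an inner product on the tangent space at x; its
   values on the normal direction are irrelevant. *)
Definition riemannian_metric U (G : 'rV[R]_n.+1 -> 'M[R]_n.+1) :=
  [/\ smooth_on U G,
      forall x, U x -> (G x)^T = G x
    & forall x v, U x -> (v <= tangent x)%MS -> v != 0 ->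
        0 < (v *m G x *m v^T) 0 0].

Definition gnorm (G : 'rV[R]_n.+1 -> 'M[R]_n.+1) x v : R :=
  Num.sqrt ((v *m G x *m v^T) 0 0).

Definition invariant_splitting (T : sphere_diffeo) K
    (Eu Es : 'rV[R]_n.+1 -> 'M[R]_n.+1) :=
  forall x, K x ->
    [/\ (Eu x + Es x == tangent x)%MS,
        (Eu x :&: Es x == (0 : 'M[R]_n.+1))%MS,
        (Eu x *m tangent_map T 1 x == Eu (T x))%MS
      & (Es x *m tangent_map T 1 x == Es (T x))%MS].

Definition hyperbolic (T : sphere_diffeo) K :=
  exists U G Eu Es (lambda c : R),
    [/\ [/\ sphere_nbhs K U, riemannian_metric U G
          & invariant_splitting T K Eu Es],
        1 < lambda, 0 < c,
        forall (k : nat) x v, K x -> (v <= Es x)%MS ->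
          gnorm G (iterz T k%:Z x) (v *m tangent_map T k%:Z x)
            <= c * lambda ^- k * gnorm G x v
      & forall (k : nat) x v, K x -> (v <= Eu x)%MS ->
          gnorm G (iterz T (- k%:Z) x) (v *m tangent_map T (- k%:Z) x)
            <= c * lambda ^- k * gnorm G x v].

Definition locally_maximal (T : sphere_diffeo) K :=
  exists V, sphere_nbhs K V /\ K = \bigcap_(m in [set: int]) (iterz T m @` V).

Definition transitive_on (T : sphere_diffeo) K :=
  forall A B, open A -> open B -> K `&` A !=set0 -> K `&` B !=set0 ->
    exists k : nat, (iter k T @` (K `&` A)) `&` (K `&` B) !=set0.

Definition hyperbolic_basic_set (T : sphere_diffeo) K :=
  [/\ [/\ K `<=` sphere, compact K & T @` K = K],
      hyperbolic T K, locally_maximal T K & transitive_on T K].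

End Sphere.

Arguments sphere R n : clear implicits.
Arguments sphere_diffeo R n : clear implicits.

Section PowerSeries.
Context {R : realType}.
Local Notation C := R[i].
Implicit Types (a : nat -> C) (f : C -> C^o).

Definition power_series a (z : C) : nat -> C^o :=
  series (fun k => a k * z ^+ k : C^o).

Definition psum a (z : C) : C^o := limn (power_series a z).

Definition has_expansion0 f a :=
  \forall z \near (0 : C^o), power_series a z @ \oo --> f z.

Definition holomorphic0 f :=
  \forall z \near (0 : C^o), derivable (f : C^o -> C^o) z 1.

Definition convergence_radius a : \bar R :=
  ereal_sup [set r%:E | r in
    [set r : R | forall z : C, `|z| < r%:C -> cvgn (power_series a z)]].

(* Coefficients of the formal power series exp(\sum_(i >= 1) a i X^i); only the
   powers k <= n and the indices i <= n contribute to the one of degree n. *)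
Definition fps_exp a : nat -> C := fun n =>
  (\sum_(0 <= k < n.+1)
     (k`!)%:R^-1 *: (\sum_(1 <= i < n.+1) a i *: 'X^i) ^+ k : {poly C})`_n.

End PowerSeries.

Section Zeta.
Context {R : realType} {n : nat}.
Local Notation C := R[i].
Variables (T : sphere_diffeo R n) (K : set 'rV[R]_n.+1).
Variable g : 'rV[R]_n.+1 -> C.

Definition fixed_in (m : nat) : set 'rV[R]_n.+1 :=
  [set x | K x /\ iter m T x = x].

Definition weight (m : nat) (x : 'rV[R]_n.+1) : C :=
  \prod_(0 <= k < m) g (iter k T x).

Definition det_I_sub (m : nat) (x : 'rV[R]_n.+1) : R :=
  \det (1%:M - restrictmx (tangent x) (tangent_map T m%:Z x)).

(* fixed_in m is finite for a hyperbolic basic set, whence the use of finitely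
   supported sums. *)
Definition zeta_series : nat -> C :=
  fps_exp (fun m => m%:R^-1 * \sum_(x \in fixed_in m) weight m x).

Definition det_series : nat -> C :=
  fps_exp (fun m =>
    - (m%:R^-1 * \sum_(x \in fixed_in m) weight m x / `|det_I_sub m x|%:C)).

Definition zeta : C -> C := psum zeta_series.

Definition dyn_det : C -> C := psum det_series.

Definition complex_Cr_on (r : nat) :=
  Cr_on r (sphere R n) (fun x => complex.Re (g x) : R^o) /\
  Cr_on r (sphere R n) (fun x => complex.Im (g x) : R^o).

End Zeta.

(* Main.v *)
Require Import Defs.
From HB Require Import structures.
From mathcomp Require Import all_boot all_order all_algebra.
From mathcomp Require Import all_classical all_reals all_analysis.
From mathcomp Require Import complex mxred ring lra zify.

Set Implicit Arguments.
Unset Strict Implicit.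
Unset Printing Implicit Defensive.

Import Order.TTheory GRing.Theory Num.Theory.
Import numFieldNormedType.Exports.

Local Open Scope classical_set_scope.
Local Open Scope ring_scope.
Local Open Scope complex_scope.

(* T is a horseshoe: in the chart y |-> (y_0, ..., y_3) / y_4 it reads
   (u, u', s, s') |-> (4 (u - i), 4 u', (s + i) / 4, s' / 4) on two disjoint boxes,
   i = 0, 1. Its invariant set K is coded by the two-sided full shift on {0, 1}, with
   u = \sum_j w_j 4^-j, and |det (1 - D T^m)| = (4^m - 1)^2 (1 - 4^-m)^2 at every point
   fixed by T^m.

   On K the weight g is 1 + alpha_k if w_0 = 1 and the next letter 1 is w_(k+1), and is 1
   otherwise. In the first case u - 1 lies in 4^-(k+1) [1, 4/3], so that g extends to a
   lacunary sum of bumps of height alpha_k at the scales 4^-k, which is C^r as soon as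
   4^(r k) alpha_k tends to 0.

   Decomposing cyclic words according to their letters 1 (a renewal equation) identifies
   the weighted numbers of fixed points with the coefficients of - z P'(z) / P(z), where
   P(z) = 1 - 2 z - z (1 - z) h(z) = (1 - z) (1 - \sum_k (1 + alpha_k) z^(k+1)). The product
   formula for d comes from the binomial series in
   1 / |det (1 - D T^m)| = 16^-m (1 - 4^-m)^-4 = \sum_k (k+1)(k+2)(k+3)/6 4^(-(k+2) m). *)

(** * Maps of class C^r *)

(** The number of dimensions is dictated by the product formula: each of the four chart directions
    contributes one factor (1 - 4^-m)^-1, which makes the multiplicities (k+1)(k+2)(k+3)/6, and the
    two expanding ones contribute 16^-m, which makes the shift k+2. The weight only looks at the
    first expanding direction.

    The geometric obstacle is that T must be a diffeomorphism of the whole sphere. Affine maps of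
    the chart come from linear maps of R^5, hence act on the sphere by acting on rays. Only the
    choice between the two branches is not projective; it is made by rotations whose angle depends
    smoothly on a coordinate that they preserve.

    The analytic device is the logarithmic derivative, in the form of the recursion n a_n = \sum_i
    W_i a_(n-i). It determines a from a_0, turns products into sums, and carries a bound M^n from W
    to a with the same M. One constant therefore controls zeta, its inverse, the determinant and all
    partial products, and coefficientwise convergence suffices for the infinite product.

    Tangent maps are obtained by differentiating cross-multiplied affine relations valid near a
    point of K, so that no formula for the derivative of the normalisation is required. *)

Section Calculus.
Context {R : realType}.

Lemma near_eq_diff_locally (V W : normedModType R) (f g : V -> W) x :
  {near x, f =1 g} -> differentiable f x ->
  g \o shift x = cst (g x) + 'd f x +o_ 0 id.
Proof.
move=> fg /diff_locally /eqaddoP df; apply/eqaddoP => e e0.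
have fgx := nbhs_singleton fg.
have fg0 : \forall h \near (0 : V), f (h + x) = g (h + x).
  by have := fg; rewrite (near_shift 0 x (fun y => f y = g y)) subr0.
by apply: filterS2 fg0 (df e e0) => h; rewrite !fctE /= fgx => ->.
Qed.

Lemma near_eq_differentiable (V W : normedModType R) (f g : V -> W) x :
  {near x, f =1 g} -> differentiable f x -> differentiable g x.
Proof.
move=> fg df; have dg := near_eq_diff_locally fg df.
have cdf : continuous ('d f x) by apply: diff_continuous.
by apply/diff_locallyP; rewrite (diff_unique cdf dg).
Qed.

Lemma near_eq_diff (V W : normedModType R) (f g : V -> W) x :
  {near x, f =1 g} -> differentiable f x -> 'd g x = 'd f x :> (V -> W).
Proof.
move=> fg df; apply: diff_unique (near_eq_diff_locally fg df).
exact: diff_continuous.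
Qed.

Lemma Cr_cst (V W : normedModType R) r U (c : W) : Cr r U (cst c : V -> W).
Proof.
elim: r c => [|r IH] c /=; first by move=> x _; exact: cst_continuous.
split=> [x _|v]; first exact: differentiable_cst.
rewrite (_ : (fun x => _) = cst 0); first exact: IH.
by apply/funext => x; rewrite diff_cst.
Qed.

(** On an open set, equality gives equality of germs, so the differentials agree as well. Each
    induction on [r] uses this to replace a differential by the formula that a differentiation rule
    provides. *)
Lemma Cr_eq (V W : normedModType R) r U (f g : V -> W) : open U ->
  (forall x, U x -> f x = g x) -> Cr r U f -> Cr r U g.
Proof.
move=> oU; elim: r f g => [|r IH] f g fg /=.
  move=> Cf x Ux; have nfg : {near x, f =1 g}.
    by apply: filterS (open_nbhs_nbhs (conj oU Ux)) => y; exact: fg.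
  rewrite /prop_for /continuous_at -(fg _ Ux).
  by apply: cvg_trans (Cf x Ux); apply: near_eq_cvg.
have nfg x : U x -> {near x, f =1 g}.
  by move=> Ux; apply: filterS (open_nbhs_nbhs (conj oU Ux)) => y; exact: fg.
case=> df Cf; split=> [x Ux|v].
  exact: near_eq_differentiable (nfg x Ux) (df x Ux).
by apply: IH (Cf v) => x Ux; rewrite (near_eq_diff (nfg x Ux)) //; exact: df.
Qed.

Lemma Cr_sub (V W : normedModType R) r (U U' : set V) (f : V -> W) :
  U `<=` U' -> Cr r U' f -> Cr r U f.
Proof.
move=> UU'; elim: r f => [|r IH] f /=; first by move=> Cf x /UU'; exact: Cf.
by case=> df Cf; split=> [x /UU'|v]; [exact: df|exact: IH].
Qed.

Lemma CrS (V W : normedModType R) r U (f : V -> W) : Cr r.+1 U f -> Cr r U f.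
Proof.
elim: r f => [|r IH] f.
  by case=> df _ x Ux; apply: differentiable_continuous; exact: df.
case=> df Cf; split=> // v; apply: IH; exact: Cf.
Qed.

Lemma Cr_continuous (V W : normedModType R) r U (f : V -> W) x :
  Cr r U f -> U x -> {for x, continuous f}.
Proof. by elim: r => [|r IH]; [exact|move/CrS]. Qed.

Lemma CrD (V W : normedModType R) r U (f g : V -> W) : open U ->
  Cr r U f -> Cr r U g -> Cr r U (fun x => f x + g x).
Proof.
move=> oU; elim: r f g => [|r IH] f g /=.
  by move=> Cf Cg x Ux; apply: continuousD; [exact: Cf|exact: Cg].
move=> [df Cf] [dg Cg]; split=> [x Ux|v].
  by apply: differentiableD; [exact: df|exact: dg].
apply: Cr_eq (IH _ _ (Cf v) (Cg v)) => // x Ux.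
by rewrite diffD //; [exact: df|exact: dg].
Qed.

Lemma Cr_sum (V W : normedModType R) r U (I : Type) (s : seq I)
    (f : I -> V -> W) : open U ->
  (forall i, Cr r U (f i)) -> Cr r U (fun x => \sum_(i <- s) f i x).
Proof.
move=> oU Cf; elim: s => [|i s IH].
  by apply: Cr_eq (Cr_cst r U (0 : W)) => // x _; rewrite big_nil.
apply: Cr_eq (CrD oU (Cf i) IH) => // x _.
by rewrite big_cons.
Qed.

Lemma Cr_lin (V W : normedModType R) r U (f : {linear V -> W}) :
  continuous f -> Cr r U f.
Proof.
move=> cf; case: r => [|r] /=; first by move=> x _; exact: cf.
split=> [x _|v]; first exact: linear_differentiable.
rewrite (_ : (fun x => _) = cst (f v)); first exact: Cr_cst.
by apply/funext => x; rewrite diff_lin.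
Qed.

Lemma CrM (V : normedModType R) r U (f g : V -> R^o) : open U ->
  Cr r U f -> Cr r U g -> Cr r U (fun x => f x * g x : R^o).
Proof.
move=> oU; elim: r f g => [|r IH] f g.
  by move=> Cf Cg x Ux; apply: continuousM; [exact: Cf|exact: Cg].
move=> Cf0 Cg0; have [df Cf] := Cf0; have [dg Cg] := Cg0; split=> [x Ux|v].
  by apply: differentiableM; [exact: df|exact: dg].
(* The Leibniz rule multiplies each function by a derivative of the other, so [CrS] first lowers the
   undifferentiated factor to class r. *)
have C1 := IH _ _ (CrS Cf0) (Cg v); have C2 := IH _ _ (CrS Cg0) (Cf v).
apply: Cr_eq (CrD oU C1 C2) => // x Ux.
by rewrite diffM //; [exact: df|exact: dg].
Qed.

Lemma Cr_scalel (V W : normedModType R) r U (f : V -> R^o) (w : W) : open U ->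
  Cr r U f -> Cr r U (fun x => f x *: w).
Proof.
move=> oU; elim: r f => [|r IH] f.
  by move=> Cf x Ux; apply: continuousZl; exact: Cf.
move=> [df Cf]; split=> [x Ux|v].
  by apply: differentiableZl; exact: df.
apply: Cr_eq (IH _ (Cf v)) => // x Ux.
by rewrite diffZl //; exact: df.
Qed.

Lemma Cr_lin_comp (V W Z : normedModType R) r U (f : V -> W)
    (c : {linear W -> Z}) : open U -> continuous c ->
  Cr r U f -> Cr r U (fun x => c (f x)).
Proof.
move=> oU cc; elim: r f => [|r IH] f.
  by move=> Cf x Ux; apply: continuous_comp; [exact: Cf|exact: cc].
move=> [df Cf]; have dc y : differentiable c y by exact: linear_differentiable.
split=> [x Ux|w]; first by apply: differentiable_comp => //; exact: df.
apply: Cr_eq (IH _ (Cf w)) => // x Ux.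
rewrite (@diff_comp _ _ _ _ f c); [|exact: df|exact: dc].
by rewrite /= (diff_lin _ cc).
Qed.

(* Composition through an intermediate space W with a finite linear coordinate
   system (e, c), which makes the chain rule a finite sum of products. *)
Lemma Cr_comp_basis (V W : normedModType R) n (e : 'I_n -> W)
    (c : 'I_n -> {linear W -> R^o}) r U U' (f : V -> W) (g : W -> R^o) :
  (forall i, continuous (c i)) -> (forall w, w = \sum_i c i w *: e i) ->
  open U -> (forall x, U x -> U' (f x)) ->
  Cr r U f -> Cr r U' g -> Cr r U (g \o f).
Proof.
move=> cc ec oU fUU'; elim: r f g fUU' => [|r IH] f g fUU'.
  move=> Cf Cg x Ux; apply: continuous_comp; first exact: Cf.
  by apply: Cg; exact: fUU'.
move=> Cf0 [dg Cg]; have [df Cf] := Cf0; split=> [x Ux|v].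
  by apply: differentiable_comp; [exact: df|apply/dg/fUU'].
have Cc i := Cr_lin_comp oU (cc i) (Cf v).
have C i : Cr r U (fun x => c i ('d f x v) * ('d g (f x) (e i)) : R^o).
  apply: CrM => //.
  exact: (IH f (fun y => 'd g y (e i)) fUU' (CrS Cf0) (Cg _)).
apply: Cr_eq (Cr_sum (index_enum _) oU C) => // x Ux.
rewrite (@diff_comp _ _ _ _ f g); [|exact: df|exact: (dg _ (fUU' _ Ux))].
rewrite /=.
rewrite [in RHS](ec ('d f x v)) linear_sum /=.
by apply: eq_bigr => i _; rewrite linearZ.
Qed.

End Calculus.

Section CalculusFiniteDim.
Context {R : realType}.

Lemma Cr_id (V : normedModType R) r U : Cr r U (id : V -> V).
Proof. by apply: (@Cr_lin _ V V r U idfun) => x; apply: cvg_id. Qed.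

Lemma Cr_coord m n r U i j : Cr r U (fun M : 'M[R]_(m.+1, n.+1) => M i j : R^o).
Proof.
have lin : linear (fun M : 'M[R]_(m.+1, n.+1) => M i j : R^o).
  by move=> a u v; rewrite !mxE.
pose f : {linear 'M[R]_(m.+1, n.+1) -> R^o} :=
  HB.pack (fun M : 'M[R]_(m.+1, n.+1) => M i j : R^o)
    (GRing.isLinear.Build _ _ _ _ _ lin).
by apply: (@Cr_lin _ _ _ _ _ f) => x; exact: coord_continuous.
Qed.

Lemma Cr_mx (V : normedModType R) m n r U (f : V -> 'M[R]_(m.+1, n.+1)) :
  open U -> (forall i j, Cr r U (fun x => f x i j : R^o)) -> Cr r U f.
Proof.
move=> oU Cf.
have C i : Cr r U (fun x => \sum_j f x i j *: delta_mx i j : 'M[R]_(m.+1, n.+1)).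
  by apply: Cr_sum => // j; apply: Cr_scalel.
apply: Cr_eq (Cr_sum (index_enum _) oU C) => // x _.
by rewrite -matrix_sum_delta.
Qed.

Lemma Cr_comp (V : normedModType R) r U U' (f : V -> R^o) (g : R^o -> R^o) :
  open U -> (forall x, U x -> U' (f x)) ->
  Cr r U f -> Cr r U' g -> Cr r U (fun x => g (f x)).
Proof.
move=> oU fU Cf Cg.
apply: (@Cr_comp_basis R V R^o 1%N (fun=> 1) (fun=> idfun) r U U' f g) => //.
  by move=> i x; exact: cvg_id.
by move=> w; rewrite big_ord1 /= [RHS]mulr1.
Qed.

Lemma Cr_rV_comp (V : normedModType R) n r U U' (f : V -> 'rV[R]_n.+1)
    (g : 'rV[R]_n.+1 -> R^o) : open U -> (forall x, U x -> U' (f x)) ->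
  Cr r U f -> Cr r U' g -> Cr r U (fun x => g (f x)).
Proof.
have lin_coord (j : 'I_n.+1) : linear (fun N : 'rV[R]_n.+1 => N 0 j : R^o).
  by move=> a u v; rewrite !mxE.
pose c j : {linear 'rV[R]_n.+1 -> R^o} :=
  HB.pack (fun N : 'rV[R]_n.+1 => N 0 j : R^o)
    (GRing.isLinear.Build _ _ _ _ _ (lin_coord j)).
move=> oU fU Cf Cg.
apply: (@Cr_comp_basis _ _ _ _ (fun j => delta_mx 0 j) c r U U' f g) => //.
  by move=> i x; exact: coord_continuous.
by move=> w; rewrite [LHS]row_sum_delta.
Qed.

Lemma CrZ (V : normedModType R) r U (f : V -> R^o) c : open U ->
  Cr r U f -> Cr r U (fun x => c * f x : R^o).
Proof. by move=> oU Cf; apply: CrM => //; exact: Cr_cst. Qed.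

Lemma CrN (V : normedModType R) r U (f : V -> R^o) : open U ->
  Cr r U f -> Cr r U (fun x => - f x : R^o).
Proof.
by move=> oU Cf; apply: Cr_eq (CrZ (-1) oU Cf) => // x _; rewrite mulN1r.
Qed.

Lemma CrB (V : normedModType R) r U (f g : V -> R^o) : open U ->
  Cr r U f -> Cr r U g -> Cr r U (fun x => f x - g x : R^o).
Proof. by move=> oU Cf Cg; apply: CrD => //; exact: CrN. Qed.

Lemma open_neq0 : open [set x : R^o | x != 0].
Proof.
rewrite (_ : [set _ | _] = ~` [set 0]).
  by apply: closed_openC; exact: accessible_closed_set1 (@hausdorff_accessible _ (@norm_hausdorff _ _)) _.
by apply/seteqP; split => x /= /eqP.
Qed.

(** The differential -v x^-2 is again a product of inverses, so the induction closes with [CrM]. *)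
Lemma Cr_inv r : Cr r [set x : R^o | x != 0] (fun x => x^-1 : R^o).
Proof.
elim: r => [|r IH]; first by move=> x x0; exact: inv_continuous.
split=> [x x0|v]; first exact: differentiable_Rinv.
have C := CrM open_neq0 IH IH.
apply: Cr_eq (CrZ (- v) open_neq0 C) => [|x x0]; first exact: open_neq0.
by rewrite diff_Rinv // -invfM -expr2 mulNr mulrC -mulNr.
Qed.

Lemma is_derive_diff (f : R^o -> R^o) (x : R^o) (df : R^o) : is_derive x 1 f df ->
  differentiable f x /\ forall v, 'd f x v = v * df.
Proof.
case=> fx <-; have dfx : differentiable f x by exact/derivable1_diffP.
by split=> // v; rewrite deriv1E // derive1E.
Qed.

(** Successive derivatives move inside the family [P], hence the induction quantifies over it. The
    families used are a sin + b cos and p(1/x) exp(-1/x). *)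
Lemma Coo_derive_closed (U : set R^o) (P : set (R^o -> R^o)) : open U ->
  (forall f, P f -> exists2 f', P f' & forall x, U x -> is_derive x 1 f (f' x)) ->
  forall f, P f -> Coo U f.
Proof.
move=> oU cP f Pf r; elim: r f Pf => [|r IH] f Pf; have [f' Pf' df] := cP f Pf.
  move=> x Ux; apply: differentiable_continuous.
  by have [] := is_derive_diff (df x Ux).
split=> [x Ux|v]; first by have [] := is_derive_diff (df x Ux).
apply: Cr_eq (CrZ v oU (IH _ Pf')) => // x Ux.
by have [_ ->] := is_derive_diff (df x Ux).
Qed.

Lemma Coo_sin_cos (f : R^o -> R^o) :
  (exists a b : R, f = fun x => a * sin x + b * cos x) -> Coo setT f.
Proof.
move: f; apply: Coo_derive_closed; first exact: openT.
move=> _ [a [b ->]]; exists (fun x => - b * sin x + a * cos x).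
  by exists (- b), a.
move=> x _; apply: is_derive_eq.
by rewrite /GRing.scale /=; ring.
Qed.

Lemma Coo_sin : Coo setT (sin : R^o -> R^o).
Proof.
by apply: Coo_sin_cos; exists 1, 0; apply/funext => x; rewrite mul1r mul0r addr0.
Qed.

Lemma Coo_cos : Coo setT (cos : R^o -> R^o).
Proof.
by apply: Coo_sin_cos; exists 0, 1; apply/funext => x; rewrite mul1r mul0r add0r.
Qed.

Lemma open_gt0 : open [set x : R^o | 0 < x].
Proof. exact: open_gt. Qed.

Lemma Cr_sqrt r : Cr r [set x : R^o | 0 < x] (Num.sqrt : R^o -> R^o).
Proof.
elim: r => [|r IH]; first by move=> x _; exact: sqrt_continuous.
have d (x : R^o) : 0 < x -> is_derive x 1 (Num.sqrt : R^o -> R^o) (2 * Num.sqrt x)^-1.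
  by move=> x0; exact: is_derive1_sqrt.
split=> [x x0|v]; first by have [] := is_derive_diff (d x x0).
have C : Cr r [set x : R^o | 0 < x] (fun x => (2 * Num.sqrt x)^-1 : R^o).
  apply: (Cr_comp open_gt0 _ (CrZ 2 open_gt0 IH) (Cr_inv r)) => x /= x0.
  by rewrite mulf_neq0 // gt_eqF // sqrtr_gt0.
apply: Cr_eq (CrZ v open_gt0 C) => [|x x0]; first exact: open_gt0.
by have [_ ->] := is_derive_diff (d x x0).
Qed.

End CalculusFiniteDim.

(** * Bump functions and lacunary sums *)

Section SmoothStep.
Context {R : realType}.

(** Meant for the point 0, where [flat_fun] and [lacunary] are glued to zero and no single formula
    holds on both sides. *)
Lemma is_derive_0 (f : R -> R) (x : R) :
  (forall e : R, 0 < e -> \forall h \near (0 : R), `|f (h + x) - f x| <= e * `|h|) ->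
  is_derive x (1 : R) f 0.
Proof.
move=> fo.
have fE : f \o shift x = cst (f x) + \0 +o_ 0 id.
  apply/eqaddoP => e e0; have := fo e e0.
  by apply: filterS => h; rewrite !fctE /= addr0.
have c0 : continuous (\0 : R -> R) by move=> y; exact: cst_continuous.
have d0 : 'd f x = \0 :> (R -> R) by apply: (@diff_unique _ _ _ f \0).
have df : differentiable f x by apply/diff_locallyP; rewrite d0.
split; first exact/derivable1_diffP.
by rewrite deriveE // d0.
Qed.

(** Each monomial is controlled by exp y >= y^(i+1) / (i+1)!. *)
Lemma horner_expRN_le (p : {poly R}) : exists2 C : R, 0 <= C &
  forall y, 0 < y -> `|p.[y] * expR (- y)| <= C / y.
Proof.
exists (\sum_(i < size p) `|p`_i| * i.+1`!%:R).
  by apply: sumr_ge0 => i _; rewrite mulr_ge0.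
move=> y y0; rewrite horner_coef !mulr_suml; apply: le_trans (ler_norm_sum _ _ _) _.
apply: ler_sum => i _; rewrite !normrM -!mulrA ler_wpM2l //.
rewrite normrX !gtr0_norm ?expR_gt0 // expRN.
rewrite ler_pdivlMr // mulrAC -exprSr ler_pdivrMr ?expR_gt0 //.
have := expR_ge1Dxn i (ltW y0).
have f0 : (0 : R) < i.+1`!%:R by rewrite ltr0n fact_gt0.
rewrite -ler_pdivrMl // mulrC => h; apply: le_trans h; by rewrite lerDr.
Qed.

(** The classical flat function exp(-1/x), with a polynomial in 1/x carried along because
    differentiation replaces p by X^2 (p - p'). *)
Definition flat_fun (p : {poly R}) (x : R) : R :=
  if 0 < x then p.[x^-1] * expR (- x^-1) else 0.

(** The exponential bound applied to p X instead of p gains a factor x. The estimate becomes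
    quadratic, hence o(x), which gives derivative 0 at the origin. *)
Lemma flat_fun_le (p : {poly R}) : exists2 C : R, 0 <= C &
  forall x, `|flat_fun p x| <= C * x ^+ 2.
Proof.
have [C C0 H] := horner_expRN_le (p * 'X); exists C => // x; rewrite /flat_fun.
case: ltP => x0; last by rewrite normr0 mulr_ge0 // sqr_ge0.
have := H x^-1; rewrite invr_gt0 invrK => /(_ x0).
rewrite hornerM hornerX mulrAC normrM (gtr0_norm (x := x^-1)) ?invr_gt0 //.
by rewrite ler_pdivrMr // -mulrA -expr2.
Qed.

Lemma is_derive_flat_fun (p : {poly R}) (x : R) :
  is_derive x (1 : R) (flat_fun p) (flat_fun ('X^2 * (p - p^`())) x).
Proof.
have flat0 q y : y <= 0 -> flat_fun q y = 0 by rewrite /flat_fun ltNge => ->.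
case: (ltrgtP x 0) => x0.
- rewrite flat0 ?ltW //.
  apply: (@near_eq_is_derive _ _ _ (cst 0)).
  by near=> y; rewrite flat0 // ltW //; near: y; exact: lt_nbhsl.
- rewrite [X in is_derive _ _ _ X]/flat_fun x0.
  apply: (@near_eq_is_derive _ _ _ (fun y : R => p.[y^-1] * expR (- y^-1))).
    by near=> y; rewrite /flat_fun ifT //; near: y; exact: lt_nbhsr.
  have xn0 : x != 0 by rewrite gt_eqF.
  have dv : is_derive x (1 : R) (fun y : R => y^-1) (- x ^- 2 *: (1 : R)).
    exact: (@is_deriveV _ id).
  have dp := @is_derive1_comp _ _ (fun y : R => y^-1) x _ _ (is_derive_poly p x^-1) dv.
  have de := @is_derive1_comp _ _ (fun y : R => - y^-1) x _ _ (is_derive_expR (- x^-1)) (is_deriveN dv).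
  apply: (@is_derive_eq _ _ _ _ _ _ _ _ (is_deriveM dp de)).
  rewrite !hornerE /= /GRing.scale /=.
  by field.
- rewrite x0 flat0 //; apply: is_derive_0 => e e0.
  have [C C0 H] := flat_fun_le p.
  near=> h; rewrite addr0 (flat0 p 0) // subr0.
  apply: le_trans (H h) _; rewrite -real_normK ?num_real // expr2 mulrA.
  rewrite ler_wpM2r //.
  have : `|h| <= e / (C + 1).
    near: h; apply/nbhs_normP; exists (e / (C + 1)); first by rewrite /= divr_gt0 // ltr_wpDl.
    by move=> h /=; rewrite sub0r normrN => /ltW.
  rewrite ler_pdivlMr ?ltr_wpDl // mulrDr mulr1 mulrC => He.
  by apply: le_trans He; rewrite lerDl.
Unshelve. all: by end_near. Qed.

Lemma Coo_flat_fun (p : {poly R}) : Coo setT (flat_fun p : R^o -> R^o).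
Proof.
apply: (Coo_derive_closed (P := [set f | exists p, f = flat_fun p])); last by exists p.
  exact: openT.
move=> _ [q ->]; exists (flat_fun ('X^2 * (q - q^`()))) => [|x _]; first by eexists.
exact: is_derive_flat_fun.
Qed.

Definition step (x : R) : R := flat_fun 1 x / (flat_fun 1 x + flat_fun 1 (1 - x)).

Lemma flat_fun1_gt0 (x : R) : 0 < x -> 0 < flat_fun 1 x.
Proof. by move=> x0; rewrite /flat_fun x0 hornerE mul1r expR_gt0. Qed.

Lemma flat_fun_le0 (p : {poly R}) (x : R) : x <= 0 -> flat_fun p x = 0.
Proof. by rewrite /flat_fun ltNge => ->. Qed.

Lemma flat_fun1_ge0 (x : R) : 0 <= flat_fun 1 x.
Proof.
by case: (ltP 0 x) => [/flat_fun1_gt0/ltW //|x0]; rewrite flat_fun_le0.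
Qed.

Lemma step_den_gt0 (x : R) : 0 < flat_fun 1 x + flat_fun 1 (1 - x).
Proof.
case: (ltP 0 x) => x0; first by rewrite ltr_wpDr ?flat_fun1_ge0 ?flat_fun1_gt0.
by rewrite ltr_wpDl ?flat_fun1_ge0 ?flat_fun1_gt0 //; lra.
Qed.

Lemma step0 (x : R) : x <= 0 -> step x = 0.
Proof. by move=> x0; rewrite /step flat_fun_le0 // mul0r. Qed.

Lemma step1 (x : R) : 1 <= x -> step x = 1.
Proof.
move=> x1; have := step_den_gt0 x; rewrite /step.
rewrite (flat_fun_le0 _ (x := 1 - x)) ?addr0; last by lra.
by move=> /lt0r_neq0 h; rewrite divff.
Qed.

Lemma Coo_step : Coo setT (step : R^o -> R^o).
Proof.
move=> r; have Cf := Coo_flat_fun 1 r.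
have Cg : Cr r setT (fun x : R^o => flat_fun 1 (1 - x) : R^o).
  apply: (@Cr_comp _ _ _ setT setT (fun x : R^o => 1 - x : R^o)) => //; first exact: openT.
  by apply: CrB; [exact: openT|exact: Cr_cst|exact: Cr_id].
apply: CrM; [exact: openT|exact: Cf|].
apply: (@Cr_comp _ _ _ setT _ _ (fun x : R^o => x^-1 : R^o) openT _ (CrD openT Cf Cg) (Cr_inv r)).
by move=> x _ /=; rewrite gt_eqF // step_den_gt0.
Qed.

(** The flat part [1, 4/3] is the range of base 4 expansions with digits 0, 1 and leading digit 1.
    The support lies in [3/4, 2], and 2 / (3/4) < 4, so dilates by distinct powers of 4 have
    disjoint supports. *)
Definition plateau (x : R) : R := step (4 * x - 3) * step (3 / 2 * (2 - x)).

Lemma plateau1 (x : R) : 1 <= x <= 4 / 3 -> plateau x = 1.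
Proof. by move=> /andP[x1 x2]; rewrite /plateau !step1 ?mul1r //; lra. Qed.

Lemma plateau0 (x : R) : x <= 3 / 4 \/ 2 <= x -> plateau x = 0.
Proof.
by move=> [h|h]; rewrite /plateau; [rewrite step0 ?mul0r|rewrite (step0 (x := 3 / 2 * _)) ?mulr0]; lra.
Qed.

Lemma Coo_plateau : Coo setT (plateau : R^o -> R^o).
Proof.
move=> r; apply: CrM; first exact: openT.
  apply: (@Cr_comp _ _ _ setT setT (fun x : R^o => 4 * x - 3 : R^o)) => //; [exact: openT| |exact: Coo_step].
  by apply: CrB; [exact: openT|apply: CrZ; [exact: openT|exact: Cr_id]|exact: Cr_cst].
apply: (@Cr_comp _ _ _ setT setT (fun x : R^o => 3 / 2 * (2 - x) : R^o)) => //; [exact: openT| |exact: Coo_step].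
by apply: CrZ; [exact: openT|apply: CrB; [exact: openT|exact: Cr_cst|exact: Cr_id]].
Qed.

End SmoothStep.

(** * Lacunary sums of dilated bumps *)

Section Lacunary.
Context {R : realType}.
Implicit Types (b : nat -> R) (f : R -> R) (v : R).

(** The k-th bump lives at v of order 4^-(k+1). For [annular] f at most one term is nonzero at each
    v, so the limit is that of an eventually constant sequence. *)
Definition lacunary b f v : R :=
  limn (series (fun k => b k * f (4 ^+ k.+1 * v))).

(** Strict inequalities make the region of vanishing open, so that the property passes to
    derivatives. *)
Definition annular f := forall x, x < 3 / 4 \/ 2 < x -> f x = 0.

Lemma lacunaryE N b f v :
  (forall k, (N <= k)%N -> f (4 ^+ k.+1 * v) = 0) ->
  lacunary b f v = \sum_(k < N) b k * f (4 ^+ k.+1 * v).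
Proof.
move=> f0; apply: cvg_lim => //; apply: cvg_near_cst.
exists N => // n /= Nn; rewrite /series /= (big_cat_nat (n := N)) //=.
rewrite big_mkord [X in _ + X]big_nat_cond [X in _ + X]big1 ?addr0 //.
by move=> k /andP[/andP[/f0 -> _] _]; rewrite mulr0.
Qed.

Lemma lacunary_le0 b f v : annular f -> v <= 0 -> lacunary b f v = 0.
Proof.
move=> af v0; rewrite (@lacunaryE 0) ?big_ord0 // => k _; apply: af; left.
by apply: le_lt_trans (_ : 0 < _); [rewrite mulr_ge0_le0|lra].
Qed.

Lemma pow4_unbounded (x : R) : exists N, x < 4 ^+ N.
Proof.
exists (Num.bound `|x|); apply: le_lt_trans (ler_norm x) _.
apply: lt_le_trans (archi_boundP (normr_ge0 x)) _.
elim: (Num.bound _) => [|n IH]; first by rewrite expr0 ler01.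
rewrite -natr1 exprS; apply: le_trans (_ : 4 ^+ n + 1 <= _); first by rewrite lerD2r.
have : 1 <= (4 : R) ^+ n by apply: exprn_ege1; lra.
by move=> ?; lra.
Qed.

(** The same [N] serves every b and f on the whole half-line from v/2, so near v both the sum and
    its candidate derivative are finite sums over the same indices, and termwise differentiation is
    legitimate. *)
Lemma lacunary_gt0 v : 0 < v -> exists N, forall b f, annular f ->
  forall w, v / 2 <= w -> lacunary b f w = \sum_(k < N) b k * f (4 ^+ k.+1 * w).
Proof.
move=> v0; have [N HN] := pow4_unbounded (4 / v).
exists N => b f af w vw; apply: lacunaryE => k Nk; apply: af; right.
have h1 : (4 : R) ^+ N <= 4 ^+ k.+1 by apply: ler_weXn2l; [lra|exact: leqW].
have h2 : 4 < 4 ^+ k.+1 * v by rewrite -ltr_pdivrMr // (lt_le_trans HN).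
apply: lt_le_trans (_ : 4 ^+ k.+1 * (v / 2) <= _); first by rewrite mulrA; lra.
by rewrite ler_pM2l // exprn_gt0.
Qed.

Lemma lacunary_at k b f v : annular f -> 3 / 4 <= 4 ^+ k.+1 * v <= 2 ->
  lacunary b f v = b k * f (4 ^+ k.+1 * v).
Proof.
move=> af /andP[k1 k2].
have p4 n : 0 < (4 : R) ^+ n by rewrite exprn_gt0.
have v0 : 0 < v by rewrite -(pmulr_rgt0 _ (p4 k.+1)); lra.
rewrite (@lacunaryE k.+1) => [|j kj].
  rewrite big_ord_recr /= big1 ?add0r // => -[j /= jk] _.
  rewrite (af (4 ^+ j.+1 * v)) ?mulr0 //; left.
  apply: le_lt_trans (_ : 4 ^+ k * v < _); last by move: k2; rewrite exprS -mulrA; lra.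
  by rewrite ler_pM2r // ler_weXn2l //; lra.
apply: af; right; apply: lt_le_trans (_ : 4 ^+ k.+2 * v <= _).
  by move: k1; rewrite (exprS _ k.+1) -mulrA; lra.
by rewrite ler_pM2r // ler_weXn2l //; lra.
Qed.

Lemma lacunary_single b f v : annular f -> lacunary b f v = 0 \/
  exists k, lacunary b f v = b k * f (4 ^+ k.+1 * v) /\ 3 / 4 <= 4 ^+ k.+1 * v <= 2.
Proof.
move=> af.
have [[k]|H] := pselect (exists k, 3 / 4 <= 4 ^+ k.+1 * v <= 2).
  by move=> kv; right; exists k; split => //; exact: lacunary_at.
left; rewrite (@lacunaryE 0) ?big_ord0 // => k _; apply: af.
case: (ltP (4 ^+ k.+1 * v) (3 / 4)) => [|h1]; first by left.
case: (ltP 2 (4 ^+ k.+1 * v)) => [|h2]; first by right.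
by exfalso; apply: H; exists k; rewrite h1.
Qed.

Definition decays r b := forall e, 0 < e ->
  exists K, forall k, (K <= k)%N -> `|b k| * (4 ^+ k.+1) ^+ r <= e.

Lemma decaysS r b : decays r.+1 b -> decays r b.
Proof.
move=> db e /db[K HK]; exists K => k /HK; apply: le_trans.
rewrite [_ ^+ r.+1]exprSr mulrA ler_peMr ?mulr_ge0 ?exprn_ge0 //.
by apply: exprn_ege1; lra.
Qed.

Lemma decaysW r s b : (r <= s)%N -> decays s b -> decays r b.
Proof.
move=> rs; rewrite -(subnK rs); elim: (s - r)%N => [//|n IH].
by rewrite addSn => /decaysS.
Qed.

(** On the k-th bump 4^(k+1) v >= 3/4, so 1 <= (4/3 * 4^(k+1) v)^r. Inserting this factor turns the
    decay of 4^(r(k+1)) b_k into the factor v^r. *)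
Lemma lacunary_near0 r b f (M : R) : annular f -> (forall x, `|f x| <= M) ->
  decays r b -> forall e, 0 < e ->
  \forall v \near (0 : R), `|lacunary b f v| <= e * `|v| ^+ r.
Proof.
move=> af fM db e e0; have M0 : 0 <= M by apply: le_trans (fM 0).
pose C := M * (4 / 3) ^+ r + 1.
have C0 : 0 < C by rewrite ltr_wpDl // mulr_ge0 // exprn_ge0 //; lra.
have [K HK] := db (e / C) (divr_gt0 e0 C0).
have p4 n : 0 < (4 : R) ^+ n by rewrite exprn_gt0.
have K0 : \forall v \near (0 : R), v < 3 / 4 / 4 ^+ K.
  by apply: lt_nbhsl; rewrite divr_gt0 //; lra.
near=> v.
have [->|[k [-> /andP[k1 k2]]]] := lacunary_single b v af.
  by rewrite normr0 mulr_ge0 ?exprn_ge0 // ltW.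
have v0 : 0 < v by rewrite -(pmulr_rgt0 _ (p4 k.+1)); lra.
have Kk : (K <= k)%N.
  rewrite leqNgt; apply/negP => kK.
  have : v < 3 / 4 / 4 ^+ K.
    by near: v.
  rewrite ltr_pdivlMr // => h.
  have : 4 ^+ k.+1 * v <= v * 4 ^+ K by rewrite mulrC ler_pM2l // ler_weXn2l //; lra.
  by lra.
rewrite normrM (gtr0_norm v0).
have h1 : 1 <= (4 / 3 * (4 ^+ k.+1 * v)) ^+ r by apply: exprn_ege1; lra.
have := HK k Kk; rewrite ler_pdivlMr // => h2.
apply: le_trans (_ : `|b k| * (M * (4 / 3 * (4 ^+ k.+1 * v)) ^+ r) <= _).
  rewrite ler_wpM2l //; apply: le_trans (fM _) _.
  by rewrite ler_peMr.
have -> : `|b k| * (M * (4 / 3 * (4 ^+ k.+1 * v)) ^+ r) =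
    `|b k| * (4 ^+ k.+1) ^+ r * (M * (4 / 3) ^+ r) * v ^+ r.
  rewrite (exprMn_comm _ (mulrC _ _)) (exprMn_comm r (mulrC (4 ^+ k.+1) v)).
  move: ((4 / 3) ^+ r) ((4 ^+ k.+1) ^+ r) (v ^+ r) => *; ring.
rewrite ler_wpM2r ?exprn_ge0 ?(ltW v0) //; apply: le_trans h2.
by rewrite ler_wpM2l ?mulr_ge0 ?exprn_ge0 // /C; lra.
Unshelve. all: by end_near. Qed.

Lemma annular_diff f (df : R -> R) : annular f ->
  (forall x : R, is_derive x (1 : R) f (df x)) -> annular df.
Proof.
move=> af fd x hx; have [_ <-] := fd x.
have nf : \forall y \near x, f y = cst 0 y.
  case: hx => hx; near=> y; apply: af; [left|right]; near: y.
    exact: lt_nbhsl.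
  exact: lt_nbhsr.
by rewrite (near_eq_derive _ nf) derive_cst.
Unshelve. all: by end_near. Qed.

Lemma annular_bounded f : annular f -> continuous f ->
  exists M, forall x, `|f x| <= M.
Proof.
move=> af cf.
have cn : {within `[3 / 4, 2 : R], continuous (fun x => `|f x|)}.
  by apply: continuous_subspaceT => x; apply: continuous_comp; [exact: cf|exact: norm_continuous].
have [|c _ Hc] := EVT_max _ cn; first by lra.
exists `|f c| => x; case: (boolP (x \in `[3 / 4, 2 : R])) => [/Hc //|].
rewrite in_itv /= negb_and -!ltNge => /orP hx.
by rewrite (af _ hx) normr0.
Qed.

(** Differentiation multiplies the k-th coefficient by 4^(k+1), which costs one order of [decays].
    For v > 0 the sum is finite; at 0 the derivative vanishes by [lacunary_near0] with r = 1. *)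
Lemma is_derive_lacunary b f (df : R -> R) (v : R) : annular f ->
  (forall x : R, is_derive x (1 : R) f (df x)) -> decays 1 b ->
  is_derive v (1 : R) (lacunary b f) (lacunary (fun k => b k * 4 ^+ k.+1) df v).
Proof.
move=> af fd db; have adf := annular_diff af fd.
have cf : continuous f.
  by move=> x; apply/differentiable_continuous/derivable1_diffP; have [] := fd x.
have [M fM] := annular_bounded af cf.
case: (ltrgtP v 0) => v0; last first.
- rewrite v0 (lacunary_le0 _ adf) //; apply: is_derive_0 => e e0.
  near=> h; rewrite addr0 (lacunary_le0 _ af (lexx 0)) subr0 -[`|h|]expr1.
  by near: h; exact: lacunary_near0 af fM db e e0.
- have [N HN] := lacunary_gt0 v0.
  rewrite (HN _ _ adf) //; last by lra.
  apply: (@near_eq_is_derive _ _ _ (\sum_(k < N) (fun w => b k * f (4 ^+ k.+1 * w)))).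
    near=> w; rewrite fct_sumE (HN _ _ af) //.
    by near: w; apply: lt_le_nbhsr; lra.
  apply: is_derive_sum => k.
  have dm : is_derive v (1 : R) (fun w : R => 4 ^+ k.+1 * w) (4 ^+ k.+1 : R).
    apply: (@is_derive_eq _ _ _ _ _ _ _ _ (is_deriveZ (4 ^+ k.+1) (is_derive_id v (1 : R)))).
    by rewrite /GRing.scale /= mulr1.
  have dc := @is_derive1_comp _ f (fun w : R => 4 ^+ k.+1 * w) v _ _ (fd _) dm.
  apply: (@is_derive_eq _ _ _ _ _ _ _ _ (is_deriveZ (b k) dc)).
  by rewrite /GRing.scale /=; ring.
- rewrite (lacunary_le0 _ adf) ?ltW //.
  apply: (@near_eq_is_derive _ _ _ (cst 0)).
  by near=> w; rewrite (lacunary_le0 _ af) // ltW //; near: w; exact: lt_nbhsl.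
Unshelve. all: by end_near. Qed.

Lemma Cr_lacunary r b f : annular f -> Coo setT (f : R^o -> R^o) ->
  decays r b -> Cr r setT (lacunary b f : R^o -> R^o).
Proof.
elim: r b f => [|r IH] b f af Cf db.
  move=> v _.
  have cf : continuous f by move=> x; exact: (Cf 0%N).
  have [M fM] := annular_bounded af cf.
  case: (ltrgtP v 0) => v0.
  - apply: (near_cst_continuous 0); near=> w.
    by rewrite lacunary_le0 // ltW //; near: w; exact: lt_nbhsl.
  - have [N HN] := lacunary_gt0 v0.
    have C : Cr 0 setT (fun w : R^o => \sum_(k < N) b k * f (4 ^+ k.+1 * w) : R^o).
      apply: Cr_sum => [|k]; first exact: openT.
      apply: CrZ; first exact: openT.
      apply: (Cr_comp (f := fun w : R^o => 4 ^+ k.+1 * w : R^o) openT _ _ (Cf 0%N)) => //.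
      by apply: CrZ; [exact: openT|exact: Cr_id].
    have := C v I; rewrite /prop_for /continuous_at (HN _ _ af); last by lra.
    apply: cvg_trans; apply: near_eq_cvg; near=> w; rewrite (HN _ _ af) //.
    by near: w; apply: lt_le_nbhsr; lra.
  - rewrite /prop_for /continuous_at v0 (lacunary_le0 _ af) //.
    apply/cvgr0Pnorm_le => e e0; have := lacunary_near0 af fM db e0.
    by apply: filterS => w; rewrite expr0 mulr1.
have fd (x : R) : is_derive x (1 : R) f ('d f x 1).
  have [dif _] := Cf 1%N; have dx := dif x I.
  by split; [exact/derivable1_diffP|rewrite deriveE].
have ld (v : R) := is_derive_lacunary v af fd (decaysW (ltn0Sn r) db).
split=> [v _|v]; first by have [] := is_derive_diff (ld v).
have Cl : Cr r setT (lacunary (fun k => b k * 4 ^+ k.+1) (fun x => 'd f x 1) : R^o -> R^o).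
  apply: IH; first exact: annular_diff af fd.
    by move=> s; have [_ /(_ 1)] := Cf s.+1.
  move=> e /db[K HK]; exists K => k /HK; rewrite normrM (gtr0_norm (x := 4 ^+ _)) ?exprn_gt0 //.
  by rewrite -mulrA -exprS.
apply: Cr_eq (CrZ v openT Cl) => [|x _]; first exact: openT.
by have [_ ->] := is_derive_diff (ld x).
Unshelve. all: by end_near. Qed.

End Lacunary.

(** * Zeta functions of cyclic words *)

Section FormalSeries.
Context {F : numFieldType}.
Implicit Types (a b c W : nat -> F) (n : nat).

Definition cauchy a b n : F := \sum_(i < n.+1) a i * b (n - i)%N.

Definition cauchy1 n : F := (n == 0)%:R.

(** Convolutions are coefficients of products of truncated polynomials, from which commutativity and
    associativity are inherited. *)
Lemma coef_cauchy N a b n : (n < N)%N ->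
  cauchy a b n = ((\poly_(i < N) a i) * (\poly_(i < N) b i))`_n.
Proof.
move=> nN; rewrite coefM; apply: eq_bigr => -[i /= i_n] _.
rewrite !coef_poly (leq_trans i_n nN) (leq_ltn_trans _ nN) //.
exact: leq_subr.
Qed.

Lemma cauchyC a b n : cauchy a b n = cauchy b a n.
Proof. by rewrite !(coef_cauchy _ _ (ltnSn n)) mulrC. Qed.

Lemma cauchyA a b c n : cauchy a (cauchy b c) n = cauchy (cauchy a b) c n.
Proof.
rewrite [LHS](coef_cauchy _ _ (ltnSn n)) [RHS](coef_cauchy _ _ (ltnSn n)).
set P := \poly_(i < _) a i; set Q := \poly_(i < _) c i.
transitivity ((P * ((\poly_(i < n.+1) b i) * Q))`_n); last rewrite mulrA.
  rewrite !coefM; apply: eq_bigr => -[i /= i_n] _; congr (_ * _).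
  by rewrite coef_poly ltnS leq_subr -coef_cauchy // ltnS leq_subr.
rewrite !coefM; apply: eq_bigr => -[i /= i_n] _; congr (_ * _).
by rewrite coef_poly i_n -coef_cauchy.
Qed.

Lemma eq_cauchy a a' b b' n : (forall i, (i <= n)%N -> a i = a' i) ->
  (forall i, (i <= n)%N -> b i = b' i) -> cauchy a b n = cauchy a' b' n.
Proof.
move=> aa bb; apply: eq_bigr => -[i /= i_n] _.
by rewrite aa // bb // leq_subr.
Qed.

Lemma cauchyDl a b c n : cauchy (fun i => a i + b i) c n = cauchy a c n + cauchy b c n.
Proof. by rewrite -big_split; apply: eq_bigr => i _; rewrite mulrDl. Qed.

Lemma cauchy1l a n : cauchy cauchy1 a n = a n.
Proof.
rewrite /cauchy big_ord_recl /= subn0 mul1r big1 ?addr0 // => i _.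
by rewrite /cauchy1 /= mul0r.
Qed.

(* W is the coefficient sequence of z a'(z) / a(z). *)
Definition logderiv a W := forall n, n%:R * a n = cauchy W a n.

Lemma logderiv_eq a W W' : logderiv a W -> (forall n, W n = W' n) -> logderiv a W'.
Proof. by move=> h WW n; rewrite h; apply: eq_cauchy. Qed.

Lemma logderivM a b W W' : logderiv a W -> logderiv b W' ->
  logderiv (cauchy a b) (fun n => W n + W' n).
Proof.
move=> aW bW n.
rewrite cauchyDl.
transitivity (cauchy (cauchy W a) b n + cauchy a (cauchy W' b) n).
  rewrite -big_split mulr_sumr; apply: eq_bigr => -[i /= i_n] _.
  have -> : n%:R = i%:R + (n - i)%:R :> F by rewrite -natrD subnKC.
  by rewrite -aW -bW; ring.
congr (_ + _); first by rewrite cauchyA.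
by rewrite !cauchyA; apply: eq_cauchy => // i _; exact: cauchyC.
Qed.

Lemma logderiv1 : logderiv cauchy1 (fun=> 0).
Proof.
move=> n; rewrite /cauchy big1 => [|i _]; last by rewrite mul0r.
by rewrite /cauchy1; case: n => [|n]; rewrite ?mul0r ?mulr0.
Qed.

Lemma logderiv_scale a W (c : F) :
  logderiv a W -> logderiv (fun n => a n * c ^+ n) (fun n => W n * c ^+ n).
Proof.
move=> aW n; rewrite mulrA aW mulr_suml; apply: eq_bigr => -[i /= i_n] _.
by rewrite mulrACA -exprD subnKC.
Qed.

Definition cauchyX a k : nat -> F := iter k (cauchy a) cauchy1.

Lemma logderivX a W k : logderiv a W -> logderiv (cauchyX a k) (fun n => k%:R * W n).
Proof.
move=> aW; elim: k => [|k IH].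
  by apply: logderiv_eq logderiv1 _ => n; rewrite mulr0n mul0r.
apply: logderiv_eq (logderivM aW IH) _ => n.
by rewrite -natr1 mulrDl mul1r addrC.
Qed.

Lemma logderiv_rec a W n : W 0%N = 0 -> logderiv a W ->
  n.+1%:R * a n.+1 = \sum_(i < n.+1) W i.+1 * a (n - i)%N.
Proof.
move=> W0 ->; rewrite /cauchy big_ord_recl W0 mul0r add0r.
by apply: eq_bigr => i _; rewrite lift0 subSS.
Qed.

(** In characteristic 0 the relation is a recursion for the coefficients. Identities of power series
    thus reduce to identities of logarithmic derivatives and of constant terms. *)
Lemma logderiv_uniq a b W : W 0%N = 0 -> logderiv a W -> logderiv b W ->
  a 0%N = b 0%N -> forall n, a n = b n.
Proof.
move=> W0 aW bW ab0 n; elim/ltn_ind: n => -[//|n] IH.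
have n0 : n.+1%:R != 0 :> F by rewrite pnatr_eq0.
apply: (mulfI n0); rewrite !(logderiv_rec _ W0) //.
by apply: eq_bigr => i _; rewrite IH // ltnS leq_subr.
Qed.

(** (n+1) a_(n+1) is a sum of n+1 terms, each at most M^(n+1) by induction, so no constant is lost.
    This uniformity is what controls all partial products at once. *)
Lemma logderiv_bound a W (M : F) : 0 <= M -> W 0%N = 0 -> a 0%N = 1 ->
  logderiv a W -> (forall n, `|W n| <= M ^+ n) -> forall n, `|a n| <= M ^+ n.
Proof.
move=> M0 W0 a0 aW WM; elim/ltn_ind => -[|n] IH; first by rewrite a0 normr1 expr0.
have n0 : 0 < n.+1%:R :> F by rewrite ltr0n.
rewrite -(ler_pM2l n0) -[X in X * `|_|](gtr0_norm n0) -normrM (logderiv_rec _ W0) //.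
apply: le_trans (ler_norm_sum _ _ _) _.
rewrite -[X in _ <= X%:R * _]card_ord -sumr_const mulr_suml.
apply: ler_sum => -[i /= i_n] _; rewrite normrM mul1r.
rewrite -[X in _ <= M ^+ X](subnKC i_n) exprD subSS.
by rewrite ler_pM // IH // ltnS leq_subr.
Qed.

End FormalSeries.

Section FpsExp.
Context {R : realType}.
Local Notation C := R[i].
Variable a : nat -> C.

Let A N : {poly C} := \sum_(1 <= i < N.+1) a i *: 'X^i.

Let coefA N i : (A N)`_i = if (0 < i <= N)%N then a i else 0.
Proof.
rewrite /A coef_sum.
under eq_bigr do rewrite coefZ coefXn.
case: ifP => [/andP[i0 iN]|hi].
  rewrite (big_rem i) /=; last by rewrite mem_index_iota i0.
  rewrite eqxx mulr1 big1_seq ?addr0 // => j /andP[_].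
  by rewrite mem_rem_uniq ?iota_uniq // inE => /andP[/negPf]; rewrite eq_sym => ->; rewrite mulr0.
rewrite big1_seq // => j /andP[_]; rewrite mem_index_iota ltnS => hj.
by case: eqP hi hj => [->|_ _ _]; [move=> ->|rewrite mulr0].
Qed.

Let coefA_exp_small N k j : (j < k)%N -> (A N ^+ k)`_j = 0.
Proof.
move=> jk; have -> : A N = (\poly_(i < N) a i.+1) * 'X.
  apply/polyP => i; by rewrite coefMX coefA coef_poly; case: i.
by rewrite exprMn coefMXn jk.
Qed.

Let coefA_exp N k j : (j <= N)%N -> (A N ^+ k)`_j = (A j ^+ k)`_j.
Proof.
move=> jN; apply/eqP; rewrite -subr_eq0 -coefB subrXX.
have -> : A N - A j = (\poly_(i < N) (a (i + j.+1)%N * (i + j.+1 <= N)%:R)) * 'X^(j.+1).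
  apply/polyP => i; rewrite coefMXn coefB !coefA coef_poly ltnS.
  case: (leqP i j) => ij; first by rewrite (leq_trans ij jN) subrr.
  rewrite andbF subr0 (leq_ltn_trans _ ij) //= subnK //.
  case: (leqP i N) => iN; rewrite ?mulr1 ?mulr0 ?if_same //.
  by rewrite ifT // (leq_trans _ iN) // ltn_subrL (leq_ltn_trans _ ij).
by rewrite mulrAC coefMXn ltnSn.
Qed.

(** [fps_exp] truncates at a bound that varies with the degree. Here one polynomial yields all low
    degrees, and can then be differentiated. *)
Let partial_exp N m j : (j <= N)%N -> (j < m)%N ->
  (\sum_(k < m) (k`!)%:R^-1 *: A N ^+ k)`_j = fps_exp a j.
Proof.
move=> jN jm; rewrite /fps_exp big_mkord -/(A j) !coef_sum.
rewrite -(subnKC jm) big_split_ord /= [X in _ + X]big1 ?addr0 => [|i _].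
  by apply: eq_bigr => i _; rewrite !coefZ coefA_exp.
by rewrite coefZ coefA_exp_small ?mulr0 // ltn_addr.
Qed.

Lemma fps_exp0 : fps_exp a 0 = 1.
Proof.
by rewrite /fps_exp big_nat1 expr0 fact0 invr1 scale1r coef1.
Qed.

(** The truncated exponential satisfies E' = A' E with one term fewer on the right, and the missing
    term does not reach the degree considered. *)
Lemma logderiv_fps_exp : logderiv (fps_exp a) (fun n => n%:R * a n).
Proof.
move=> n; rewrite /cauchy big_ord_recl !mul0r add0r.
case: n => [|n]; first by rewrite big_ord0 mul0r.
rewrite -(@partial_exp n.+1 n.+2) // mulr_natl -coef_deriv raddf_sum /=.
rewrite big_ord_recl expr0 derivZ derivC scaler0 add0r.
have -> : \sum_(i < n.+1) ((lift ord0 i)`!%:R^-1 *: A n.+1 ^+ lift ord0 i)^`() =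
    (A n.+1)^`() * \sum_(k < n.+1) (k`!)%:R^-1 *: A n.+1 ^+ k.
  rewrite mulr_sumr; apply: eq_bigr => i _; rewrite lift0 derivZ deriv_exp /=.
  rewrite -scalerAr -(scaler_nat i.+1 (_ * _)) scalerA; congr (_ *: _).
  by rewrite factS natrM invfM mulrAC mulVf ?mul1r // pnatr_eq0.
rewrite coefM; apply: eq_bigr => i _; have i_n := ltn_ord i; rewrite /bump leq0n add1n subSS.
rewrite coef_deriv coefA ltnS i_n /= mulr_natl; congr (_ * _).
by rewrite partial_exp // ?ltnS ?leq_subr // leqW // leq_subr.
Qed.

End FpsExp.

Section CyclicWords.
Context {F : numFieldType}.
Variable b : nat -> F.

(* Index of the first letter [true] of s, when s is followed by a sequence whose
   first [true] has index j. *)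
Fixpoint lead (s : seq bool) (j : nat) : nat :=
  if s is x :: s' then (if x then 0 else (lead s' j).+1)%N else j.

Fixpoint block_weight (s : seq bool) (j : nat) : F :=
  if s is x :: s' then (if x then b (lead s' j) else 1) * block_weight s' j else 1.

(* Weight of the cyclic word made of i letters [false] followed by s. *)
Definition cyclic_weight (i : nat) (s : seq bool) : F :=
  if has id s then block_weight s (i + lead s 0) else 1.

(** Total weight of the words made of [true], then k letters [false], then n free letters, when what
    follows has its first [true] at index i. *)
Definition open_sum n k i : F :=
  \sum_(s : n.-tuple bool) b (k + lead s i) * block_weight s i.

Definition cyclic_sum n i : F := \sum_(s : n.-tuple bool) cyclic_weight i s.

Lemma sum_tupleS n (f : seq bool -> F) :
  \sum_(s : n.+1.-tuple bool) f s =
  \sum_(s : n.-tuple bool) f (true :: s) + \sum_(s : n.-tuple bool) f (false :: s).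
Proof.
pose h (p : bool * n.-tuple bool) : n.+1.-tuple bool := cons_tuple p.1 p.2.
pose h' (t : n.+1.-tuple bool) : bool * n.-tuple bool := (thead t, behead_tuple t).
rewrite (reindex h) /=; last first.
  exists h' => [[x s] _|t _]; last by apply: val_inj; rewrite /= [RHS](congr1 val (tuple_eta t)).
  by rewrite /h' /h theadE; congr (_, _); apply: val_inj.
have -> : \sum_j f (h j) = \sum_x \sum_(s : n.-tuple bool) f (x :: s).
  by rewrite pair_big; apply: eq_bigr.
by rewrite big_bool.
Qed.

Lemma sum_tuple0 (f : seq bool -> F) : \sum_(s : 0.-tuple bool) f s = f [::].
Proof.
rewrite (big_pred1 [tuple]) // => t; apply/esym/eqP.
by apply: val_inj; rewrite /= (tuple0 t).
Qed.

Lemma open_sum0 k i : open_sum 0 k i = b (k + i).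
Proof. by rewrite /open_sum (sum_tuple0 (fun s => b (k + lead s i) * block_weight s i)) /= mulr1. Qed.

Lemma open_sumS n k i :
  open_sum n.+1 k i = b k * open_sum n 0 i + open_sum n k.+1 i.
Proof.
rewrite /open_sum (sum_tupleS _ (fun s => b (k + lead s i) * block_weight s i)) /=.
rewrite mulr_sumr addn0; congr (_ + _).
by apply: eq_bigr => s _; rewrite mul1r addnS.
Qed.

Lemma cyclic_sumS n i : cyclic_sum n.+1 i = open_sum n 0 i + cyclic_sum n i.+1.
Proof.
rewrite /cyclic_sum (sum_tupleS _ (cyclic_weight i)); congr (_ + _).
  by apply: eq_bigr => s _; rewrite /cyclic_weight /= addn0 add0n.
by apply: eq_bigr => s _; rewrite /cyclic_weight /= mul1r addnS.
Qed.

(** [l] is the position of the first [true] among the free letters. Cutting the cyclic word there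
    leaves i + l letters [false] before it closes up. The summand 1 is the word without [true]. *)
Lemma cyclic_sumE n i :
  cyclic_sum n i = 1 + \sum_(l < n) open_sum (n.-1 - l) 0 (i + l).
Proof.
elim: n i => [|n IH] i.
  by rewrite /cyclic_sum (sum_tuple0 (cyclic_weight i)) big_ord0 addr0.
rewrite cyclic_sumS IH big_ord_recl /= subn0 addn0 addrCA; congr (_ + (_ + _)).
by apply: eq_bigr => l _; rewrite addSnnS /bump leq0n add1n -subn1 -subnDA add1n.
Qed.

(* Decomposition according to the next letter [true]. *)
Lemma open_sum_renewal n k i : open_sum n k i =
  \sum_(l < n) b (k + (n.-1 - l)) * open_sum l 0 i + b (k + n + i).
Proof.
elim: n k => [|n IH] k; first by rewrite big_ord0 add0r addn0 open_sum0.
rewrite open_sumS (IH k.+1) big_ord_recr /= subnn addn0 addrA [X in X + _ = _]addrC.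
congr (_ + _ + _); last by rewrite addnS addSn.
apply: eq_bigr => -[l /= ln] _.
by rewrite addSnnS; congr (b (_ + _) * _); rewrite -subn1 -subnDA add1n subnSK.
Qed.

(* coefficients of 1 - \sum_j b_j z^(j+1) *)
Definition renewal_den n : F := if n is n'.+1 then - b n' else 1.

Definition renewal_trace n : F := \sum_(l < n) open_sum (n.-1 - l) 0 l.

(** A Newton identity. The renewal equation is applied to every open sum: the boundary term is b_m
    in each of the m + 1 summands, and the remaining terms regroup, according to the length of the
    shorter cyclic word, into lower traces. *)
Lemma renewal_traceS m : renewal_trace m.+1 =
  m.+1%:R * b m + \sum_(l < m.+1) renewal_trace l * b (m - l).
Proof.
have -> : \sum_(l < m.+1) renewal_trace l * b (m - l) =
    \sum_(i < m.+1) \sum_(l < m - i) b ((m - i).-1 - l) * open_sum l 0 i.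
  transitivity (\sum_(l < m.+1) \sum_(i < m.+1 | (i < l)%N)
      open_sum (l.-1 - i) 0 i * b (m - l)).
    apply: eq_bigr => -[l /= lm] _; rewrite /renewal_trace mulr_suml.
    by rewrite (big_ord_widen m.+1 (fun i => open_sum (l.-1 - i) 0 i * b (m - l))) // ltnW.
  rewrite (exchange_big_dep xpredT) //=; apply: eq_bigr => -[i /= im] _.
  rewrite -(big_mkord (fun l => i < l)%N (fun l => open_sum (l.-1 - i) 0 i * b (m - l))).
  rewrite -(big_mkord xpredT (fun l => b ((m - i).-1 - l) * open_sum l 0 i)).
  have -> : \sum_(0 <= l < m.+1 | (i < l)%N) open_sum (l.-1 - i) 0 i * b (m - l) =
      \sum_(i.+1 <= l < m.+1) open_sum (l.-1 - i) 0 i * b (m - l).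
    by rewrite [RHS](big_nat_widenl _ 0%N).
  rewrite -{1}[i.+1]add0n big_addn subSS; apply: eq_bigr => l _.
  by rewrite addnS /= addnK mulrC -subn1 -!subnDA addnC add1n addnS addnC.
rewrite /renewal_trace -[X in X%:R]card_ord -sumr_const mulr_suml -big_split /=.
apply: eq_bigr => -[i /= im] _.
by rewrite open_sum_renewal !add0n subnK // mul1r addrC.
Qed.

Lemma logderiv_renewal : logderiv renewal_den (fun n => - renewal_trace n).
Proof.
move=> [|n]; first by rewrite mul0r /cauchy big_ord1 /renewal_trace big_ord0 oppr0 mul0r.
rewrite /cauchy big_ord_recr /= subnn mulr1 renewal_traceS opprD addrCA.
rewrite mulrN -[LHS]addr0; congr (_ + _).
rewrite -sumrN -big_split /= big1 // => -[i /= i_n] _.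
by rewrite (subSn (i_n : (i <= n)%N)) /=; ring.
Qed.

(** Coefficients of 1 - z, the factor that accounts for the cyclic word without [true], that is, for
    the summand 1 of [cyclic_sumE]. *)
Definition one_subX (n : nat) : F := (n == 0%N)%:R - (n == 1%N)%:R.

Lemma logderiv_one_subX : logderiv one_subX (fun n => - (0 < n)%N%:R).
Proof.
case=> [|[|n]]; rewrite /cauchy /one_subX.
- by rewrite mul0r big_ord1 oppr0 mul0r.
- by rewrite !big_ord_recl big_ord0 /= /bump /= !mulr0n; ring.
rewrite 2!big_ord_recr /= subnn subSnn big1 /= => [|[i /= i_n] _].
  by rewrite !mulr0n; ring.
have -> : (n.+2 - i == 0)%N = false by apply/negP => /eqP; lia.
have -> : (n.+2 - i == 1)%N = false by apply/negP => /eqP; lia.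
by rewrite subrr mulr0.
Qed.

Definition zeta_den : nat -> F := cauchy one_subX renewal_den.

Lemma logderiv_zeta_den :
  logderiv zeta_den (fun n => - (if n is 0 then 0 else cyclic_sum n 0)).
Proof.
apply: logderiv_eq (logderivM logderiv_one_subX logderiv_renewal) _ => -[|n].
  by rewrite /renewal_trace big_ord0 !oppr0 addr0.
by rewrite cyclic_sumE /renewal_trace -opprD; congr (- (_ + _)).
Qed.

Lemma open_sum_bound (B : F) n k i : 1 <= B -> (forall j, `|b j| <= B) ->
  `|open_sum n k i| <= B * (2 * B) ^+ n.
Proof.
move=> B1 bB; have B0 : 0 <= B by apply: le_trans B1.
elim: n k => [|n IH] k; first by rewrite open_sum0 mulr1.
rewrite open_sumS exprS; apply: le_trans (ler_normD _ _) _; rewrite normrM.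
apply: le_trans (_ : B * (B * (2 * B) ^+ n) + B * (B * (2 * B) ^+ n) <= _).
  apply: lerD; first by apply: ler_pM.
  apply: le_trans (IH _) _; rewrite ler_wpM2l // ler_peMl //.
  by rewrite exprn_ge0 // mulr_ge0.
by rewrite [X in X <= _](_ : _ = B * (2 * B * (2 * B) ^+ n)) //; ring.
Qed.

Lemma cyclic_sum_bound (B : F) n : 1 <= B -> (forall j, `|b j| <= B) ->
  `|cyclic_sum n.+1 0| <= (8 * B) ^+ n.+1.
Proof.
move=> B1 bB; have B0 : 0 <= B by apply: le_trans B1.
have B2 : 1 <= 2 * B by rewrite mulr_ege1 // ler1n.
rewrite cyclic_sumE; apply: le_trans (ler_normD _ _) _; rewrite normr1.
have h : `|\sum_(l < n.+1) open_sum (n - l) 0 (0 + l)| <= n.+1%:R * (2 * B) ^+ n.+1.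
  apply: le_trans (ler_norm_sum _ _ _) _.
  rewrite -[X in _ <= X%:R * _]card_ord -sumr_const mulr_suml.
  apply: ler_sum => -[l /= ln] _; rewrite mul1r.
  apply: le_trans (open_sum_bound _ _ _ B1 bB) _.
  apply: le_trans (_ : (2 * B) ^+ (n - l).+1 <= _).
    rewrite exprS ler_wpM2r ?exprn_ge0 ?mulr_ge0 //.
    by rewrite ler_peMl // ler1n.
  by rewrite ler_weXn2l // ltnS leq_subr.
apply: le_trans (lerD (lexx 1) h) _.
apply: le_trans (_ : n.+2%:R * (2 * B) ^+ n.+1 <= _).
  by rewrite -[n.+2%:R]natr1 [X in _ <= X]mulrDl mul1r [X in _ <= X]addrC lerD2r exprn_ege1.
(* The extra factor 4 absorbs the number of summands: n + 2 <= 4^(n+1). *)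
have -> : 8 * B = 4 * (2 * B) by rewrite mulrA -natrM.
rewrite [X in _ <= X]exprMn ler_wpM2r ?exprn_ge0 ?mulr_ge0 //.
rewrite -natrX ler_nat; elim: n {h} => // n IH.
by rewrite expnS; apply: leq_trans (_ : 4 * n.+2 <= _)%N; [lia|rewrite leq_mul2l].
Qed.

End CyclicWords.

(** * Convergence *)

Section ComplexSeries.
Context {R : realType}.
Local Notation C := R[i].

Lemma gt0_complexE (e : C) : 0 < e -> e = (complex.Re e)%:C /\ 0 < complex.Re e.
Proof. by case: e => x y; rewrite ltcE /= => /andP[/eqP -> ->]. Qed.

Lemma cvg_real_complex (u : nat -> R) (l : R) :
  u @ \oo --> l -> (fun n => (u n)%:C : C^o) @ \oo --> (l%:C : C^o).
Proof.
move=> ul; apply/cvgrPdist_le => e e0; have [-> e0'] := gt0_complexE e0.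
move/cvgrPdist_le : ul => /(_ _ e0'); apply: filterS => n h.
by rewrite -rmorphB /= normc_def /= expr0n addr0 sqrtr_sqr lecR.
Qed.

Lemma cvg_complex (u : nat -> C) (x y : R) :
  (fun n => complex.Re (u n)) @ \oo --> x -> (fun n => complex.Im (u n)) @ \oo --> y ->
  (u : nat -> C^o) @ \oo --> (x +i* y : C^o).
Proof.
move=> ux uy; have -> : (x +i* y) = x%:C + 'i%C * y%:C.
  by apply/eqP; rewrite eq_complex /=; apply/andP; split; apply/eqP; ring.
have -> : u = (fun n => (complex.Re (u n))%:C + 'i%C * (complex.Im (u n))%:C).
  apply/funext => n; case: (u n) => a b; apply/eqP.
  by rewrite eq_complex /=; apply/andP; split; apply/eqP; ring.
apply: (@cvgD _ C^o); first exact: cvg_real_complex.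
apply: (@cvgM C); first exact: cvg_cst.
exact: cvg_real_complex.
Qed.

Lemma cvg_norm_le (u : nat -> C) (l e : C) p : (u : nat -> C^o) @ \oo --> (l : C^o) ->
  (forall n, (p <= n)%N -> `|u n| <= e) -> `|l| <= e.
Proof.
move=> ul ue.
have er : e \is Num.real by rewrite ger0_real // (le_trans _ (ue p (leqnn p))).
rewrite real_leNgt // ?normr_real //; apply/negP => el.
have d0 : 0 < (`|l| - e) / 2 by rewrite divr_gt0 ?subr_gt0.
move/cvgrPdist_le : ul => /(_ _ d0) [N _ HN].
have h1 := HN (maxn N p) (leq_maxl _ _); have h2 := ue _ (leq_maxr N p).
have := lerD h1 h2.
have h3 : `|l| <= `|l - u (maxn N p)| + `|u (maxn N p)|.
  by rewrite -[X in `|X| <= _](subrK (u (maxn N p)) l) ler_normD.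
move=> h4; have := le_trans h3 h4.
rewrite -subr_ge0 (_ : _ - _ = (e - `|l|) / 2); last by field.
by rewrite pmulr_lge0 ?invr_gt0 // subr_ge0 => /(lt_le_trans el); rewrite ltxx.
Qed.

Lemma cvg_pow_half : (fun n => (2 ^- n : C) : C^o) @ \oo --> (0 : C^o).
Proof.
have h : (fun n => (2^-1 : R) ^+ n) @ \oo --> (0 : R).
  by apply: cvg_expr; rewrite gtr0_norm //; lra.
have := cvg_real_complex h; rewrite rmorph0; apply: cvg_trans.
by apply: near_eq_cvg; near=> n; rewrite rmorphXn /= fmorphV rmorph_nat exprVn.
Unshelve. all: by end_near. Qed.

Lemma half_pow_lt (e : C) : 0 < e -> exists p, forall n, (p <= n)%N -> 2 ^- n <= e.
Proof.
move=> e0; have /cvgrPdist_le/(_ _ e0)[p _ Hp] := cvg_pow_half.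
by exists p => n /Hp /=; rewrite sub0r normrN ger0_norm // invr_ge0 exprn_ge0.
Qed.

(** Two rates occur: 1/2 is enough for convergence with explicit tails, while 1/4 is asked of the
    factors of a Cauchy product, because (n + 1) 4^-n <= 2^-n. *)
Definition dominated (r : nat) (c : nat -> C) := forall n, `|c n| <= r%:R ^- n.

Lemma dominatedW (r s : nat) c : (0 < r)%N -> (r <= s)%N -> dominated s c -> dominated r c.
Proof.
move=> r0 rs cs n; apply: le_trans (cs n) _.
rewrite lef_pV2 ?posrE ?exprn_gt0 ?ltr0n // ?(leq_trans r0) //.
by rewrite lerXn2r ?nnegrE ?ler0n // ler_nat.
Qed.

Lemma dominated_tail c p n : dominated 2 c -> (p <= n)%N ->
  `|\sum_(p <= k < n) c k| <= 2 * 2 ^- p.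
Proof.
move=> c8 pn; apply: le_trans (ler_norm_sum _ _ _) _.
suff : \sum_(p <= k < n) `|c k| <= 2 * 2 ^- p - 2 * 2 ^- n.
  move=> /le_trans; apply; rewrite gerBl mulr_ge0 // invr_ge0 exprn_ge0 //.
elim: n pn => [|n IH]; first by rewrite leqn0 => /eqP ->; rewrite big_geq // subrr.
rewrite leq_eqVlt => /orP[/eqP <-|pn]; first by rewrite big_geq // subrr.
rewrite big_nat_recr //=; apply: le_trans (lerD (IH pn) (c8 n)) _.
rewrite exprS invfM mulrA mulfV ?pnatr_eq0 // mul1r.
by rewrite [X in X <= _](_ : _ = 2 * 2 ^- p - 2 ^- n) //; ring.
Qed.

Lemma dominated_cvg c : dominated 2 c -> cvgn (series c : nat -> C^o).
Proof.
move=> c8.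
have g8 : cvgn (series (fun n => (2^-1 : R) ^+ n)).
  have -> : (fun n => (2^-1 : R) ^+ n) = geometric 1 2^-1.
    by apply/funext => n; rewrite /= mul1r.
  by apply: is_cvg_geometric_series; rewrite gtr0_norm //; lra.
have H (f : C -> R) : (forall z, `|f z|%:C <= `|z|) -> cvgn (series (fun n => f (c n))).
  move=> fz; apply: normed_cvg; apply: series_le_cvg g8 => n //=.
  rewrite exprVn -lecR (le_trans (fz _)) // (le_trans (c8 n)) //.
  by rewrite fmorphV rmorphXn /= rmorph_nat.
have HR : cvgn (series (fun n => complex.Re (c n))).
  apply: H => -[x y]; rewrite normc_def lecR /= -sqrtr_sqr.
  by apply: ler_wsqrtr; rewrite lerDl sqr_ge0.
have HI : cvgn (series (fun n => complex.Im (c n))).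
  apply: H => -[x y]; rewrite normc_def lecR /= -sqrtr_sqr.
  by apply: ler_wsqrtr; rewrite lerDr sqr_ge0.
apply/cvg_ex; exists (limn (series (fun n => complex.Re (c n))) +i*
                      limn (series (fun n => complex.Im (c n)))).
apply: cvg_complex.
  have -> : (fun n => complex.Re (series c n)) = series (fun n => complex.Re (c n)).
    by apply/funext => n; rewrite /series /= raddf_sum.
  exact: HR.
have -> : (fun n => complex.Im (series c n)) = series (fun n => complex.Im (c n)).
  by apply/funext => n; rewrite /series /= raddf_sum.
exact: HI.
Qed.

Definition csum (c : nat -> C) : C := limn (series c : nat -> C^o).

Lemma dominated_csum_tail c p : dominated 2 c ->
  `|csum c - \sum_(0 <= k < p) c k| <= 2 * 2 ^- p.
Proof.
move=> c8.
have h : (fun n => (series c n - \sum_(0 <= k < p) c k : C^o)) @ \oo -->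
    (csum c - \sum_(0 <= k < p) c k : C^o).
  by apply: (@cvgB _ C^o); [exact: dominated_cvg|exact: cvg_cst].
apply: (cvg_norm_le (p := p) h) => n pn.
have -> : series c n = \sum_(0 <= k < p) c k + \sum_(p <= k < n) c k.
  by rewrite /series /= (@big_cat_nat _ _ _ p 0 n).
by rewrite addrAC subrr add0r; exact: dominated_tail.
Qed.

Lemma cvg_sum_nat (c : nat -> nat -> C) (d : nat -> C) p :
  (forall n, (fun N => c N n : C^o) @ \oo --> (d n : C^o)) ->
  (fun N => \sum_(0 <= k < p) c N k : C^o) @ \oo --> (\sum_(0 <= k < p) d k : C^o).
Proof.
move=> cd; elim: p => [|p IH].
  have -> : (fun N => \sum_(0 <= k < 0) c N k : C^o) = (fun=> 0).
    by apply/funext => N; rewrite big_geq.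
  by rewrite big_geq //; exact: cvg_cst.
have -> : (fun N => \sum_(0 <= k < p.+1) c N k : C^o) =
    (fun N => \sum_(0 <= k < p) c N k + c N p : C^o).
  by apply/funext => N; rewrite big_nat_recr.
have -> : \sum_(0 <= k < p.+1) d k = \sum_(0 <= k < p) d k + d p by rewrite big_nat_recr.
by apply: (@cvgD _ C^o); [exact: IH|exact: cd].
Qed.

(** Tannery's theorem: a cut at p independent of N leaves uniformly small tails, and the finite head
    converges term by term. *)
Lemma csum_tannery (c : nat -> nat -> C) (d : nat -> C) :
  (forall N, dominated 2 (c N)) -> dominated 2 d ->
  (forall n, (fun N => c N n : C^o) @ \oo --> (d n : C^o)) ->
  (fun N => csum (c N) : C^o) @ \oo --> (csum d : C^o).
Proof.
move=> c8 d8 cd; apply/cvgrPdist_le => e e0.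
(* Two tails of at most e/3 each and a head of at most e/6. *)
have e6 : 0 < e / 6 by rewrite divr_gt0.
have [p Hp] := half_pow_lt e6.
have fin := cvg_sum_nat cd (p := p).
move/cvgrPdist_le : fin => /(_ _ e6); apply: filterS => N hN.
have h1 := dominated_csum_tail p d8; have h2 := dominated_csum_tail p (c8 N).
have h3 := Hp p (leqnn p).
set S := \sum_(_ <= _ < _) d _ in h1 hN; set S' := \sum_(_ <= _ < _) c N _ in h2 hN.
have -> : csum d - csum (c N) = (csum d - S) + (S - S') - (csum (c N) - S') by ring.
apply: le_trans (ler_normB _ _) _.
apply: le_trans (lerD (ler_normD _ _) (lexx _)) _.
apply: le_trans (lerD (lerD h1 hN) h2) _.
rewrite -subr_ge0.
have -> : e - (2 * 2 ^- p + e / 6 + 2 * 2 ^- p) = 4 * (e / 6 - 2 ^- p) + e / 6 by field; rewrite expf_neq0 // pnatr_eq0.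
by rewrite addr_ge0 ?mulr_ge0 ?subr_ge0 // ltW.
Qed.

Lemma dominated_cauchy (a b : nat -> C) : dominated 4 a -> dominated 4 b ->
  dominated 2 (cauchy a b).
Proof.
move=> a4 b4 n; apply: le_trans (ler_norm_sum _ _ _) _.
apply: le_trans (_ : n.+1%:R * 4 ^- n <= _).
  rewrite -[X in _ <= X%:R * _]card_ord -sumr_const mulr_suml.
  apply: ler_sum => -[i /= i_n] _; rewrite mul1r normrM.
  by rewrite -[X in 4 ^- X](subnKC (i_n : (i <= n)%N)) exprD invfM ler_pM.
have -> : 4 ^- n = 2 ^- n * 2 ^- n :> C by rewrite -invfM -exprMn -natrM.
rewrite mulrA ler_piMl ?invr_ge0 ?exprn_ge0 // ler_pdivrMr ?exprn_gt0 // mul1r.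
by rewrite -natrX ler_nat; apply: ltn_expl.
Qed.

Lemma csum_cauchy (a b : nat -> C) : dominated 4 a -> dominated 4 b ->
  csum (cauchy a b) = csum a * csum b.
Proof.
move=> a4 b4; have a2 : dominated 2 a by exact: dominatedW a4.
have b2 : dominated 2 b by exact: dominatedW b4.
have ab : (fun n => series a n * series b n : C^o) @ \oo --> (csum a * csum b : C^o).
  by apply: (@cvgM C); exact: dominated_cvg.
have diff0 : (fun n => series (cauchy a b) n - series a n * series b n : C^o) @ \oo --> (0 : C^o).
  apply/cvgrPdist_le => e e0.
  have [p Hp] := half_pow_lt (divr_gt0 e0 (ltr0n C 2)).
  exists p => // n /= /Hp; rewrite sub0r normrN ler_pdivlMr ?ltr0n // mulrC.
  apply: le_trans; rewrite /series /= !big_mkord.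
  (* Truncation at n makes the product of partial sums a product of two polynomials evaluated at 1,
     that is, a sum of the truncated convolution up to 2n. Below n this convolution is the full one,
     so the error is a tail beyond n. *)
  pose trunc (c : nat -> C) k := if (k < n)%N then c k else 0.
  have t4 c : dominated 4 c -> dominated 4 (trunc c).
    by move=> c4 k; rewrite /trunc; case: ifP => // _; rewrite normr0 invr_ge0 exprn_ge0.
  have t2 := dominated_cauchy (t4 _ a4) (t4 _ b4).
  have -> : \sum_(k < n) cauchy a b k = \sum_(0 <= k < n) cauchy (trunc a) (trunc b) k.
    rewrite big_mkord; apply: eq_bigr => -[k /= kn] _.
    by apply: eq_cauchy => i ik; rewrite /trunc (leq_ltn_trans ik kn).
  have -> : (\sum_(k < n) a k) * (\sum_(k < n) b k) =
      \sum_(0 <= k < n + n) cauchy (trunc a) (trunc b) k.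
    transitivity ((\poly_(i < n) a i) * \poly_(i < n) b i).[1].
      by rewrite hornerM !horner_poly; congr (_ * _); apply: eq_bigr => i _; rewrite expr1n mulr1.
    rewrite (@horner_coef_wide _ (n + n)); last first.
      apply: leq_trans (size_polyMleq _ _) _; apply: leq_trans (leq_pred _) _.
      by rewrite leq_add // size_poly.
    rewrite big_mkord; apply: eq_bigr => k _; rewrite expr1n mulr1 coefM.
    by apply: eq_bigr => i _; rewrite !coef_poly.
  have -> : \sum_(0 <= k < n + n) cauchy (trunc a) (trunc b) k =
      \sum_(0 <= k < n) cauchy (trunc a) (trunc b) k +
      \sum_(n <= k < n + n) cauchy (trunc a) (trunc b) k.
    by rewrite (@big_cat_nat _ _ _ n 0 (n + n)) ?leq_addr.
  rewrite opprD addrA subrr add0r normrN.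
  exact: dominated_tail (leq_addr _ _).
have h := @cvgD _ C^o _ _ _ _ _ _ _ diff0 ab.
apply: (@cvg_lim C^o (@norm_hausdorff _ C^o)); rewrite -[csum a * _]add0r.
have -> : (series (cauchy a b) : nat -> C^o) =
    (fun n => series (cauchy a b) n - series a n * series b n) + (fun n => series a n * series b n).
  by apply/funext => n; rewrite fctE subrK.
exact: h.
Qed.

End ComplexSeries.

(** * The negative binomial series *)

Section NegativeBinomial.
Context {R : realType}.
Local Notation C := R[i].

Lemma cvg0_bound (u : nat -> C) (K : C) : (forall n, `|u n| <= K * 2 ^- n) ->
  (u : nat -> C^o) @ \oo --> (0 : C^o).
Proof.
move=> uK; apply/cvgrPdist_le => e e0.
have K0 : 0 <= K by have := uK 0%N; rewrite invr1 mulr1; apply: le_trans.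
have K1 : 0 < K + 1 by rewrite ltr_wpDl.
have [p Hp] := half_pow_lt (divr_gt0 e0 K1).
exists p => // n /= /Hp; rewrite sub0r normrN ler_pdivlMr // => h.
apply: le_trans (uK n) _; apply: le_trans h; rewrite mulrC.
by rewrite ler_wpM2l ?invr_ge0 ?exprn_ge0 // lerDl.
Qed.

Lemma bin_le_exp2 n k : ('C(n, k) <= 2 ^ n)%N.
Proof.
case: (leqP k n) => kn; last by rewrite bin_small.
rewrite -[2%N]/(1 + 1)%N expnDn (bigD1 (Ordinal (kn : (k < n.+1)%N))) //=.
by rewrite !exp1n !muln1 leq_addr.
Qed.

(** Pascal's rule: multiplication by 1 - q lowers the order j by one, up to a remainder. For |q| <=
    1/4 this remainder is at most 2^(N+j) 4^-N, which permits induction on j in the limit. *)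
Lemma partial_negative_binomial (q : C) j N :
  (1 - q) * (\sum_(k < N) ('C(k + j.+1, j.+1))%:R * q ^+ k) =
  \sum_(k < N) ('C(k + j, j))%:R * q ^+ k - ('C(N + j, j.+1))%:R * q ^+ N.
Proof.
elim: N => [|N IH]; first by rewrite !big_ord0 bin_small // mul0r subr0 mulr0.
have e1 : 'C(N + j.+1, j.+1) = ('C(N + j, j.+1) + 'C(N + j, j))%N by rewrite addnS binS.
have e2 : 'C(N.+1 + j, j.+1) = ('C(N + j, j.+1) + 'C(N + j, j))%N by rewrite addSn binS.
by rewrite !big_ord_recr /= mulrDr IH e1 e2 !natrD exprS; ring.
Qed.

Lemma cvg_negative_binomial (q : C) j : `|q| <= 4^-1 ->
  (fun N => \sum_(k < N) ('C(k + j, j))%:R * q ^+ k : C^o) @ \oo -->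
  ((1 - q) ^- j.+1 : C^o).
Proof.
move=> q4; have q1 : 1 - q != 0.
  rewrite subr_eq0; apply/eqP => qE; move: q4.
  by rewrite -qE normr1 invf_ge1 ?ltr0n // (ler_nat _ 4 1).
have qn n : `|q ^+ n| <= 2 ^- n * 2 ^- n.
  rewrite normrX -invfM -exprMn -natrM -exprVn lerXn2r ?nnegrE //.
elim: j => [|j IH].
  have h : (fun N => (1 - q)^-1 * (1 - q ^+ N) : C^o) @ \oo --> ((1 - q)^-1 * (1 - 0) : C^o).
    apply: (@cvgM C); first exact: cvg_cst.
    apply: (@cvgB _ C^o); first exact: cvg_cst.
    apply: (@cvg0_bound _ 1) => n; apply: le_trans (qn n) _.
    by rewrite ler_wpM2r ?invr_ge0 ?exprn_ge0 // invf_le1 ?exprn_gt0 // exprn_ege1 // ler1n.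
  move: h; rewrite subr0 mulr1 expr1; apply: cvg_trans; apply: near_eq_cvg; near=> N.
  have -> : 1 - q ^+ N = (1 - q) * \sum_(k < N) q ^+ k.
    by rewrite -opprB subrX1 -mulNr opprB.
  by rewrite mulKf //; apply: eq_bigr => k _; rewrite bin0 mul1r.
have h : (fun N => (1 - q)^-1 * (\sum_(k < N) ('C(k + j, j))%:R * q ^+ k -
     ('C(N + j, j.+1))%:R * q ^+ N) : C^o) @ \oo --> ((1 - q)^-1 * ((1 - q) ^- j.+1 - 0) : C^o).
  apply: (@cvgM C); first exact: cvg_cst.
  apply: (@cvgB _ C^o); first exact: IH.
  apply: (@cvg0_bound _ (2 ^+ j)) => n; rewrite normrM normr_nat.
  apply: le_trans (_ : 2 ^+ (n + j) * (2 ^- n * 2 ^- n) <= _).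
    by apply: ler_pM => //; rewrite -natrX ler_nat bin_le_exp2.
  by rewrite exprD mulrACA mulfV ?expf_neq0 ?pnatr_eq0 // mul1r.
move: h; rewrite subr0 -invfM -exprS; apply: cvg_trans; apply: near_eq_cvg; near=> N.
by rewrite -partial_negative_binomial mulKf.
Unshelve. all: by end_near. Qed.

End NegativeBinomial.

(** * Product formula for the determinant *)

Section AnalyticZeta.
Context {R : realType}.
Local Notation C := R[i].
Implicit Types (a : nat -> C) (z : C).

Definition pterm a z (k : nat) : C := a k * z ^+ k.

Lemma psumE a z : psum a z = csum (pterm a z).
Proof. by []. Qed.

Lemma pterm_dominated a z (M : C) : (forall n, `|a n| <= M ^+ n) -> M * `|z| <= 4^-1 ->
  dominated 4 (pterm a z).
Proof.
move=> aM Mz n; rewrite normrM normrX.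
have M0 : 0 <= M by have := aM 1%N; rewrite expr1; apply: le_trans.
apply: le_trans (_ : M ^+ n * `|z| ^+ n <= _).
  by rewrite ler_wpM2r // exprn_ge0.
by rewrite -exprMn -exprVn lerXn2r ?nnegrE ?mulr_ge0 // invr_ge0.
Qed.

Lemma cauchy_pterm a b z n : cauchy (pterm a z) (pterm b z) n = pterm (cauchy a b) z n.
Proof.
rewrite /pterm mulr_suml; apply: eq_bigr => -[i /= i_n] _.
by rewrite mulrACA -exprD subnKC.
Qed.

Lemma eq_csum (a b : nat -> C) : (forall n, a n = b n) -> csum a = csum b.
Proof. by move=> ab; congr csum; apply/funext. Qed.

Lemma psum_cauchy a b z (M : C) : (forall n, `|a n| <= M ^+ n) ->
  (forall n, `|b n| <= M ^+ n) -> M * `|z| <= 4^-1 ->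
  psum (cauchy a b) z = psum a z * psum b z.
Proof.
move=> aM bM Mz; rewrite !psumE -(csum_cauchy (pterm_dominated aM Mz) (pterm_dominated bM Mz)).
by apply: eq_csum => n; rewrite cauchy_pterm.
Qed.

Lemma csum_finite (c : nat -> C) p : (forall n, (p <= n)%N -> c n = 0) ->
  csum c = \sum_(0 <= k < p) c k.
Proof.
move=> c0; apply: (@cvg_lim C^o (@norm_hausdorff _ C^o)); apply: cvg_near_cst.
exists p => // n /= pn; rewrite /series /=.
rewrite (@big_cat_nat _ _ _ p 0 n) //= [X in _ + X]big_nat_cond [X in _ + X]big1 ?addr0 //.
by move=> k /andP[/andP[/c0]].
Qed.

Lemma psum_cauchy1 z : psum cauchy1 z = 1.
Proof.
rewrite psumE (@csum_finite _ 1) => [|[|n] // _]; last by rewrite /pterm /cauchy1 mul0r.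
by rewrite big_nat1 /pterm mul1r.
Qed.

(** In the application [Z n] is the weighted number of points fixed by the n-th iterate, [e] the
    zeta function, [Q] its inverse and [d] the determinant; the factor after [Z n] in [dd] is 1 /
    |det(1 - D T^n)|. *)
Variables (Z Q e d : nat -> C) (M : C).
Hypotheses (Z0 : Z 0%N = 0) (M1 : 1 <= M) (ZM : forall n, `|Z n| <= M ^+ n).
Hypotheses (Q0 : Q 0%N = 1) (dQ : logderiv Q (fun n => - Z n)).
Hypotheses (e0 : e 0%N = 1) (de : logderiv e Z).
Hypotheses (d0 : d 0%N = 1) (dd : logderiv d (fun n => - (Z n *
  ((4 ^- n) ^+ 2 * (1 - 4 ^- n) ^- 4)))).

Let M0 : 0 <= M. Proof. exact: le_trans M1. Qed.

Lemma zeta_den_bound n : `|Q n| <= M ^+ n.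
Proof.
apply: (logderiv_bound M0 _ Q0 dQ) => [|k]; first by rewrite Z0 oppr0.
by rewrite normrN.
Qed.

Lemma zeta_bound n : `|e n| <= M ^+ n.
Proof. exact: (logderiv_bound M0 Z0 e0 de). Qed.

Lemma psum_zetaM z : M * `|z| <= 4^-1 -> psum e z * psum Q z = 1.
Proof.
move=> Mz; rewrite -(psum_cauchy zeta_bound zeta_den_bound Mz) -(psum_cauchy1 z).
apply: eq_csum => n; congr (_ * _); apply: (@logderiv_uniq _ _ _ (fun=> 0)) => //.
- by apply: logderiv_eq (logderivM de dQ) _ => k; rewrite subrr.
- exact: logderiv1.
- by rewrite /cauchy big_ord1 e0 Q0 mulr1.
Qed.

Let q (k : nat) : C := 4 ^- k.+2.

Let q_ge0 k : 0 <= q k. Proof. by rewrite invr_ge0 exprn_ge0. Qed.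

Let q_le1 k : q k <= 1.
Proof. by rewrite invf_le1 ?exprn_gt0 // exprn_ege1 // ler1n. Qed.

(** Binomials are at most 2^(k+3) and the scale is 4^-(k+2). The bounds 2^-(k+1) sum to at most 1,
    which keeps all partial products below M^n. Smaller exponents j are allowed for the intermediate
    powers in [psum_Qk]. *)
Let multiplicity_le k j n : (j <= 'C(k + 3, 3))%N -> j%:R * q k ^+ n.+1 <= 2 ^- k.+1.
Proof.
move=> jC; apply: le_trans (_ : 2 ^+ (k + 3) * q k <= _).
  apply: ler_pM => //; first by rewrite exprn_ge0.
    by rewrite -natrX ler_nat (leq_trans jC) // bin_le_exp2.
  by rewrite exprS ler_piMr // exprn_ile1.
have -> : q k = 2 ^- k.+2 * 2 ^- k.+2 by rewrite /q -invfM -exprMn -natrM.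
have -> : (k + 3 = k.+2 + 1)%N by lia.
rewrite exprD mulrACA mulfV ?expf_neq0 ?pnatr_eq0 // mul1r expr1.
by rewrite exprS invfM mulrA mulfV ?pnatr_eq0 // mul1r.
Qed.

Let T N n : C := \sum_(k < N) ('C(k + 3, 3))%:R * q k ^+ n.

Let T_bound N n : `|T N n.+1| <= 1.
Proof.
apply: le_trans (_ : 1 - 2 ^- N <= _); last by rewrite gerBl invr_ge0 exprn_ge0.
elim: N => [|N IH]; first by rewrite /T big_ord0 normr0 expr0 invr1 subrr.
rewrite /T big_ord_recr /=; apply: le_trans (ler_normD _ _) _.
apply: le_trans (_ : 1 - 2 ^- N + 2 ^- N.+1 <= _).
  apply: lerD => //; rewrite ger0_norm ?mulr_ge0 ?exprn_ge0 //.
  exact: multiplicity_le.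
rewrite exprS invfM [X in X <= _](_ : _ = 1 - 2^-1 * 2 ^- N) //; by field; rewrite expf_neq0 // pnatr_eq0.
Qed.

Let cvg_T n : (fun N => T N n.+1 : C^o) @ \oo -->
  ((4 ^- n.+1) ^+ 2 * (1 - 4 ^- n.+1) ^- 4 : C^o).
Proof.
have h : `|4 ^- n.+1 : C| <= 4^-1.
  rewrite ger0_norm ?invr_ge0 ?exprn_ge0 // lef_pV2 ?posrE ?exprn_gt0 //.
  by rewrite exprS ler_peMr // exprn_ege1 // ler1n.
have -> : (fun N => T N n.+1 : C^o) = (fun N => (4 ^- n.+1) ^+ 2 *
    (\sum_(k < N) ('C(k + 3, 3))%:R * (4 ^- n.+1) ^+ k) : C^o); last first.
  by apply: (@cvgM C); [exact: cvg_cst|exact: (@cvg_negative_binomial _ _ 3 h)].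
apply/funext => N; rewrite /T mulr_sumr; apply: eq_bigr => k _.
by rewrite mulrCA -exprD /q !exprVn -!exprM; congr (_ * _^-1); congr (_ ^+ _); lia.
Qed.

Let Qk k n : C := Q n * q k ^+ n.

Let Qk_bound k j n : (j <= 'C(k + 3, 3))%N -> `|cauchyX (Qk k) j n| <= M ^+ n.
Proof.
move=> jC; have dQk := logderivX j (logderiv_scale (q k) dQ).
apply: (logderiv_bound M0 _ _ dQk) => [||i].
- by rewrite Z0 oppr0 mul0r mulr0.
- elim: (j) => [//|i IH]; rewrite /cauchyX iterS -/(cauchyX _ i) /cauchy big_ord1 IH.
  by rewrite /Qk Q0 expr0 !mulr1.
case: i => [|i]; first by rewrite Z0 oppr0 mul0r mulr0 normr0.
rewrite mulrCA normrM normrN; apply: le_trans (_ : M ^+ i.+1 * 1 <= _); last by rewrite mulr1.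
apply: ler_pM => //; rewrite ger0_norm ?mulr_ge0 ?exprn_ge0 //.
apply: le_trans (multiplicity_le i jC) _.
by rewrite invf_le1 ?exprn_gt0 // exprn_ege1 // ler1n.
Qed.

Let psum_Qk z k j : M * `|z| <= 4^-1 -> (j <= 'C(k + 3, 3))%N ->
  psum (cauchyX (Qk k) j) z = psum Q (z * q k) ^+ j.
Proof.
move=> Mz; elim: j => [|j IH] jC; first by rewrite psum_cauchy1.
have jC' : (j <= 'C(k + 3, 3))%N by exact: ltnW.
have Qk1 n : `|Qk k n| <= M ^+ n.
  have := @Qk_bound k 1 n; rewrite /cauchyX /= cauchyC cauchy1l; apply.
  by rewrite bin_gt0; lia.
rewrite /cauchyX iterS (psum_cauchy Qk1 (fun n => Qk_bound n jC') Mz) IH // exprS.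
congr (_ * _); apply: eq_csum => n.
by rewrite /pterm /Qk exprMn mulrAC mulrA.
Qed.

(** The N-th partial product, kept as a formal series so that its logarithmic derivative is a plain
    sum over k. *)
Let dN N : nat -> C :=
  iteri N (fun k c => cauchy (cauchyX (Qk k) 'C(k + 3, 3)) c) cauchy1.

Let dN0 N : dN N 0%N = 1.
Proof.
elim: N => [//|N IH]; rewrite /dN /= -/(dN N) /cauchy big_ord1 IH mulr1.
elim: 'C(_, _) => [//|i IHi]; rewrite /cauchyX iterS -/(cauchyX _ i) /cauchy big_ord1 IHi.
by rewrite /Qk Q0 expr0 !mulr1.
Qed.

Let logderiv_dN N : logderiv (dN N) (fun n => - (Z n * T N n)).
Proof.
elim: N => [|N IH].
  by apply: logderiv_eq logderiv1 _ => n; rewrite /T big_ord0 mulr0 oppr0.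
have dQk := logderivX 'C(N + 3, 3) (logderiv_scale (q N) dQ).
apply: logderiv_eq (logderivM dQk IH) _ => n.
by rewrite /T big_ord_recr /=; ring.
Qed.

Let dN_bound N n : `|dN N n| <= M ^+ n.
Proof.
apply: (logderiv_bound M0 _ (dN0 N) (logderiv_dN N)) => [|i]; first by rewrite Z0 mul0r oppr0.
case: i => [|i]; first by rewrite Z0 mul0r oppr0 normr0.
rewrite normrN normrM; apply: le_trans (_ : M ^+ i.+1 * 1 <= _); last by rewrite mulr1.
exact: ler_pM.
Qed.

Let psum_dN z N : M * `|z| <= 4^-1 ->
  psum (dN N) z = \prod_(0 <= k < N) psum Q (z * q k) ^+ 'C(k + 3, 3).
Proof.
move=> Mz; elim: N => [|N IH]; first by rewrite big_geq // psum_cauchy1.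
rewrite big_nat_recr //= -IH mulrC -(psum_Qk Mz (leqnn _)).
by rewrite -(psum_cauchy (fun n => Qk_bound n (leqnn _)) (dN_bound N) Mz).
Qed.

Lemma det_bound n : `|d n| <= M ^+ n.
Proof.
apply: (logderiv_bound M0 _ d0 dd) => [|i]; first by rewrite Z0 mul0r oppr0.
case: i => [|i]; first by rewrite Z0 mul0r oppr0 normr0.
rewrite normrN normrM; apply: le_trans (_ : M ^+ i.+1 * 1 <= _); last by rewrite mulr1.
apply: ler_pM => //.
by apply: (cvg_norm_le (p := 0%N) (cvg_T (n := i))) => N _; exact: T_bound.
Qed.

(** The recursion [logderiv_rec] writes each coefficient as a finite combination of lower ones and
    of values of [T N], whose limits are known; hence strong induction. *)
Let cvg_dN n : (fun N => dN N n : C^o) @ \oo --> (d n : C^o).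
Proof.
elim/ltn_ind: n => -[|n] IH.
  by rewrite d0; under eq_fun do rewrite dN0; exact: cvg_cst.
have n0 : n.+1%:R != 0 :> C by rewrite pnatr_eq0.
have E a W : W 0%N = 0 -> logderiv a W ->
    a n.+1 = n.+1%:R^-1 * \sum_(0 <= i < n.+1) W i.+1 * a (n - i)%N.
  by move=> W0 aW; rewrite big_mkord -(logderiv_rec _ W0 aW) mulKf.
rewrite (E _ _ _ dd); last by rewrite Z0 mul0r oppr0.
have -> : (fun N => dN N n.+1 : C^o) = (fun N => n.+1%:R^-1 *
    \sum_(0 <= i < n.+1) (- (Z i.+1 * T N i.+1)) * dN N (n - i)%N : C^o).
  by apply/funext => N; rewrite (E _ _ _ (logderiv_dN N)) // Z0 mul0r oppr0.
apply: (@cvgM C); first exact: cvg_cst.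
apply: (@cvg_sum_nat R (fun N i => - (Z i.+1 * T N i.+1) * dN N (n - i)%N)
  (fun i => - (Z i.+1 * ((4 ^- i.+1) ^+ 2 * (1 - 4 ^- i.+1) ^- 4)) * d (n - i)%N)) => i.
apply: (@cvgM C); last by apply: IH; rewrite ltnS leq_subr.
by apply: (@cvgN _ C^o); apply: (@cvgM C); [exact: cvg_cst|exact: cvg_T].
Qed.

(** Coefficientwise convergence and the common bound M^n allow the limit to be taken under the
    sum. *)
Lemma cvg_det_product z : M * `|z| <= 4^-1 ->
  (fun N => \prod_(0 <= k < N) psum Q (z / 4 ^+ k.+2) ^+ 'C(k + 3, 3) : C^o) @ \oo -->
  (psum d z : C^o).
Proof.
move=> Mz.
have -> : (fun N => \prod_(0 <= k < N) psum Q (z / 4 ^+ k.+2) ^+ 'C(k + 3, 3) : C^o) =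
    (fun N => csum (pterm (dN N) z) : C^o).
  by apply/funext => N; rewrite -psumE psum_dN.
apply: csum_tannery => [N||n].
- exact: dominatedW (pterm_dominated (dN_bound N) Mz).
- exact: dominatedW (pterm_dominated det_bound Mz).
- by apply: (@cvgM C); [exact: cvg_dN|exact: cvg_cst].
Qed.

Lemma power_series_cvg a z : (forall n, `|a n| <= M ^+ n) -> M * `|z| <= 4^-1 ->
  power_series a z @ \oo --> (psum a z : C^o).
Proof.
move=> aM Mz; apply: dominated_cvg.
exact: dominatedW (pterm_dominated aM Mz).
Qed.

End AnalyticZeta.

(** * Consequences of the radius of convergence *)

Section ZetaOfPowerSeries.
Context {R : realType}.
Local Notation C := R[i].
Implicit Types (alpha : nat -> C) (z : C).

Lemma norm_Re_le z : `|complex.Re z|%:C <= `|z|.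
Proof.
case: z => x y; rewrite normc_def lecR /= -sqrtr_sqr.
by apply: ler_wsqrtr; rewrite lerDl sqr_ge0.
Qed.

Lemma norm_Im_le z : `|complex.Im z|%:C <= `|z|.
Proof.
case: z => x y; rewrite normc_def lecR /= -sqrtr_sqr.
by apply: ler_wsqrtr; rewrite lerDr sqr_ge0.
Qed.

(** The series converges at a point t chosen midway between x and an admissible radius r, so its
    terms there are eventually at most 1; [K] also absorbs the finitely many earlier ones. The gap t
    > x provides geometric decay at x. *)
Lemma radius_bound alpha (x : R) : 0 <= x -> (x%:E < convergence_radius alpha)%E ->
  exists K t : R, x < t /\ forall k, `|alpha k| * (t ^+ k)%:C <= K%:C.
Proof.
move=> x0 /ereal_sup_gt[_ [r hr <-]]; rewrite lte_fin => xr.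
pose t := (x + r) / 2; have t0 : 0 <= t by rewrite /t; lra.
have : cvgn (power_series alpha t%:C).
  apply: hr; rewrite normc_def /= expr0n addr0 sqrtr_sqr ltcR ger0_norm //.
  by rewrite /t; lra.
move=> /(@cvg_series_cvg_0 C C^o) /cvgrPdist_le /(_ 1 ltr01)[N _ HN].
pose K : R := 1 + \sum_(k < N) complex.Re (`|alpha k| * (t ^+ k)%:C).
have normE k : `|alpha k| * (t ^+ k)%:C = (complex.Re (`|alpha k| * (t ^+ k)%:C))%:C.
  by rewrite normc_def -rmorphM.
have ge0 k : 0 <= complex.Re (`|alpha k| * (t ^+ k)%:C).
  by rewrite -lecR -normE mulr_ge0 // lecR exprn_ge0.
exists K, t; split; first by rewrite /t; lra.
move=> k; rewrite normE lecR /K; case: (ltnP k N) => kN.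
  rewrite (bigD1 (Ordinal kN)) //= addrCA lerDl addr_ge0 // sumr_ge0 // => i _.
  exact: ge0.
apply: le_trans (_ : 1 <= _); last by rewrite lerDl sumr_ge0.
have := HN k kN; rewrite sub0r normrN normrM normrX.
have -> : `|t%:C| = t%:C by rewrite normc_def /= expr0n addr0 sqrtr_sqr ger0_norm.
by rewrite -rmorphXn -lecR -normE.
Qed.

Lemma decays_geometric (b : nat -> R) (r : nat) (K t : R) : 4 ^+ r < t ->
  (forall k, `|b k| * t ^+ k <= K) -> decays r b.
Proof.
move=> rt bK e e0.
have p4 : 0 < (4 : R) ^+ r by rewrite exprn_gt0.
have t0 : 0 < t by apply: lt_trans rt.
have K0 : 0 <= K by apply: le_trans (bK 0%N); rewrite mulr_ge0.
have q0 : 0 <= 4 ^+ r / t by rewrite divr_ge0 // ltW.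
have q1 : `|4 ^+ r / t| < 1 by rewrite ger0_norm // ltr_pdivrMr // mul1r.
have C0 : 0 < K * 4 ^+ r + 1 by rewrite ltr_wpDl // mulr_ge0 // ltW.
have /cvgrPdist_le/(_ _ (divr_gt0 e0 C0))[N _ HN] := cvg_expr q1.
exists N => k /HN /=; rewrite sub0r normrN ger0_norm ?exprn_ge0 //.
rewrite ler_pdivlMr // => h; apply: le_trans h.
have -> : `|b k| * (4 ^+ k.+1) ^+ r = (`|b k| * t ^+ k) * 4 ^+ r * (4 ^+ r / t) ^+ k.
  rewrite -exprM mulSn exprD mulnC exprM expr_div_n.
  by field; rewrite expf_neq0 // gt_eqF.
rewrite [X in _ <= X]mulrC ler_wpM2r ?exprn_ge0 //.
apply: le_trans (_ : K * 4 ^+ r <= _); last by rewrite lerDl.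
by rewrite ler_wpM2r // ltW.
Qed.

Lemma lt_ln_radius (rho : \bar R) (r : nat) : (1 < rho)%E ->
  (r%:R%:E < lne rho / (ln 4)%:E)%E -> ((4 ^+ r)%:E < rho)%E.
Proof.
case: rho => [x||] //; last by move=> _ _; rewrite ltry.
rewrite lte_fin => x1; have x0 : 0 < x by apply: lt_trans x1.
have l4 : 0 < ln (4 : R) by apply: ln_gt0; lra.
rewrite lne_EFin // inver gt_eqF // -EFinM lte_fin ltr_pdivlMr // lte_fin => h.
rewrite -ltr_ln ?posrE ?exprn_gt0 // lnXn //.
by rewrite -(mulr_natl (ln 4) r).
Qed.

Lemma decays_radius alpha r : (1 < convergence_radius alpha)%E ->
  (r%:R%:E < lne (convergence_radius alpha) / (ln 4)%:E)%E ->
  decays r (fun k => complex.Re (alpha k)) /\ decays r (fun k => complex.Im (alpha k)).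
Proof.
move=> r1 /(lt_ln_radius r1) /radius_bound [|K [t [rt aK]]]; first by rewrite exprn_ge0.
have t0 : 0 <= t by apply: le_trans (ltW rt); rewrite exprn_ge0.
split; apply: (decays_geometric (K := K) rt) => k; rewrite -lecR rmorphM /=.
  by apply: le_trans (aK k); rewrite ler_wpM2r ?norm_Re_le // lecR exprn_ge0.
by apply: le_trans (aK k); rewrite ler_wpM2r ?norm_Im_le // lecR exprn_ge0.
Qed.

Lemma coef_bound alpha : (1 < convergence_radius alpha)%E ->
  exists B : C, 1 <= B /\ forall k, `|1 + alpha k| <= B.
Proof.
move=> /(radius_bound ler01) [K [t [t1 aK]]].
have K0 : 0 <= K.
  by rewrite -lecR; apply: le_trans (aK 0%N); rewrite expr0 mulr1.
exists (1 + K%:C); split; first by rewrite lerDl lecR.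
move=> k; apply: le_trans (ler_normD _ _) _; rewrite normr1 lerD2l.
apply: le_trans (aK k); rewrite ler_peMr //.
by rewrite (lecR 1) exprn_ege1 // ltW.
Qed.

Lemma near0_small (M : C) : 1 <= M -> \forall z \near (0 : C^o), M * `|z| <= 4^-1.
Proof.
move=> M1; have M0 : 0 < M by apply: lt_le_trans M1.
apply/nbhs_normP; exists ((4 * M)^-1); first by rewrite /= invr_gt0 mulr_gt0.
move=> z /=; rewrite sub0r normrN => /ltW zM.
by rewrite -ler_pdivlMl // -invfM mulrC.
Qed.

(** The constant 1 in 1 + alpha_k sums to a geometric series, and (1 - z) (1 - z / (1 - z) - z h) =
    1 - 2 z - z (1 - z) h. *)
Lemma psum_zeta_den alpha z (h B : C) : 1 <= B -> (forall k, `|1 + alpha k| <= B) ->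
  8 * B * `|z| <= 4^-1 -> power_series alpha z @ \oo --> (h : C^o) ->
  psum (zeta_den (fun k => 1 + alpha k)) z = 1 - 2 * z - z * (1 - z) * h.
Proof.
move=> B1 aB Bz ah; have B0 : 0 <= B by apply: le_trans B1.
have M1 : 1 <= 8 * B by rewrite mulr_ege1 // ler1n.
have BM : B <= 8 * B by rewrite ler_peMl // ler1n.
have z4 : `|z| <= 4^-1 by apply: le_trans Bz; rewrite ler_peMl.
have z1 : 1 - z != 0.
  rewrite subr_eq0; apply/eqP => zE; move: z4.
  by rewrite -zE normr1 invf_ge1 ?ltr0n // (ler_nat _ 4 1).
rewrite (@psum_cauchy _ _ _ _ (8 * B)) //; first last.
- case=> [|n]; first by rewrite normr1.
  rewrite /= normrN; apply: le_trans (aB n) _; apply: le_trans BM _.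
  by rewrite exprS ler_peMr ?exprn_ege1 // mulr_ge0.
- move=> n; apply: le_trans (exprn_ege1 n M1); rewrite /one_subX.
  by case: n => [|[|n]] /=; rewrite ?subr0 ?sub0r ?normrN ?normr1 ?normr0.
have -> : psum one_subX z = 1 - z.
  rewrite psumE (@csum_finite _ _ 2) => [|[|[|n]] // _]; last by rewrite /pterm /one_subX subrr mul0r.
  by rewrite big_ltn // big_nat1 /pterm /one_subX /= !mulr0n; ring.
have lim : (fun n => 1 - z * (\sum_(k < n) ('C(k + 0, 0))%:R * z ^+ k + power_series alpha z n) : C^o)
    @ \oo --> (1 - z * ((1 - z) ^- 1 + h) : C^o).
  apply: (@cvgB _ C^o); first exact: cvg_cst.
  apply: (@cvgM C); first exact: cvg_cst.
  by apply: (@cvgD _ C^o); [exact: (@cvg_negative_binomial _ _ 0)|exact: ah].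
have -> : psum (renewal_den (fun k => 1 + alpha k)) z = 1 - z * ((1 - z) ^- 1 + h).
  apply: (@cvg_lim C^o (@norm_hausdorff _ C^o)); rewrite -cvg_shiftS.
  apply: cvg_trans lim; apply: near_eq_cvg; near=> n.
  have -> : \sum_(k < n) ('C(k + 0, 0))%:R * z ^+ k = \sum_(0 <= k < n) z ^+ k.
    by rewrite big_mkord; apply: eq_bigr => k _; rewrite bin0 mul1r.
  rewrite /power_series /series /= big_nat_recl //= mulr1 -big_split /=.
  rewrite mulr_sumr -sumrN; congr (_ + _); apply: eq_bigr => k _.
  by rewrite exprS; ring.
by field.
Unshelve. all: by end_near. Qed.

(* S m is the weighted number of fixed points of the m-th iterate, S' m the same
   sum divided by |det (1 - D T^m)|; e and d are the resulting zeta function and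
   dynamical determinant. *)
Lemma zeta_det_identities alpha (h : C -> C) (S S' : nat -> C) :
  has_expansion0 h alpha -> (1 < convergence_radius alpha)%E ->
  (forall m, S m.+1 = cyclic_sum (fun k => 1 + alpha k) m.+1 0) ->
  (forall m, S' m.+1 = S m.+1 * ((4 ^- m.+1) ^+ 2 * (1 - 4 ^- m.+1) ^- 4)) ->
  let e := fps_exp (fun m => m%:R^-1 * S m) in
  let d := fps_exp (fun m => - (m%:R^-1 * S' m)) in
  [/\ has_expansion0 (psum e) e, has_expansion0 (psum d) d,
      \forall z \near (0 : C^o), (psum e z)^-1 = 1 - 2 * z - z * (1 - z) * h z
    & \forall z \near (0 : C^o),
        (fun N => \prod_(0 <= k < N) ((psum e (z / 4 ^+ k.+2))^-1)
           ^+ ((k.+1 * k.+2 * k.+3) %/ 6) : C^o) @ \oo --> (psum d z : C^o)].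
Proof.
move=> hh r1 SE S'E e d; have [B [B1 aB]] := coef_bound r1.
pose b k := 1 + alpha k; pose Z n := if n is 0 then 0 else cyclic_sum b n 0.
pose M := 8 * B; have M1 : 1 <= M by rewrite mulr_ege1 // ler1n.
have ZM n : `|Z n| <= M ^+ n.
  by case: n => [|n]; [rewrite normr0|exact: cyclic_sum_bound].
have n0 n : n.+1%:R != 0 :> C by rewrite pnatr_eq0.
have de : logderiv e Z.
  apply: logderiv_eq (logderiv_fps_exp _) _ => -[|n]; first by rewrite mul0r.
  by rewrite mulrA mulfV // mul1r SE.
have dd : logderiv d (fun n => - (Z n * ((4 ^- n) ^+ 2 * (1 - 4 ^- n) ^- 4))).
  apply: logderiv_eq (logderiv_fps_exp _) _ => -[|n]; first by rewrite !mul0r oppr0.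
  by rewrite mulrN mulrA mulfV // mul1r S'E SE.
have e0 : e 0%N = 1 by exact: fps_exp0.
have d0 : d 0%N = 1 by exact: fps_exp0.
have dQ := logderiv_zeta_den b.
have Q0 : zeta_den b 0%N = 1 by rewrite /zeta_den /cauchy big_ord1 mulr1 /one_subX subr0.
have Z0 : Z 0%N = 0 by [].
have small := near0_small M1.
have eM := zeta_bound Z0 M1 ZM e0 de.
have dM := det_bound Z0 M1 ZM d0 dd.
have QE z : M * `|z| <= 4^-1 -> (psum e z)^-1 = psum (zeta_den b) z.
  move=> Mz; have eQ := psum_zetaM Z0 M1 ZM Q0 dQ e0 de Mz.
  have en0 : psum e z != 0.
    by apply/eqP => E; move: eQ; rewrite E mul0r => /esym/eqP; rewrite oner_eq0.
  by apply: (mulfI en0); rewrite mulfV.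
split.
- by apply: filterS small => z Mz; exact: power_series_cvg eM Mz.
- by apply: filterS small => z Mz; exact: power_series_cvg dM Mz.
- apply: filterS2 small hh => z Mz hz; rewrite QE //.
  exact: psum_zeta_den B1 aB Mz hz.
- apply: filterS small => z Mz.
  have := cvg_det_product Z0 M1 ZM Q0 dQ d0 dd Mz.
  have -> // : (fun N => \prod_(0 <= k < N) ((psum e (z / 4 ^+ k.+2))^-1)
           ^+ ((k.+1 * k.+2 * k.+3) %/ 6) : C^o) =
    (fun N => \prod_(0 <= k < N) psum (zeta_den b) (z / 4 ^+ k.+2) ^+ 'C(k + 3, 3) : C^o).
  apply/funext => N; apply: eq_bigr => k _; rewrite QE; last first.
    apply: le_trans Mz; rewrite ler_wpM2l ?(le_trans _ M1) //.
    rewrite normrM ler_piMr // ger0_norm ?invr_ge0 ?exprn_ge0 //.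
    by rewrite invf_le1 ?exprn_gt0 // exprn_ege1 // ler1n.
  congr (_ ^+ _); rewrite bin_ffactd !addn3 !ffactnS ffactn0 !factS fact0 /=.
  by congr (_ %/ _)%N; rewrite muln1 mulnA -mulnA mulnC; lia.
Qed.

End ZetaOfPowerSeries.

(** * The horseshoe *)

Section SphereMaps.
Context {R : realType} {n : nat}.
Local Notation rV := 'rV[R]_n.+1.
Implicit Types x v : rV.

Definition sqnorm x : R := \sum_i x 0 i ^+ 2.

Lemma sqnorm_ge0 x : 0 <= sqnorm x.
Proof. by apply: sumr_ge0 => i _; exact: sqr_ge0. Qed.

Lemma enormE x : enorm x = Num.sqrt (sqnorm x).
Proof. by []. Qed.

Lemma enorm_ge0 x : 0 <= enorm x.
Proof. exact: sqrtr_ge0. Qed.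

Lemma sqr_enorm x : enorm x ^+ 2 = sqnorm x.
Proof. by rewrite sqr_sqrtr // sqnorm_ge0. Qed.

Lemma sqnorm_gt0 x : x != 0 -> 0 < sqnorm x.
Proof.
move=> x0; rewrite lt_neqAle sqnorm_ge0 andbT; apply: contra_neq x0 => /esym/eqP.
rewrite psumr_eq0 => [/allP h|i _]; last exact: sqr_ge0.
by apply/rowP => i; rewrite mxE; apply/eqP; rewrite -sqrf_eq0; exact: h (mem_index_enum i).
Qed.

Lemma enorm_gt0 x : x != 0 -> 0 < enorm x.
Proof. by move=> x0; rewrite sqrtr_gt0 sqnorm_gt0. Qed.

Lemma enormZ c x : enorm (c *: x) = `|c| * enorm x.
Proof.
rewrite /enorm -sqrtr_sqr -sqrtrM ?sqr_ge0 //; congr Num.sqrt.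
by rewrite mulr_sumr; apply: eq_bigr => i _; rewrite mxE exprMn.
Qed.

Lemma sphereP x : sphere R n x <-> sqnorm x = 1.
Proof.
split=> [xS|xS]; first by rewrite -sqr_enorm xS expr1n.
by rewrite /sphere /= enormE xS sqrtr1.
Qed.

Lemma sphere_neq0 x : sphere R n x -> x != 0.
Proof.
move=> /sphereP xS; apply/eqP => x0; move: xS; rewrite x0 /sqnorm big1.
  by move/eqP; rewrite eq_sym oner_eq0.
by move=> i _; rewrite mxE expr0n.
Qed.

Lemma radial_sphere x : x != 0 -> sphere R n (radial x).
Proof.
move=> x0; rewrite /sphere /= /radial enormZ ger0_norm ?invr_ge0 ?enorm_ge0 //.
by rewrite mulVf // gt_eqF // enorm_gt0.
Qed.

Lemma radial_id x : sphere R n x -> radial x = x.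
Proof. by move=> xS; rewrite /radial xS invr1 scale1r. Qed.

Lemma radialZ c x : 0 < c -> radial (c *: x) = radial x.
Proof.
move=> c0; rewrite /radial enormZ gtr0_norm // scalerA invfM mulrAC.
by rewrite mulVf ?mul1r // gt_eqF.
Qed.

Definition nonzero : set rV := [set x | x != 0].

Lemma open_nonzero : open nonzero.
Proof.
rewrite (_ : nonzero = ~` [set 0]).
  by apply: closed_openC; exact: accessible_closed_set1 (@hausdorff_accessible _ (@norm_hausdorff _ _)) _.
by apply/seteqP; split => x /= /eqP.
Qed.

Lemma Cr_coordinate (V : normedModType R) r U (f : V -> rV) i :
  open U -> Cr r U f -> Cr r U (fun y => f y 0 i : R^o).
Proof.
move=> oU Cf.
exact: (Cr_rV_comp (U' := setT) (g := fun y => y 0 i : R^o) oU _ Cf (Cr_coord r setT 0 i)).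
Qed.

Lemma Cr_enorm r : Cr r nonzero (enorm : rV -> R^o).
Proof.
apply: (Cr_comp (U' := [set y : R^o | 0 < y]) (f := sqnorm : rV -> R^o) open_nonzero) => [x x0||].
- exact: sqnorm_gt0.
- apply: Cr_sum => [|i]; first exact: open_nonzero.
  have C := Cr_coord (n := n) (m := 0) r nonzero 0 i.
  by apply: Cr_eq (CrM open_nonzero C C) => [|x _]; [exact: open_nonzero|rewrite expr2].
- exact: Cr_sqrt.
Qed.

Lemma Coo_radial : Coo nonzero (@radial R n).
Proof.
move=> r; apply: Cr_mx => [|i j]; first exact: open_nonzero.
have C : Cr r nonzero (fun x : rV => (enorm x)^-1 * x i j : R^o).
  apply: CrM; [exact: open_nonzero| |exact: Cr_coord].
  apply: (Cr_comp (U' := [set y : R^o | y != 0]) open_nonzero _ (Cr_enorm r) (Cr_inv r)).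
  by move=> x x0 /=; rewrite gt_eqF // enorm_gt0.
by apply: Cr_eq C => [|x _]; [exact: open_nonzero|rewrite mxE].
Qed.

End SphereMaps.

Section SmoothOn.
Context {R : realType} {n : nat}.
Local Notation rV := 'rV[R]_n.+1.

Lemma Cr_rV_comp_rV (V : normedModType R) k r (U : set V) (U' : set rV) (f : V -> rV)
    (g : rV -> 'rV[R]_k.+1) : open U -> open U' -> (forall x, U x -> U' (f x)) ->
  Cr r U f -> Cr r U' g -> Cr r U (g \o f).
Proof.
move=> oU oU' fU Cf Cg; apply: Cr_mx => // i j; rewrite (ord1 i).
exact: (Cr_rV_comp (g := fun y => g y 0 j : R^o) oU fU Cf (Cr_coordinate j oU' Cg)).
Qed.

Lemma open_preimage_in (V W : normedModType R) (U : set V) (U' : set W) (f : V -> W) :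
  open U -> (forall x, U x -> {for x, continuous f}) -> open U' ->
  open (U `&` f @^-1` U').
Proof.
move=> oU cf oU'; rewrite openE => x [Ux U'x].
apply: filterI; first exact: open_nbhs_nbhs.
by apply: cf => //; exact: open_nbhs_nbhs.
Qed.

Lemma smooth_on_open (W : normedModType R) (A U : set rV) (f : rV -> W) :
  open U -> A `<=` U -> Coo U f -> smooth_on A f.
Proof. by move=> oU AU Cf x /AU Ux; exists U, f. Qed.

Lemma smooth_on_comp (A B : set rV) (f g : rV -> rV) : (forall x, A x -> B (f x)) ->
  smooth_on A f -> smooth_on B g -> smooth_on A (g \o f).
Proof.
move=> fAB sf sg x Ax; have [U [F [oU Ux CF Ff]]] := sf x Ax.
have [U' [G [oU' Ux' CG Gg]]] := sg _ (fAB x Ax).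
have cF y : U y -> {for y, continuous F} by move=> Uy; exact: (CF 0%N).
have Ffx y : A y -> U y -> F y = f y by move=> Ay Uy; apply: Ff; rewrite inE.
exists (U `&` F @^-1` U'), (G \o F); split.
- exact: open_preimage_in.
- by split=> //=; rewrite Ffx.
- move=> r; apply: (Cr_rV_comp_rV (U' := U')) => //; [exact: open_preimage_in|by move=> y []|].
  by apply: Cr_sub (CF r) => y [].
- move=> y; rewrite inE => -[Ay [Uy U'y]] /=; rewrite /= in U'y.
  by rewrite Ffx // in U'y *; apply: Gg; rewrite inE; split => //; exact: fAB.
Qed.

(** Smoothness of f is known only through local ambient extensions; precomposition with [radial]
    lands on the sphere, where extension and f agree. *)
Lemma smooth_on_differentiable (f : rV -> rV) x : sphere R n x ->
  smooth_on (sphere R n) f -> differentiable (f \o @radial R n) x.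
Proof.
move=> xS sf; have [U [F [oU Ux CF Ff]]] := sf x xS.
have x0 := sphere_neq0 xS.
have cr : {for x, continuous (@radial R n)} by exact: (Coo_radial 0%N).
have dF : differentiable F x by have [d _] := CF 1%N; exact: d.
have dr : differentiable (@radial R n) x by have [d _] := @Coo_radial R n 1%N; exact: d.
apply: (near_eq_differentiable (f := F \o @radial R n)); last first.
  by apply: differentiable_comp => //; rewrite radial_id.
have Un : \forall y \near x, U (radial y).
  by apply: cr; apply: open_nbhs_nbhs; rewrite radial_id.
have n0 : \forall y \near x, nonzero y by apply: open_nbhs_nbhs; split => //; exact: open_nonzero.
apply: filterS2 Un n0 => y Uy y0 /=; apply: Ff; rewrite inE; split => //.
exact: radial_sphere.
Qed.

Definition sd_comp (T T' : sphere_diffeo R n) : sphere_diffeo R n.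
Proof.
refine (@SphereDiffeo R n (T \o T') (sd_inv T' \o sd_inv T) _ _ _ _ _ _).
- by move=> x xS; do 2!apply: sd_funS.
- by move=> x xS; do 2!apply: sd_invS.
- by move=> x xS /=; rewrite sd_funK ?sd_funK //; exact: sd_funS.
- by move=> x xS /=; rewrite sd_invK ?sd_invK //; exact: sd_invS.
- exact: smooth_on_comp (@sd_funS _ _ T') (sd_fun_smooth T') (sd_fun_smooth T).
- exact: smooth_on_comp (@sd_invS _ _ T) (sd_inv_smooth T) (sd_inv_smooth T').
Defined.

Lemma iterz_sphere (T : sphere_diffeo R n) m x : sphere R n x -> sphere R n (iterz T m x).
Proof.
case: m => k xS.
  by elim: k => [//|k IH]; exact: (sd_funS T IH).
by elim: k => [|k IH]; [exact: (sd_invS T xS)|exact: (sd_invS T IH)].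
Qed.

Lemma iterz_smooth (T : sphere_diffeo R n) m : smooth_on (sphere R n) (iterz T m).
Proof.
have sid : smooth_on (sphere R n) (@id rV).
  move=> x _; exists setT, id; split => // [|r]; [exact: openT|exact: Cr_id].
case: m => k; first elim: k => [//|k IH].
  exact: smooth_on_comp (@iterz_sphere T k) IH (sd_fun_smooth T).
elim: k => [|k IH]; first exact: sd_inv_smooth.
exact: smooth_on_comp (@iterz_sphere T (Negz k)) IH (sd_inv_smooth T).
Qed.

Lemma iterzS (T : sphere_diffeo R n) m x : sphere R n x -> T (iterz T m x) = iterz T (m + 1) x.
Proof.
case: m => k xS; first by rewrite -[(Posz k + 1)]/(Posz (k + 1)) addn1.
case: k => [|k]; first by rewrite /= sd_invK.
have -> : Negz k.+1 + 1 = Negz k by rewrite !NegzE; lia.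
by rewrite /= sd_invK //; exact: (iterz_sphere T (Negz k)).
Qed.

Lemma iterzP (T : sphere_diffeo R n) m x : sphere R n x ->
  sd_inv T (iterz T m x) = iterz T (m - 1) x.
Proof.
move=> xS; rewrite -[in LHS](subrK 1 m) -iterzS // sd_funK //.
exact: iterz_sphere.
Qed.

Lemma iterzD (T : sphere_diffeo R n) m k x : sphere R n x ->
  iterz T m (iterz T k x) = iterz T (m + k) x.
Proof.
move=> xS; have kS := iterz_sphere T k xS.
elim/int_ind: m => [|m IH|m IH]; first by rewrite add0r.
  have -> : Posz m.+1 = m%:Z + 1 by rewrite intS addrC.
  by rewrite -iterzS // IH iterzS // addrAC.
have -> : - Posz m.+1 = - m%:Z - 1 by rewrite intS opprD addrC.
by rewrite -iterzP // IH iterzP // addrAC.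
Qed.

End SmoothOn.

Notation i0 := (@Ordinal 5 0 isT).
Notation i1 := (@Ordinal 5 1 isT).
Notation i2 := (@Ordinal 5 2 isT).
Notation i3 := (@Ordinal 5 3 isT).
Notation i4 := (@Ordinal 5 4 isT).

Section Vec5.
Context {R : realType}.
Implicit Types x y : 'rV[R]_5.

Definition vec5 (a b c d e : R) : 'rV[R]_5 := \row_(i < 5) [:: a; b; c; d; e]`_i.

Lemma vec5_eta x : x = vec5 (x 0 i0) (x 0 i1) (x 0 i2) (x 0 i3) (x 0 i4).
Proof.
by apply/rowP; case=> [[|[|[|[|[|k]]]]] h] //; rewrite mxE /=; congr (x 0 _); apply: val_inj.
Qed.

Lemma vec5E (a b c d e : R) : (vec5 a b c d e 0 i0 = a) * (vec5 a b c d e 0 i1 = b) *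
  (vec5 a b c d e 0 i2 = c) * (vec5 a b c d e 0 i3 = d) * (vec5 a b c d e 0 i4 = e).
Proof. by rewrite !mxE. Qed.

Lemma vec5Z k (a b c d e : R) :
  k *: vec5 a b c d e = vec5 (k * a) (k * b) (k * c) (k * d) (k * e).
Proof. by rewrite [LHS]vec5_eta !mxE. Qed.

Lemma sqnorm_vec5 (a b c d e : R) :
  sqnorm (vec5 a b c d e) = a ^+ 2 + b ^+ 2 + c ^+ 2 + d ^+ 2 + e ^+ 2.
Proof. by rewrite /sqnorm !big_ord_recl big_ord0 !mxE /= addr0 !addrA. Qed.

Lemma Coo_vec5 (U : set 'rV[R]_5) (a b c d e : 'rV[R]_5 -> R) : open U ->
  Coo U (a : _ -> R^o) -> Coo U (b : _ -> R^o) -> Coo U (c : _ -> R^o) ->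
  Coo U (d : _ -> R^o) -> Coo U (e : _ -> R^o) ->
  Coo U (fun x => vec5 (a x) (b x) (c x) (d x) (e x)).
Proof.
move=> oU Ca Cb Cc Cd Ce r; apply: Cr_mx => // i j.
by case: j => [[|[|[|[|[|k]]]]] h] //;
  [move: (Ca r)|move: (Cb r)|move: (Cc r)|move: (Cd r)|move: (Ce r)];
  apply: Cr_eq => // x _; rewrite mxE.
Qed.

Definition lin5 (a b c d e : R) x : R :=
  a * x 0 i0 + b * x 0 i1 + c * x 0 i2 + d * x 0 i3 + e * x 0 i4.

Lemma Coo_lin5 U a b c d e : open U -> Coo U (lin5 a b c d e : _ -> R^o).
Proof.
move=> oU r; have C i : Cr r U (fun x : 'rV[R]_5 => x 0 i : R^o).
  exact: (Cr_coord (m := 0)).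
by do ![apply: CrD => //]; apply: CrZ.
Qed.

End Vec5.

Section LinearDiffeo.
Context {R : realType}.
Local Notation rV := 'rV[R]_5.
Variables (L L' : rV -> rV).
Hypotheses (LZ : forall c x, L (c *: x) = c *: L x) (L'Z : forall c x, L' (c *: x) = c *: L' x).
Hypotheses (LK : cancel L L') (L'K : cancel L' L).
Hypotheses (CL : Coo setT L) (CL' : Coo setT L').

Lemma homogeneous_neq0 (f g : rV -> rV) : (forall c x, g (c *: x) = c *: g x) ->
  cancel f g -> forall x, x != 0 -> f x != 0.
Proof.
move=> gZ fK x; apply: contra_neq => fx0; rewrite -(fK x) fx0.
by have := gZ 0 0; rewrite scaler0 scale0r.
Qed.

Lemma radial_radial (f : rV -> rV) : (forall c x, f (c *: x) = c *: f x) ->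
  forall x, x != 0 -> radial (f (radial x)) = radial (f x).
Proof. by move=> fZ x x0; rewrite {2}/radial fZ radialZ // invr_gt0 enorm_gt0. Qed.

Lemma smooth_radial_comp (f : rV -> rV) : Coo setT f -> (forall x, x != 0 -> f x != 0) ->
  smooth_on (sphere R 4) (fun x => radial (f x)).
Proof.
move=> Cf f0; apply: (smooth_on_open (@open_nonzero R 4)) => [x|r]; first exact: sphere_neq0.
apply: (Cr_rV_comp_rV (U' := @nonzero R 4) (f := f) (@open_nonzero R 4) (@open_nonzero R 4) f0 _ (@Coo_radial R 4 r)).
exact: Cr_sub (Cf r).
Qed.

Lemma lin_neq0 x : x != 0 -> L x != 0. Proof. exact: homogeneous_neq0 L'Z LK x. Qed.
Lemma lin_inv_neq0 x : x != 0 -> L' x != 0. Proof. exact: homogeneous_neq0 LZ L'K x. Qed.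

(** The action on rays. In the chart that divides by the last coordinate it is a projective map, so
    every invertible affine map of the chart is induced by a diffeomorphism of the sphere. *)
Definition sd_lin : sphere_diffeo R 4.
Proof.
refine (@SphereDiffeo R 4 (fun x => radial (L x)) (fun x => radial (L' x)) _ _ _ _ _ _).
- by move=> x /sphere_neq0 x0; exact/radial_sphere/lin_neq0.
- by move=> x /sphere_neq0 x0; exact/radial_sphere/lin_inv_neq0.
- by move=> x xS; rewrite radial_radial ?LK ?radial_id //; exact/lin_neq0/sphere_neq0.
- by move=> x xS; rewrite radial_radial ?L'K ?radial_id //; exact/lin_inv_neq0/sphere_neq0.
- exact: smooth_radial_comp CL lin_neq0.
- exact: smooth_radial_comp CL' lin_inv_neq0.
Defined.

End LinearDiffeo.

Section Twist.
Context {R : realType}.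
Local Notation rV := 'rV[R]_5.
Implicit Types (phi : R -> R) (x : rV).

(** The angle depends on a coordinate that the rotation preserves, so the opposite angle gives the
    inverse, whatever the smooth function [phi]. *)
Definition twist phi x : rV :=
  vec5 (cos (phi (x 0 i2)) * x 0 i0 - sin (phi (x 0 i2)) * x 0 i1)
       (sin (phi (x 0 i2)) * x 0 i0 + cos (phi (x 0 i2)) * x 0 i1)
       (x 0 i2) (x 0 i3) (x 0 i4).

Lemma sqnorm_twist phi x : sqnorm (twist phi x) = sqnorm x.
Proof.
rewrite [in RHS](vec5_eta x) !sqnorm_vec5.
by have := cos2Dsin2 (phi (x 0 i2)); nra.
Qed.

Lemma twist_sphere phi x : sphere R 4 x -> sphere R 4 (twist phi x).
Proof. by move=> /sphereP xS; apply/sphereP; rewrite sqnorm_twist. Qed.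

Lemma twistK phi : cancel (twist phi) (twist (fun y => - phi y)).
Proof.
move=> x; rewrite [RHS]vec5_eta /twist !vec5E cosN sinN.
have h := cos2Dsin2 (phi (x 0 i2)).
congr vec5; rewrite -[RHS]mul1r -h; ring.
Qed.

Lemma Coo_twist phi : Coo setT (phi : R^o -> R^o) -> Coo setT (twist phi).
Proof.
move=> Cphi; have C i : Coo setT (fun x : rV => x 0 i : R^o).
  by move=> r; exact: (Cr_coord (m := 0)).
have Cc (f : R^o -> R^o) : Coo setT f -> Coo setT (fun x : rV => f (phi (x 0 i2)) : R^o).
  move=> Cf r.
  have Cp := Cr_comp (f := fun x : rV => x 0 i2 : R^o) openT (fun _ _ => I) (C i2 r) (Cphi r).
  exact: (Cr_comp openT (fun _ _ => I) Cp (Cf r)).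
apply: Coo_vec5 => //; first exact: openT.
  by move=> r; apply: CrB; [exact: openT| |]; (apply: CrM; [exact: openT| |exact: C]);
    apply: Cc; [exact: Coo_cos|exact: Coo_sin].
by move=> r; apply: CrD; [exact: openT| |]; (apply: CrM; [exact: openT| |exact: C]);
    apply: Cc; [exact: Coo_sin|exact: Coo_cos].
Qed.

Definition sd_twist phi (Cphi : Coo setT (phi : R^o -> R^o)) : sphere_diffeo R 4.
Proof.
refine (@SphereDiffeo R 4 (twist phi) (twist (fun y => - phi y)) _ _ _ _ _ _).
- by move=> x; exact: twist_sphere.
- by move=> x; exact: twist_sphere.
- by move=> x xS; exact: twistK.
- move=> x xS; have := twistK (fun y => - phi y) x.
  by rewrite (_ : (fun y => - - phi y) = phi) //; apply/funext => y; rewrite opprK.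
- by apply: (smooth_on_open openT) => //; exact: Coo_twist.
- apply: (smooth_on_open openT) => //; apply: Coo_twist => r.
  by apply: CrN; [exact: openT|exact: Cphi].
Defined.

Lemma twist0 phi x : phi (x 0 i2) = 0 -> twist phi x = x.
Proof.
by move=> h; rewrite [RHS]vec5_eta /twist h cos0 sin0 !mul1r !mul0r subr0 add0r.
Qed.

Lemma twist_pi phi x : phi (x 0 i2) = pi ->
  twist phi x = vec5 (- x 0 i0) (- x 0 i1) (x 0 i2) (x 0 i3) (x 0 i4).
Proof.
by move=> h; rewrite /twist h cospi sinpi !mulN1r !mul0r subr0 add0r.
Qed.

End Twist.

Section Horseshoe.
Context {R : realType}.
Local Notation rV := 'rV[R]_5.
Implicit Types x y : rV.

(* In homogeneous coordinates (u1, u2, s1, s2, t), the sign of u1 + s1 - 5/6 t tells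
   the two boxes apart; it is the third coordinate after [chart1]. *)
Definition chart1 x : rV :=
  vec5 (lin5 (-1) 0 1 0 1 x) (lin5 0 1 0 0 0 x) (lin5 1 0 1 0 (- (5 / 6)) x)
       (lin5 0 0 0 1 0 x) (lin5 0 0 0 0 1 x).

Definition chart1_inv x : rV :=
  vec5 (lin5 (- 2^-1) 0 2^-1 0 (11 / 12) x) (lin5 0 1 0 0 0 x)
       (lin5 2^-1 0 2^-1 0 (- 12^-1) x) (lin5 0 0 0 1 0 x) (lin5 0 0 0 0 1 x).

Definition shift_center (c : R) x : rV :=
  vec5 (lin5 1 0 0 0 c x) (lin5 0 1 0 0 0 x) (lin5 0 0 1 0 0 x)
       (lin5 0 0 0 1 0 x) (lin5 0 0 0 0 1 x).

(* inverse of (u1, u2, s1, s2, t) |-> (s1 - u1, u2, u1 + s1 - 5/6 t, s2, t), followed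
   by diag(4, 4, 1/4, 1/4, 1) *)
Definition chart2 x : rV :=
  vec5 (lin5 (-2) 0 2 0 (5 / 3) x) (lin5 0 4 0 0 0 x)
       (lin5 8^-1 0 8^-1 0 (5 / 48) x) (lin5 0 0 0 4^-1 0 x) (lin5 0 0 0 0 1 x).

Definition chart2_inv x : rV :=
  vec5 (lin5 (- 4^-1) 0 4 0 0 x) (lin5 0 4^-1 0 0 0 x)
       (lin5 4^-1 0 4 0 (- (5 / 6)) x) (lin5 0 0 0 4 0 x) (lin5 0 0 0 0 1 x).

Lemma Coo_vec5_lin (a b c d e : R * R * R * R * R) :
  let l (p : R * R * R * R * R) := let: (p1, p2, p3, p4, p5) := p in lin5 p1 p2 p3 p4 p5 in
  Coo setT (fun x => vec5 (l a x) (l b x) (l c x) (l d x) (l e x)).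
Proof.
move: a b c d e => [[[[? ?] ?] ?] ?] [[[[? ?] ?] ?] ?] [[[[? ?] ?] ?] ?] [[[[? ?] ?] ?] ?] [[[[? ?] ?] ?] ?] /=.
by apply: Coo_vec5; first exact: openT; apply: Coo_lin5; exact: openT.
Qed.

Lemma lin5Z a b c d e k x : lin5 a b c d e (k *: x) = k * lin5 a b c d e x :> R.
Proof. by rewrite /lin5 !mxE; ring. Qed.

Lemma chart1Z c x : chart1 (c *: x) = c *: chart1 x.
Proof. by rewrite /chart1 !lin5Z -vec5Z. Qed.
Lemma chart1_invZ c x : chart1_inv (c *: x) = c *: chart1_inv x.
Proof. by rewrite /chart1_inv !lin5Z -vec5Z. Qed.
Lemma chart2Z c x : chart2 (c *: x) = c *: chart2 x.
Proof. by rewrite /chart2 !lin5Z -vec5Z. Qed.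
Lemma chart2_invZ c x : chart2_inv (c *: x) = c *: chart2_inv x.
Proof. by rewrite /chart2_inv !lin5Z -vec5Z. Qed.
Lemma shift_centerZ k c x : shift_center k (c *: x) = c *: shift_center k x.
Proof. by rewrite /shift_center !lin5Z -vec5Z. Qed.

Lemma chart1K : cancel chart1 chart1_inv.
Proof.
by move=> x; rewrite [RHS]vec5_eta /chart1 /chart1_inv /lin5 !vec5E; congr vec5; field.
Qed.
Lemma chart1_invK : cancel chart1_inv chart1.
Proof.
by move=> x; rewrite [RHS]vec5_eta /chart1 /chart1_inv /lin5 !vec5E; congr vec5; field.
Qed.
Lemma chart2K : cancel chart2 chart2_inv.
Proof.
by move=> x; rewrite [RHS]vec5_eta /chart2 /chart2_inv /lin5 !vec5E; congr vec5; field.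
Qed.
Lemma chart2_invK : cancel chart2_inv chart2.
Proof.
by move=> x; rewrite [RHS]vec5_eta /chart2 /chart2_inv /lin5 !vec5E; congr vec5; field.
Qed.
Lemma shift_centerK c : cancel (shift_center c) (shift_center (- c)).
Proof.
by move=> x; rewrite [RHS]vec5_eta /shift_center /lin5 !vec5E; congr vec5; ring.
Qed.

Lemma shift_centerK' c : cancel (shift_center (- c)) (shift_center c).
Proof. by have := shift_centerK (- c); rewrite opprK. Qed.

Lemma Coo_chart1 : Coo setT chart1.
Proof. exact: (Coo_vec5_lin (_, _, _, _, _) (_, _, _, _, _) (_, _, _, _, _) (_, _, _, _, _) (_, _, _, _, _)). Qed.
Lemma Coo_chart1_inv : Coo setT chart1_inv.
Proof. exact: (Coo_vec5_lin (_, _, _, _, _) (_, _, _, _, _) (_, _, _, _, _) (_, _, _, _, _) (_, _, _, _, _)). Qed.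
Lemma Coo_chart2 : Coo setT chart2.
Proof. exact: (Coo_vec5_lin (_, _, _, _, _) (_, _, _, _, _) (_, _, _, _, _) (_, _, _, _, _) (_, _, _, _, _)). Qed.
Lemma Coo_chart2_inv : Coo setT chart2_inv.
Proof. exact: (Coo_vec5_lin (_, _, _, _, _) (_, _, _, _, _) (_, _, _, _, _) (_, _, _, _, _) (_, _, _, _, _)). Qed.
Lemma Coo_shift_center c : Coo setT (shift_center c).
Proof. exact: (Coo_vec5_lin (_, _, _, _, _) (_, _, _, _, _) (_, _, _, _, _) (_, _, _, _, _) (_, _, _, _, _)). Qed.

(** Equal to 0 below -1/48 and to pi above 1/48. On the boxes with t = 1, u1 + s1 - 5/6 is below 3/4
    - 5/6 = -1/12 or above 11/12 - 5/6 = 1/12, and normalisation divides it by at most 4. *)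
Definition angle (v : R) : R := pi * step (24 * v + 2^-1).

Lemma Coo_angle : Coo setT (angle : R^o -> R^o).
Proof.
move=> r; apply: CrZ; first exact: openT.
apply: (Cr_comp (f := fun v : R^o => 24 * v + 2^-1 : R^o) openT (fun _ _ => I) _ (Coo_step r)).
apply: CrD; [exact: openT| |exact: Cr_cst].
by apply: CrZ; [exact: openT|exact: Cr_id].
Qed.

Definition sd_chart1 : sphere_diffeo R 4 :=
  sd_lin chart1Z chart1_invZ chart1K chart1_invK Coo_chart1 Coo_chart1_inv.
Definition sd_shift : sphere_diffeo R 4 :=
  sd_lin (shift_centerZ (-1)) (shift_centerZ 1) (@shift_centerK' 1) (@shift_centerK 1)
    (Coo_shift_center (-1)) (Coo_shift_center 1).
Definition sd_chart2 : sphere_diffeo R 4 :=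
  sd_lin chart2Z chart2_invZ chart2K chart2_invK Coo_chart2 Coo_chart2_inv.

(* Before the scaling by diag(4, 4, 1/4, 1/4, 1), the branch i = 1 is u1 |-> u1 - t,
   s1 |-> s1 + t, which fixes u1 + s1. Where [angle] is pi, two half-turns about centres
   differing by t compose to this translation; where it is 0 they do nothing. *)
Definition horseshoe : sphere_diffeo R 4 :=
  sd_comp sd_chart2 (sd_comp (sd_twist Coo_angle)
    (sd_comp sd_shift (sd_comp (sd_twist Coo_angle) sd_chart1))).

(** On the invariant set u1 - i and s1 range over [0, 1/3] and u2 = s2 = 0; a margin of 1/24 makes
    the boxes open neighbourhoods. All bounds scale with the last coordinate, so that membership can
    be tested before normalisation. *)
Definition box (i : bool) x : Prop :=
  [/\ 0 < x 0 i4,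
      - x 0 i4 / 24 < x 0 i0 - i%:R * x 0 i4 < 3 * x 0 i4 / 8,
      `|x 0 i1| < x 0 i4,
      - x 0 i4 / 24 < x 0 i2 < 3 * x 0 i4 / 8
    & `|x 0 i3| < x 0 i4].

Definition branch (i : bool) x : rV :=
  vec5 (4 * (x 0 i0 - i%:R * x 0 i4)) (4 * x 0 i1) ((x 0 i2 + i%:R * x 0 i4) / 4)
       (x 0 i3 / 4) (x 0 i4).

Lemma branchZ i c x : branch i (c *: x) = c *: branch i x.
Proof. by rewrite /branch !mxE vec5Z; congr vec5; ring. Qed.

Lemma neq0_i4 x : x 0 i4 != 0 -> x != 0.
Proof. by apply: contra_neq => ->; rewrite mxE. Qed.

Lemma enorm_le4 x : sqnorm x <= 16 -> enorm x <= 4.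
Proof.
move=> h; rewrite -(ler_pXn2r (n := 2)) ?nnegrE ?enorm_ge0 ?ler0n // sqr_enorm.
by apply: le_trans h _; lra.
Qed.

Lemma twist_radial_id x : x != 0 -> sqnorm x <= 16 -> x 0 i2 <= - 12^-1 ->
  twist angle (radial x) = radial x.
Proof.
move=> x0 /enorm_le4 x4 x2; have p0 := enorm_gt0 x0.
apply: twist0; rewrite /angle step0 ?mulr0 // mxE.
have : (enorm x)^-1 * x 0 i2 <= - 48^-1.
  by rewrite mulrC ler_pdivrMr //; lra.
by lra.
Qed.

Lemma twist_radial_pi x : x != 0 -> sqnorm x <= 16 -> 12^-1 <= x 0 i2 ->
  twist angle (radial x) =
  radial (vec5 (- x 0 i0) (- x 0 i1) (x 0 i2) (x 0 i3) (x 0 i4)).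
Proof.
move=> x0 /enorm_le4 x4 x2; have p0 := enorm_gt0 x0.
rewrite twist_pi; last first.
  rewrite /angle step1 ?mulr1 // mxE.
  have : 48^-1 <= (enorm x)^-1 * x 0 i2 by rewrite mulrC ler_pdivlMr //; lra.
  by lra.
rewrite {-1}/radial.
have -> : enorm (vec5 (- x 0 i0) (- x 0 i1) (x 0 i2) (x 0 i3) (x 0 i4)) = enorm x.
  by rewrite !enormE [in RHS](vec5_eta x) !sqnorm_vec5 !sqrrN.
by rewrite vec5Z !mxE !mulrN.
Qed.

Lemma horseshoe_box1 i x : x 0 i4 = 1 -> box i x ->
  horseshoe (radial x) = radial (branch i x).
Proof.
move=> t1; rewrite (vec5_eta x) t1 /box /branch !vec5E.
move: (x 0 i0) (x 0 i1) (x 0 i2) (x 0 i3) => u1 u2 s1 s2.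
case=> _; rewrite !mulr1 !ltr_norml => /andP[a1 a2] /andP[b1 b2] /andP[c1 c2] /andP[e1 e2].
have n0 y : y 0 i4 = 1 -> y != 0 by move=> h; rewrite neq0_i4 // h oner_eq0.
have u22 : u2 ^+ 2 <= 1 by nra.
have s22 : s2 ^+ 2 <= 1 by nra.
rewrite /= (radial_radial chart1Z) //; last by apply: n0; rewrite vec5E.
have -> : chart1 (vec5 u1 u2 s1 s2 1) = vec5 (s1 - u1 + 1) u2 (u1 + s1 - 5 / 6) s2 1.
  by rewrite /chart1 /lin5 !vec5E; congr vec5; field.
(* Put a = s1 - u1 + 1. The middle shift alone gives a - 1 = s1 - u1. Between two half-turns it
   gives a + 1 = (s1 + 1) - (u1 - 1), while u2 changes sign twice. *)
case: i a1 a2 => /= a1 a2.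
- rewrite (twist_radial_pi (x := vec5 (s1 - u1 + 1) u2 (u1 + s1 - 5 / 6) s2 1));
    [|by apply: n0; rewrite vec5E|by rewrite sqnorm_vec5; nra|by rewrite vec5E; lra].
  rewrite !vec5E.
  rewrite (radial_radial (shift_centerZ (-1))) //; last by apply: n0; rewrite vec5E.
  have -> : shift_center (-1) (vec5 (- (s1 - u1 + 1)) (- u2) (u1 + s1 - 5 / 6) s2 1) =
      vec5 (u1 - s1 - 2) (- u2) (u1 + s1 - 5 / 6) s2 1.
    by rewrite /shift_center /lin5 !vec5E; congr vec5; field.
  rewrite twist_radial_pi;
    [|by apply: n0; rewrite vec5E|by rewrite sqnorm_vec5; nra|by rewrite vec5E; lra].
  rewrite !vec5E.
  rewrite (radial_radial chart2Z) //; last by apply: n0; rewrite vec5E.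
  by congr radial; rewrite /chart2 /lin5 !vec5E; congr vec5; field.
- rewrite (twist_radial_id (x := vec5 (s1 - u1 + 1) u2 (u1 + s1 - 5 / 6) s2 1));
    [|by apply: n0; rewrite vec5E|by rewrite sqnorm_vec5; nra|by rewrite vec5E; lra].
  rewrite (radial_radial (shift_centerZ (-1))) //; last by apply: n0; rewrite vec5E.
  have -> : shift_center (-1) (vec5 (s1 - u1 + 1) u2 (u1 + s1 - 5 / 6) s2 1) =
      vec5 (s1 - u1) u2 (u1 + s1 - 5 / 6) s2 1.
    by rewrite /shift_center /lin5 !vec5E; congr vec5; field.
  rewrite twist_radial_id;
    [|by apply: n0; rewrite vec5E|by rewrite sqnorm_vec5; nra|by rewrite vec5E; lra].
  rewrite (radial_radial chart2Z) //; last by apply: n0; rewrite vec5E.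
  by congr radial; rewrite /chart2 /lin5 !vec5E; congr vec5; field.
Qed.

Lemma boxZ i c x : 0 < c -> box i x -> box i (c *: x).
Proof.
move=> c0; rewrite /box !mxE !normrM (gtr0_norm c0).
case=> t0 /andP[a1 a2] b /andP[c1 c2] d; split; rewrite ?pmulr_rgt0 ?ltr_pM2l //.
  apply/andP; split.
    by have := a1; rewrite -(ltr_pM2l c0); lra.
  by have := a2; rewrite -(ltr_pM2l c0); lra.
apply/andP; split.
  by have := c1; rewrite -(ltr_pM2l c0); lra.
by have := c2; rewrite -(ltr_pM2l c0); lra.
Qed.

Lemma horseshoe_box i x : box i x -> horseshoe (radial x) = radial (branch i x).
Proof.
move=> bx; have t0 : 0 < x 0 i4 by case: bx.
have V0 : 0 < (x 0 i4)^-1 by rewrite invr_gt0.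
rewrite -(radialZ x V0) (horseshoe_box1 (i := i)) ?branchZ ?radialZ //.
  by rewrite mxE mulVf // gt_eqF.
exact: boxZ.
Qed.

End Horseshoe.

(** * Coding of the invariant set *)

Section Base4.
Context {R : realType}.
Implicit Types a b : nat -> bool.

Definition base4 a : R := limn (series (fun j => (a j)%:R / 4 ^+ j : R)).

Lemma base4_cvg a : cvgn (series (fun j => (a j)%:R / 4 ^+ j : R)).
Proof.
have g4 : cvgn (series (fun n => (4^-1 : R) ^+ n)).
  have -> : (fun n => (4^-1 : R) ^+ n) = geometric 1 4^-1.
    by apply/funext => n; rewrite /= mul1r.
  by apply: is_cvg_geometric_series; rewrite gtr0_norm //; lra.
apply: series_le_cvg g4 => n /=.
- by rewrite divr_ge0 // exprn_ge0.
- by rewrite exprn_ge0.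
- by rewrite exprVn ler_piMl ?invr_ge0 ?exprn_ge0 //; case: (a n).
Qed.

Lemma base4_ge0 a : 0 <= base4 a.
Proof.
apply: limr_ge; first exact: base4_cvg.
near=> n; rewrite /series /=; apply: sumr_ge0 => i _.
by rewrite divr_ge0 // exprn_ge0.
Unshelve. all: by end_near. Qed.

Lemma base4_le a : base4 a <= 4 / 3.
Proof.
apply: limr_le; first exact: base4_cvg.
near=> n; apply: le_trans (_ : 4 / 3 - (4 / 3) / 4 ^+ n <= _); last first.
  by rewrite gerBl divr_ge0 ?exprn_ge0 //; lra.
elim: (n) => [|k IH]; first by rewrite /series /= big_geq // expr0; lra.
rewrite seriesSr; apply: le_trans (lerD IH (_ : _ <= 4 ^- k)) _.
  by rewrite ler_piMl ?invr_ge0 ?exprn_ge0 //; case: (a k).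
rewrite exprS invfM mulrA.
have : 0 < (4 ^- k : R) by rewrite invr_gt0 exprn_gt0.
by move: (4 ^- k) => q q0; lra.
Unshelve. all: by end_near. Qed.

Lemma base4_rec a : base4 a = (a 0%N)%:R + base4 (fun j => a j.+1) / 4.
Proof.
have h : (fun n => (a 0%N)%:R + series (fun j => (a j.+1)%:R / 4 ^+ j : R) n / 4) @ \oo -->
    (a 0%N)%:R + base4 (fun j => a j.+1) / 4.
  apply: cvgD; first exact: cvg_cst.
  by apply: cvgM; [exact: base4_cvg|exact: cvg_cst].
apply: cvg_lim => //; rewrite -cvg_shiftS; apply: cvg_trans h.
apply: near_eq_cvg; near=> n.
rewrite /series /= big_nat_recl //= expr0 divr1; congr (_ + _).
rewrite mulr_suml; apply: eq_bigr => i _; rewrite exprS; field.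
by rewrite expf_neq0 // pnatr_eq0.
Unshelve. all: by end_near. Qed.

Lemma pow4_small (C e : R) : 0 < e -> exists n, C / 4 ^+ n <= e.
Proof.
move=> e0; have [n hn] := pow4_unbounded (C / e); exists n.
by rewrite ler_pdivrMr ?exprn_gt0 // mulrC -ler_pdivrMr // ltW.
Qed.

(** The difference w of two bounded solutions satisfies w_0 = w_n / 4^n, hence vanishes. A bounded
    orbit is thereby determined by its itinerary. *)
Lemma base4_unique a (v : nat -> R) (C : R) :
  (forall n, v n = (a n)%:R + v n.+1 / 4) -> (forall n, `|v n| <= C) -> v 0%N = base4 a.
Proof.
move=> vr vC; pose w n := v n - base4 (fun j => a (j + n)%N).
have wr n : w n = w n.+1 / 4.
  rewrite /w [in LHS]vr [in LHS]base4_rec add0n.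
  have -> : (fun j => a (j.+1 + n)%N) = (fun j => a (j + n.+1)%N).
    by apply/funext => j; rewrite addSnnS.
  by field.
have wC n : `|w n| <= C + 4 / 3.
  apply: le_trans (ler_normB _ _) _; apply: lerD; first exact: vC.
  by rewrite ger0_norm ?base4_ge0 // base4_le.
have wn n : w 0%N = w n / 4 ^+ n.
  elim: n => [|n IH]; first by rewrite expr0 divr1.
  rewrite IH [in LHS]wr exprS; field.
  by rewrite expf_neq0 // pnatr_eq0.
have w0 : w 0%N = 0.
  apply/eqP; rewrite -normr_le0; apply/ler_addgt0Pl => e e0; rewrite addr0.
  have [n hn] := pow4_small (C + 4 / 3) e0.
  rewrite (wn n) normrM (ger0_norm (x := (4 ^+ n)^-1)) ?invr_ge0 ?exprn_ge0 //.
  by apply: le_trans hn; rewrite ler_wpM2r // invr_ge0 exprn_ge0.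
move: w0 => /eqP; rewrite /w subr_eq0 => /eqP ->; congr base4.
by apply/funext => j; rewrite addn0.
Qed.

Lemma base4_agree a b n : (forall j, (j < n)%N -> a j = b j) ->
  `|base4 a - base4 b| <= (4 / 3) / 4 ^+ n.
Proof.
elim: n a b => [|n IH] a b ab.
  rewrite expr0 divr1 ler_norml.
  by have := base4_ge0 a; have := base4_ge0 b; have := base4_le a; have := base4_le b; lra.
rewrite (base4_rec a) (base4_rec b) ab //.
have := IH (fun j => a j.+1) (fun j => b j.+1) (fun j jn => ab j.+1 jn).
set x := base4 _; set y := base4 (fun j => b _) => h.
have -> : (b 0%N)%:R + x / 4 - ((b 0%N)%:R + y / 4) = (x - y) / 4 by field.
rewrite normrM (ger0_norm (x := 4^-1)) ?invr_ge0 // exprS invfM.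
by rewrite mulrCA mulrC ler_wpM2l // invr_ge0.
Qed.

End Base4.

Section Coding.
Context {R : realType}.
Local Notation rV := 'rV[R]_5.
Implicit Types (w : int -> bool) (x : rV).

Definition shift (m : int) w : int -> bool := fun j => w (j + m).
Definition future w (j : nat) : bool := w (Posz j).
Definition past w (j : nat) : bool := w (Negz j).

Definition ucoord w : R := base4 (future w).
(** The past begins at position -1, which carries the weight 1/4: a letter crossing into the past
    enters s exactly as the branch (s + i) / 4 prescribes. *)
Definition scoord w : R := base4 (past w) / 4.

Lemma shiftD m k w : shift m (shift k w) = shift (m + k) w.
Proof. by apply/funext => j; rewrite /shift addrA. Qed.

Lemma shift0 w : shift 0 w = w.
Proof. by apply/funext => j; rewrite /shift addr0. Qed.

Lemma ucoord_shift w : ucoord (shift 1 w) = 4 * (ucoord w - (w 0)%:R).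
Proof.
rewrite /ucoord [in RHS]base4_rec.
have -> : future (shift 1 w) = (fun j => future w j.+1).
  by apply/funext => j; rewrite /future /shift -[1]/(Posz 1) -PoszD addn1.
by rewrite /future; field.
Qed.

Lemma scoord_shift w : scoord (shift 1 w) = (scoord w + (w 0)%:R) / 4.
Proof.
rewrite /scoord [in LHS]base4_rec.
have -> : (fun j => past (shift 1 w) j.+1) = past w.
  by apply/funext => j; rewrite /past /shift; congr w; rewrite !NegzE; lia.
have -> : past (shift 1 w) 0 = w 0 by [].
by field.
Qed.

Lemma ucoord_bounds w : 0 <= ucoord w - (w 0)%:R <= 3^-1.
Proof.
rewrite /ucoord base4_rec /future addrC addKr.
by have := @base4_ge0 R (fun j => w j.+1); have := @base4_le R (fun j => w j.+1); lra.
Qed.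

Lemma scoord_bounds w : 0 <= scoord w <= 3^-1.
Proof.
by rewrite /scoord; have := @base4_ge0 R (past w); have := @base4_le R (past w); lra.
Qed.

Definition chart_point w : rV := vec5 (ucoord w) 0 (scoord w) 0 1.
Definition point w : rV := radial (chart_point w).
Definition cantor : set rV := range point.

Lemma chart_point_neq0 w : chart_point w != 0.
Proof. by apply: neq0_i4; rewrite vec5E oner_eq0. Qed.

Lemma point_sphere w : sphere R 4 (point w).
Proof. exact/radial_sphere/chart_point_neq0. Qed.

Lemma box_chart_point w : box (w 0) (chart_point w).
Proof.
rewrite /box !vec5E normr0 !mulr1; have := ucoord_bounds w; have := scoord_bounds w.
by move=> h1 h2; split => //; lra.
Qed.

Lemma branch_chart_point w : branch (w 0) (chart_point w) = chart_point (shift 1 w).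
Proof.
by rewrite /branch /chart_point !vec5E ucoord_shift scoord_shift !mulr1 mulr0 mul0r.
Qed.

Lemma horseshoe_point w : horseshoe (point w) = point (shift 1 w).
Proof. by rewrite /point (horseshoe_box (box_chart_point w)) branch_chart_point. Qed.

Lemma iterz_point m w : iterz horseshoe m (point w) = point (shift m w).
Proof.
have inv w' : sd_inv horseshoe (point w') = point (shift (-1) w').
  rewrite -[in LHS](shift0 w') -[0](subrr 1) -shiftD -horseshoe_point sd_funK //.
  exact: point_sphere.
elim/int_ind: m => [|m IH|m IH]; first by rewrite shift0.
  have -> : Posz m.+1 = m%:Z + 1 by rewrite intS addrC.
  rewrite -iterzS ?IH ?horseshoe_point ?shiftD 1?[in RHS]addrC //; exact: point_sphere.
have -> : - Posz m.+1 = - m%:Z - 1 by rewrite intS opprD addrC.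
rewrite -iterzP ?IH ?inv ?shiftD 1?[in RHS]addrC //; exact: point_sphere.
Qed.

Lemma point_ratio w : point w 0 i4 > 0 /\ point w 0 i0 / point w 0 i4 = ucoord w.
Proof.
have p0 := enorm_gt0 (chart_point_neq0 w).
rewrite /point /radial vec5Z !vec5E mulr1 invr_gt0 p0; split => //.
by field; rewrite gt_eqF.
Qed.

Lemma point_inj : injective point.
Proof.
move=> w w' ww'; apply/funext => m.
(* u lies in [0, 1/3] or in [1, 4/3] according to the letter at 0, and 1/2 separates the two. *)
have digit v : v 0 = (2^-1 < ucoord v).
  by have := ucoord_bounds v; case: (v 0) => /= h; apply/esym; [|apply/negbTE; rewrite -leNgt]; lra.
have E v : v m = (2^-1 < ucoord (shift m v)) by rewrite -digit /shift add0r.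
rewrite !E; have := congr1 (iterz horseshoe m) ww'; rewrite !iterz_point => h.
by have [_ <-] := point_ratio (shift m w); have [_ <-] := point_ratio (shift m w'); rewrite h.
Qed.

Lemma cantor_sphere : cantor `<=` sphere R 4.
Proof. by move=> _ [w _ <-]; exact: point_sphere. Qed.

Lemma horseshoe_cantor : horseshoe @` cantor = cantor.
Proof.
apply/seteqP; split=> [_ [_ [w _ <-] <-]|_ [w _ <-]].
  by exists (shift 1 w) => //; rewrite horseshoe_point.
by exists (point (shift (-1) w)); [exists (shift (-1) w)|rewrite horseshoe_point shiftD subrr shift0].
Qed.

Definition boxes : set rV := [set x | exists i, box i x].

Lemma cantor_boxes : cantor `<=` boxes.
Proof.
move=> _ [w _ <-]; exists (w 0); apply: boxZ; last exact: box_chart_point.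
by rewrite invr_gt0 enorm_gt0 // chart_point_neq0.
Qed.

(** In the chart the orbit obeys affine recursions and stays bounded. By [base4_unique], the future
    determines the expanding coordinates and the past the contracting ones; those without
    translation follow the zero digits and vanish. *)
Lemma boxes_orbit_cantor x : sphere R 4 x ->
  (forall m, boxes (iterz horseshoe m x)) -> cantor x.
Proof.
move=> xS xb; have [w wb] := choice xb.
pose X m := iterz horseshoe m x.
have t0 m : 0 < X m 0 i4 by have [] := wb m.
pose g i m := X m 0 i / X m 0 i4.
have rec m : exists2 c : R, 0 < c & X (m + 1) = c *: branch (w m) (X m).
  exists (enorm (branch (w m) (X m)))^-1.
    rewrite invr_gt0 enorm_gt0 //; apply: neq0_i4; rewrite vec5E gt_eqF //; exact: t0.
  by rewrite /X -iterzS // -{1}(radial_id (iterz_sphere horseshoe m xS)) (horseshoe_box (wb m)).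
have gu m : g i0 (m + 1) = 4 * (g i0 m - (w m)%:R).
  have [c c0 E] := rec m; rewrite /g E !mxE /=; field.
  by rewrite !gt_eqF // t0.
have gu' m : g i1 (m + 1) = 4 * g i1 m.
  have [c c0 E] := rec m; rewrite /g E !mxE /=; field.
  by rewrite !gt_eqF // t0.
have gs m : g i2 (m + 1) = (g i2 m + (w m)%:R) / 4.
  have [c c0 E] := rec m; rewrite /g E !mxE /=; field.
  by rewrite !gt_eqF // t0.
have gs' m : g i3 (m + 1) = g i3 m / 4.
  have [c c0 E] := rec m; rewrite /g E !mxE /=; field.
  by rewrite !gt_eqF // t0.
have gb m : [/\ `|g i0 m| <= 2, `|g i1 m| <= 1, `|g i2 m| <= 1 & `|g i3 m| <= 1].
  have [_ h0 h1 h2 h3] := wb m; have tm := t0 m.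
  rewrite /g !normrM !normfV (gtr0_norm tm) !ler_pdivrMr // !mul1r !ler_norml.
  move: h0 h1 h2 h3; rewrite -/(X m) !ltr_norml.
  by case: (w m) => /=; split; lra.
have succ n : Posz n.+1 = n%:Z + 1 by rewrite intS addrC.
have E0 : g i0 0 = ucoord w.
  apply: (@base4_unique _ _ (fun n => g i0 n) 2) => n; last by have [] := gb n.
  by rewrite succ gu /future; field.
(* The zero sequence solves the same recursion with all digits [false], so uniqueness identifies the
   two. *)
have E1 : g i1 0 = 0.
  have := (@base4_unique R (fun=> false) (fun n => g i1 n) 1).
  have := (@base4_unique R (fun=> false) (fun=> 0) 1).
  move=> <- => [-> // n|n|n]; rewrite ?normr0 ?mul0r ?addr0 //.
    by rewrite succ gu' add0r; field.
  by have [] := gb n.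
(* Read backwards in time, 4 s obeys the recursion with digits [past w]; the factor 4 undoes the
   division in [scoord]. *)
have E2 : g i2 0 = scoord w.
  have := (@base4_unique R (past w) (fun n => 4 * g i2 (- n%:Z)) 4).
  rewrite /= oppr0 /scoord => <- => [|n|n]; first by field.
    have -> : - n%:Z = (- n.+1%:Z) + 1 by lia.
    by rewrite gs /past -NegzE; field.
  rewrite normrM ger0_norm //; have [_ _ h _] := gb (- n%:Z).
  by lra.
have E3 : g i3 0 = 0.
  have := (@base4_unique R (fun=> false) (fun n => g i3 (- n%:Z)) 1).
  have := (@base4_unique R (fun=> false) (fun=> 0) 1).
  move=> <- => [|n|n]; rewrite ?normr0 ?mul0r ?addr0 //.
  rewrite /= oppr0; apply => n.
    have -> : - n%:Z = (- n.+1%:Z) + 1 by lia.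
    by rewrite gs' add0r.
  by have [] := gb (- n%:Z).
exists w => //; have xt := t0 0; rewrite /X /= in xt.
have -> : point w = radial ((x 0 i4)^-1 *: x); last by rewrite radialZ ?invr_gt0 // radial_id.
rewrite /point /chart_point [in RHS](vec5_eta x) vec5Z vec5E; congr (radial (vec5 _ _ _ _ _)).
- by rewrite -E0 /g /X /= mulrC.
- by rewrite -[LHS]E1 /g /X /= mulrC.
- by rewrite -E2 /g /X /= mulrC.
- by rewrite -[LHS]E3 /g /X /= mulrC.
- by rewrite mulVf // gt_eqF.
Qed.

End Coding.

(** * Local maximality, compactness and transitivity *)

Section BasicSet.
Context {R : realType}.
Local Notation rV := 'rV[R]_5.
Local Notation T := (@horseshoe R).
Local Notation K := (@cantor R).
Implicit Types (w : int -> bool) (x : rV).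

Lemma lin5_continuous a b c d e : continuous (lin5 a b c d e : rV -> R).
Proof. by move=> x; exact: (@Coo_lin5 R setT a b c d e openT 0%N). Qed.

Lemma open_lin5 a b c d e : open [set x : rV | 0 < lin5 a b c d e x].
Proof.
apply: (@open_comp _ _ (lin5 a b c d e : rV -> R) [set y | 0 < y]); last exact: open_gt.
by move=> x _; exact: lin5_continuous.
Qed.

Lemma closed_lin5 a b c d e : closed [set x : rV | 0 <= lin5 a b c d e x].
Proof.
apply: (@closed_comp _ _ (lin5 a b c d e : rV -> R) [set y | 0 <= y]); last exact: closed_ge.
by move=> x _; exact: lin5_continuous.
Qed.

Lemma open_box i : open (@box R i).
Proof.
have -> : @box R i = [set x | 0 < lin5 0 0 0 0 1 x] `&`
    [set x | 0 < lin5 1 0 0 0 (24^-1 - i%:R) x] `&`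
    [set x | 0 < lin5 (-1) 0 0 0 (3 / 8 + i%:R) x] `&`
    [set x | 0 < lin5 0 1 0 0 1 x] `&` [set x | 0 < lin5 0 (-1) 0 0 1 x] `&`
    [set x | 0 < lin5 0 0 1 0 24^-1 x] `&` [set x | 0 < lin5 0 0 (-1) 0 (3 / 8) x] `&`
    [set x | 0 < lin5 0 0 0 1 1 x] `&` [set x | 0 < lin5 0 0 0 (-1) 1 x].
  apply/seteqP; split => x; rewrite /box /lin5 /= !ltr_norml.
    by case=> *; repeat split; lra.
  by move=> [[[[[[[[? ?] ?] ?] ?] ?] ?] ?] ?]; split; lra.
by do 8!(apply: openI; last exact: open_lin5); exact: open_lin5.
Qed.

Lemma open_boxes : open (@boxes R).
Proof.
have -> : @boxes R = \bigcup_(i in setT) @box R i.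
  by apply/seteqP; split=> [x [i bx]|x [i _ bx]]; exists i.
by apply: bigcup_open => i _; exact: open_box.
Qed.

Lemma cantor_locally_maximal : locally_maximal T K.
Proof.
exists (@boxes R `&` sphere R 4); split.
  split=> [x []//|]; exists (@boxes R); split => //; first exact: open_boxes.
  exact: cantor_boxes.
apply/seteqP; split => [_ [w _ <-] m _|x xV].
  exists (point (shift (- m) w)); last by rewrite iterz_point shiftD subrr shift0.
  by split; [apply: cantor_boxes; exists (shift (- m) w)|exact: point_sphere].
have xS : sphere R 4 x by have [y [_ yS] <-] := xV 0 I.
apply: boxes_orbit_cantor => // m; have [y [yb yS] <-] := xV (- m) I.
by rewrite iterzD // subrr.
Qed.

(* The boxes are not closed, whence this description of a smaller set. *)
Definition closed_boxes : set rV :=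
  ([set x | 0 <= lin5 1 0 0 0 0 x] `&` [set x | 0 <= lin5 (-3) 0 0 0 1 x] `|`
   [set x | 0 <= lin5 1 0 0 0 (-1) x] `&` [set x | 0 <= lin5 (-3) 0 0 0 4 x]) `&`
  [set x | 0 <= lin5 0 1 0 0 0 x] `&` [set x | 0 <= lin5 0 (-1) 0 0 0 x] `&`
  [set x | 0 <= lin5 0 0 1 0 0 x] `&` [set x | 0 <= lin5 0 0 (-3) 0 1 x] `&`
  [set x | 0 <= lin5 0 0 0 1 0 x] `&` [set x | 0 <= lin5 0 0 0 (-1) 0 x] `&`
  (fun x => lin5 0 0 0 0 1 x) @^-1` [set y | 2^-1 <= y].

Lemma closed_closed_boxes : closed closed_boxes.
Proof.
apply: closedI; last first.
  apply: (@closed_comp _ _ (lin5 0 0 0 0 1 : rV -> R) [set y | 2^-1 <= y]).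
    by move=> x _; exact: lin5_continuous.
  exact: closed_ge.
do 6!(apply: closedI; last exact: closed_lin5).
by apply: closedU; apply: closedI; exact: closed_lin5.
Qed.

Lemma closed_boxes_boxes : closed_boxes `<=` boxes.
Proof.
move=> x; rewrite /closed_boxes /lin5 /=.
move=> [[[[[[[[[h1 h2]|[h1 h2]] ?] ?] ?] ?] ?] ?] ?]; [exists false|exists true];
  by rewrite /box !ltr_norml /=; split; lra.
Qed.

(** The squared norm is at most 16/9 + 1/9 + 1 < 4. Consequently the last coordinate is at least 1/2
    on the invariant set. *)
Lemma enorm_chart_point w : 1 <= enorm (@chart_point R w) <= 2.
Proof.
have := @ucoord_bounds R w; have := @scoord_bounds R w => h1 h2.
have u2 : 0 <= @ucoord R w ^+ 2 <= 16 / 9 by case: (w 0) h2 => /= h2; nra.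
have s2 : 0 <= @scoord R w ^+ 2 <= 1 / 9 by nra.
have e0 := enorm_ge0 (@chart_point R w).
have := sqr_enorm (@chart_point R w); rewrite sqnorm_vec5 expr0n expr1n /= => h.
by nra.
Qed.

Lemma cantor_closed_boxes : K `<=` closed_boxes.
Proof.
move=> _ [w _ <-]; have := @ucoord_bounds R w; have := @scoord_bounds R w => h1 h2.
have /andP[e1 e2] := enorm_chart_point w.
have q1 : 2^-1 <= (enorm (@chart_point R w))^-1 by rewrite lef_pV2 ?posrE //; lra.
rewrite /closed_boxes /lin5 /point /radial vec5Z /= !vec5E.
move: (enorm _)^-1 q1 => q q1.
have s1 : 0 <= q * @scoord R w by nra.
have s2 : q * @scoord R w <= q / 3 by nra.
have u1 : 0 <= q * (@ucoord R w - (w 0)%:R) by nra.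
have u2 : q * (@ucoord R w - (w 0)%:R) <= q / 3 by nra.
by case: (w 0) u1 u2 => /= u1 u2; repeat split; lra.
Qed.

Lemma closed_sphere : closed (sphere R 4).
Proof.
have -> : sphere R 4 = (fun x => sqnorm x) @^-1` [set 1 : R].
  by apply/seteqP; split => x /sphereP.
apply: closed_comp; last exact: closed_eq.
move=> x _; apply: (@Cr_continuous R rV R^o 0 setT) => //.
apply: Cr_sum => [|i]; first exact: openT.
have C := Cr_coord (R := R) (n := 4) (m := 0) 0 setT 0 i.
by apply: Cr_eq (CrM openT C C) => [|y _]; [exact: openT|rewrite expr2].
Qed.

(** For closedness: by continuity the whole orbit of a limit point lies in [closed_boxes], and
    [boxes_orbit_cantor] brings the point back into the set. *)
Lemma compact_cantor : compact K.
Proof.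
apply: bounded_closed_compact.
  exists 1; split => // M M1 x Kx.
  have xS := cantor_sphere Kx; rewrite /= /Num.norm /= mx_normrE.
  apply: bigmax_le; first by apply: ltW; apply: lt_trans M1.
  move=> [i j] _ /=; apply: le_trans (ltW M1).
  rewrite -(ler_pXn2r (n := 2)) ?nnegrE // expr1n real_normK ?num_real //.
  rewrite -((sphereP x).1 xS) /sqnorm (bigD1 j) //= (ord1 i) lerDl.
  by apply: sumr_ge0 => k _; exact: sqr_ge0.
rewrite closure_id; apply/seteqP; split; first exact: subset_closure.
move=> x Kx; have xS : sphere R 4 x.
  have := closure_subset (@cantor_sphere R) Kx.
  by rewrite -(closure_id _).1 //; exact: closed_sphere.
apply: boxes_orbit_cantor => // m; apply: closed_boxes_boxes.
have cf : {for x, continuous (iterz T m \o @radial R 4)}.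
  apply: differentiable_continuous; apply: smooth_on_differentiable => //.
  exact: iterz_smooth.
rewrite [X in X _](closure_id _).1; last exact: closed_closed_boxes.
move=> B nB; have nB' : nbhs ((iterz T m \o @radial R 4) x) B by rewrite /= radial_id.
have [_ [[w _ <-] /= Bw]] := Kx _ (cf _ nB').
exists (iterz T m (point w)); split.
  by rewrite iterz_point; apply: cantor_closed_boxes; exists (shift m w).
by rewrite radial_id // in Bw; exact: point_sphere.
Qed.

Lemma chart_point_cvg (u s : R) (v r : nat -> R) : v @ \oo --> u -> r @ \oo --> s ->
  (fun n => radial (vec5 (v n) 0 (r n) 0 1)) @ \oo --> radial (vec5 u 0 s 0 1).
Proof.
move=> vu rs.
have n0 : nonzero (vec5 u 0 s 0 1) by apply: neq0_i4; rewrite vec5E oner_eq0.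
have cr : {for vec5 u 0 s 0 1, continuous (@radial R 4)} by exact: (Coo_radial 0%N).
apply: continuous_cvg => //.
have E a b : vec5 a 0 b 0 1 = a *: vec5 1 0 0 0 0 + (b *: vec5 0 0 1 0 0 + vec5 0 0 0 0 1) :> rV.
  by rewrite [RHS]vec5_eta !mxE /=; congr vec5; ring.
rewrite (E u s); under eq_fun do rewrite E.
apply: cvgD; first exact: cvgZr_tmp.
by apply: cvgD; [exact: cvgZr_tmp|exact: cvg_cst].
Qed.

Lemma base4_cvg_agree (a : nat -> bool) (b : nat -> nat -> bool) :
  (forall n j, (j < n)%N -> b n j = a j) -> (fun n => @base4 R (b n)) @ \oo --> base4 a.
Proof.
move=> ab; apply/cvgrPdist_le => e e0; have [N hN] := pow4_small (4 / 3) e0.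
exists N => // n /= Nn; apply: le_trans hN.
by apply: base4_agree => j jN; rewrite ab // (leq_trans jN).
Qed.

Lemma cantor_transitive : transitive_on T K.
Proof.
move=> A B oA oB [_ [[w _ <-] Aw]] [_ [[w' _ <-] Bw']].
(* This word agrees with w before position n, and its shift by 2n agrees with w' from position -n
   on. As n grows, the first point tends to that of w and its image under the 2n-th iterate to that
   of w'. *)
pose z (n : nat) : int -> bool := fun j => if (j < n%:Z)%R then w j else w' (j - (n + n)%:Z).
have zA : (fun n => @point R (z n)) @ \oo --> @point R w.
  apply: (@chart_point_cvg (ucoord w) (scoord w) (fun n => ucoord (z n)) (fun n => scoord (z n))).
    by apply: base4_cvg_agree => n j jn; rewrite /future /z ifT.
  apply: cvgM; last exact: cvg_cst.
  by apply: base4_cvg_agree => n j jn.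
have zB : (fun n => @point R (shift (n + n)%:Z (z n))) @ \oo --> @point R w'.
  apply: (@chart_point_cvg (ucoord w') (scoord w') (fun n => ucoord (shift (n + n)%:Z (z n)))
    (fun n => scoord (shift (n + n)%:Z (z n)))).
    apply: base4_cvg_agree => n j jn; rewrite /future /shift /z ifF; first by rewrite addrK.
    by apply/negbTE; lia.
  apply: cvgM; last exact: cvg_cst.
  apply: base4_cvg_agree => n j jn; rewrite /past /shift /z ifF; first by rewrite addrK.
  by apply/negbTE; rewrite NegzE; lia.
have [N1 _ hN1] : \forall n \near \oo, A (point (z n)).
  exact: zA _ (open_nbhs_nbhs (conj oA Aw)).
have [N2 _ hN2] : \forall n \near \oo, B (point (shift (n + n)%:Z (z n))).
  exact: zB _ (open_nbhs_nbhs (conj oB Bw')).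
pose N := maxn N1 N2.
have hA : A (point (z N)) by apply: hN1; rewrite /= leq_maxl.
have hB : B (point (shift (N + N)%:Z (z N))) by apply: hN2; rewrite /= leq_maxr.
exists (N + N)%N; exists (point (shift (N + N)%:Z (z N))); split; last first.
  by split => //; exists (shift (N + N)%:Z (z N)).
exists (point (z N)); first by split => //; exists (z N).
exact: (iterz_point (N + N)%:Z).
Qed.

End BasicSet.

(** * Hyperbolicity *)

Section Gnomonic.
Context {R : realType}.
Local Notation rV := 'rV[R]_5.
Implicit Types (x y v : rV).

Definition wi (j : 'I_4) : 'I_5 := widen_ord (leqnSn 4) j.

(* Derivative at x of the central projection (y, t) |-> y / t. *)
Definition gnomonic_D x : 'M[R]_(5, 4) := \matrix_(i, j)
  ((i == wi j)%:R * (x 0 i4)^-1 - (i == i4)%:R * (x 0 (wi j) * ((x 0 i4)^-1 * (x 0 i4)^-1))).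

Definition first4 : 'M[R]_(4, 5) := \matrix_(i, j) (j == wi i)%:R.

(* On the sphere, the right inverse of [gnomonic_D x] with values in the tangent space. *)
Definition gnomonic_lift x : 'M[R]_(4, 5) := x 0 i4 *: (first4 *m (1%:M - x^T *m x)).

Lemma wi_neq4 j : (i4 == wi j) = false.
Proof. by apply/negbTE; rewrite -val_eqE /= eq_sym neq_ltn ltn_ord. Qed.

Lemma wi_inj : injective wi.
Proof. by move=> i j /(congr1 val) /= h; apply: val_inj. Qed.

Lemma wiP (i : 'I_5) : i = i4 \/ exists j, i = wi j.
Proof.
case: i => i hi; case: (ltnP i 4) => h.
  by right; exists (Ordinal h); apply: val_inj.
by left; apply: val_inj => /=; apply/eqP; rewrite eqn_leq h -ltnS hi.
Qed.

Lemma mul_gnomonic_D x v j : (v *m gnomonic_D x) 0 j =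
  v 0 (wi j) / x 0 i4 - v 0 i4 * (x 0 (wi j) / x 0 i4 ^+ 2).
Proof.
rewrite mxE (eq_bigr (fun i => (if i == wi j then v 0 i / x 0 i4 else 0) -
  (if i == i4 then v 0 i * (x 0 (wi j) / x 0 i4 ^+ 2) else 0))) => [|i _]; last first.
  rewrite mxE mulrBr expr2 invfM; congr (_ - _).
    by case: eqP; rewrite ?mul1r // mul0r mulr0.
  by case: eqP; rewrite ?mul1r // mul0r mulr0.
by rewrite sumrB -!big_mkcond /= !big_pred1_eq.
Qed.

Lemma mul_gnomonic_D_self x : x 0 i4 != 0 -> x *m gnomonic_D x = 0.
Proof.
move=> t0; apply/rowP => j; rewrite mul_gnomonic_D mxE; field.
exact: t0.
Qed.

Lemma first4_gnomonic_D x : first4 *m gnomonic_D x = (x 0 i4)^-1%:M.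
Proof.
apply/row_matrixP => i; rewrite row_mul; apply/rowP => j.
rewrite mul_gnomonic_D !mxE wi_neq4 mul0r subr0 (inj_eq wi_inj) eq_sym.
by case: eqP; rewrite ?mul1r ?mul0r.
Qed.

Lemma sphere_mul_tr x : sphere R 4 x -> x *m x^T = 1%:M.
Proof.
move=> /sphereP xS; apply/matrixP => i j; rewrite !ord1 !mxE eqxx -[RHS]xS.
by apply: eq_bigr => k _; rewrite mxE expr2.
Qed.

Lemma gnomonic_lift_tangent x : sphere R 4 x -> gnomonic_lift x *m x^T = 0.
Proof.
move=> xS; rewrite /gnomonic_lift -scalemxAl -mulmxA mulmxBl mul1mx -mulmxA.
by rewrite sphere_mul_tr // mulmx1 subrr mulmx0 scaler0.
Qed.

Lemma gnomonic_liftK x : x 0 i4 != 0 -> gnomonic_lift x *m gnomonic_D x = 1%:M.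
Proof.
move=> t0; rewrite /gnomonic_lift -scalemxAl -mulmxA mulmxBl mul1mx -mulmxA.
rewrite mul_gnomonic_D_self // mulmx0 subr0 first4_gnomonic_D.
by rewrite scale_scalar_mx mulfV.
Qed.

(** The kernel of the chart's derivative is the line of x, which is normal to the sphere. *)
Lemma gnomonic_D_inj x v : sphere R 4 x -> x 0 i4 != 0 ->
  v *m x^T = 0 -> v *m gnomonic_D x = 0 -> v = 0.
Proof.
move=> xS t0 vx vD; have vE : v = (v 0 i4 / x 0 i4) *: x.
  apply/rowP => i; rewrite mxE; case: (wiP i) => [->|[j ->]]; first by rewrite divfK.
  have := congr1 (fun w : 'rV[R]_4 => w 0 j) vD; rewrite mul_gnomonic_D mxE => h.
  apply: (mulIf (invr_neq0 t0)); apply/eqP; rewrite -subr_eq0 -[X in _ == X]h.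
  by apply/eqP; field.
move: vx; rewrite vE -scalemxAl sphere_mul_tr // => /(congr1 (fun M : 'M[R]_1 => M 0 0)).
by rewrite !mxE eqxx mulr1 => ->; rewrite scale0r.
Qed.

Lemma gnomonic_D_inj_mx m x (M N : 'M[R]_(m, 5)) : sphere R 4 x -> x 0 i4 != 0 ->
  M *m x^T = 0 -> N *m x^T = 0 -> M *m gnomonic_D x = N *m gnomonic_D x -> M = N.
Proof.
move=> xS t0 Mx Nx MN; apply/eqP; rewrite -subr_eq0; apply/eqP/row_matrixP => i.
rewrite row0; apply: (gnomonic_D_inj xS t0).
  by rewrite -row_mul mulmxBl Mx Nx subrr row0.
by rewrite -row_mul mulmxBl MN subrr row0.
Qed.

Lemma Coo_gnomonic_D i j : Coo [set x : rV | x 0 i4 != 0] (fun x => gnomonic_D x i j : R^o).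
Proof.
have oU : open [set x : rV | x 0 i4 != 0].
  rewrite (_ : [set x | _] = (fun x : rV => x 0 i4 : R^o) @^-1` [set y | y != 0]) //.
  by apply: open_comp => [x _|]; [exact: coord_continuous|exact: open_neq0].
move=> r; have C k : Cr r [set x : rV | x 0 i4 != 0] (fun x => x 0 k : R^o).
  exact: (Cr_coord (m := 0)).
have Ci : Cr r [set x : rV | x 0 i4 != 0] (fun x => (x 0 i4)^-1 : R^o).
  by apply: (Cr_comp (U' := [set y : R^o | y != 0]) oU _ (C i4) (Cr_inv r)).
have C1 := CrZ (i == wi j)%:R oU Ci.
have C2 := CrZ (i == i4)%:R oU (CrM oU (C (wi j)) (CrM oU Ci Ci)).
by apply: Cr_eq (CrB oU C1 C2) => // x _; rewrite mxE.
Qed.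

(* z is the image of y by a map which reads, in the j-th coordinate of the chart
   y |-> y_j / y_4, as the affine map of slope a and constant term c. *)
Definition affine_coord (a c : R) (j : 'I_4) y (z : rV) : Prop :=
  z 0 (wi j) * y 0 i4 = (a * y 0 (wi j) + c * y 0 i4) * z 0 i4.

Lemma derive_coord (f : rV -> rV) x v (i : 'I_5) : differentiable f x ->
  derivable (fun y => f y 0 i) x v /\ 'D_v (fun y => f y 0 i) x = (v *m 'J f x) 0 i.
Proof.
move=> df; have dv : derivable f x v by exact: diff_derivable.
split; first by have := (derivable_mxP f x v).1 dv 0 i.
by rewrite -deriveEjacobian // derive_mx // mxE.
Qed.

Lemma derive_coord_id x v (i : 'I_5) :
  derivable (fun y : rV => y 0 i) x v /\ 'D_v (fun y : rV => y 0 i) x = v 0 i.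
Proof.
have dv : derivable (@id rV) x v by exact: derivable_id.
split; first by have := (derivable_mxP (@id rV) x v).1 dv 0 i.
by have := derive_mx dv; rewrite derive_id => /(congr1 (fun w : rV => w 0 i)); rewrite mxE => ->.
Qed.

(** The cross-multiplied relation is differentiated by the product rule; the constant term drops out
    of the result. *)
Lemma affine_coord_derive (f : rV -> rV) x v a c j : differentiable f x ->
  x 0 i4 != 0 -> f x 0 i4 != 0 -> (\forall y \near x, affine_coord a c j y (f y)) ->
  (v *m 'J f x *m gnomonic_D (f x)) 0 j = a * (v *m gnomonic_D x) 0 j.
Proof.
move=> df x0 fx0 nf; have fxE := nbhs_singleton nf; rewrite /affine_coord in fxE.
have [fj1 fj2] := derive_coord v (wi j) df; have [f41 f42] := derive_coord v i4 df.
have [xj1 xj2] := derive_coord_id x v (wi j); have [x41 x42] := derive_coord_id x v i4.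
have L := deriveM fj1 x41.
have lin1 := derivableD (derivableZ (k := a) xj1) (derivableZ (k := c) x41).
have lin2 := deriveD (derivableZ (k := a) xj1) (derivableZ (k := c) x41).
have Rr := deriveM lin1 f41.
have E : 'D_v ((fun y => f y 0 (wi j)) * (fun y => y 0 i4)) x =
    'D_v ((a \*: (fun y => y 0 (wi j)) + c \*: (fun y => y 0 i4)) * (fun y => f y 0 i4)) x.
  exact: near_eq_derive.
move: E; rewrite L Rr lin2 !deriveZ // fj2 f42 xj2 x42.
rewrite !mul_gnomonic_D; set w := v *m 'J f x; rewrite !fctE /GRing.scale /=.
move: fxE; move: (f x 0 (wi j)) (f x 0 i4) fx0 (x 0 (wi j)) (x 0 i4) x0 => X X4 X40 u t t0.
move: (w 0 (wi j)) (w 0 i4) (v 0 (wi j)) (v 0 i4) => W W4 V V4 h1 h2.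
have hX : X = (a * u + c * t) * X4 / t by rewrite -h1 mulfK.
have hW : W = ((a * u + c * t) * W4 + X4 * (a * V + c * V4) - X * V4) / t.
  by rewrite -h2; field.
by rewrite hW hX; field; rewrite t0 X40.
Qed.

(** Derivative of the constant squared norm of f. *)
Lemma derive_sphere_tangent (f : rV -> rV) x v : differentiable f x ->
  (\forall y \near x, sphere R 4 (f y)) -> v *m 'J f x *m (f x)^T = 0.
Proof.
move=> df nf; apply/matrixP => i k; rewrite !ord1 [RHS]mxE mxE.
have d j := derive_coord v j df.
have D := derive_sum (fun j => derivableM (d j).1 (d j).1).
have E : 'D_v (\sum_(j < 5) ((fun y => f y 0 j) * (fun y => f y 0 j))) x = 'D_v (cst (1 : R)) x.
  apply: near_eq_derive; apply: filterS nf => y /sphereP <-.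
  by rewrite fct_sumE /sqnorm; apply: eq_bigr => j _; rewrite expr2.
move: E; rewrite D derive_cst => h.
have : 2 * (\sum_j (v *m 'J f x) 0 j * (f x)^T j 0) = 0.
  apply: etrans h; rewrite mulr_sumr; apply: eq_bigr => j _.
  rewrite (deriveM (d j).1 (d j).1) (d j).2.
  by rewrite [(f x)^T _ _]mxE /GRing.scale /=; ring.
by move/eqP; rewrite mulf_eq0 pnatr_eq0 /= => /eqP.
Qed.

End Gnomonic.

Section Hyperbolicity.
Local Opaque horseshoe.
Context {R : realType}.
Local Notation rV := 'rV[R]_5.
Local Notation T := (@horseshoe R).
Local Notation K := (@cantor R).
Implicit Types (w : int -> bool) (x y v : rV).

Definition slope (j : 'I_4) : R := [:: 4; 4; 4^-1; 4^-1]`_j.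

Lemma slope_neq0 j : slope j != 0.
Proof.
by case: j => [[|[|[|[|j]]]] h] //; rewrite /slope /= ?invr_eq0 pnatr_eq0.
Qed.

Lemma affine_coord_scale a c j k y z :
  affine_coord a c j y z -> @affine_coord R a c j y (k *: z).
Proof. by rewrite /affine_coord !mxE => h; rewrite -mulrA h; ring. Qed.

Lemma affine_coord_branch (i : bool) j x :
  @affine_coord R (slope j) ([:: - 4 * i%:R; 0; i%:R / 4; 0]`_j) j x (branch i x).
Proof.
rewrite /affine_coord [in X in _ = _ * X]/branch vec5E; congr (_ * _).
rewrite mxE; case: j => [[|[|[|[|j]]]] h] //=; rewrite /slope /=.
- by rewrite (_ : wi _ = i0); [ring|apply: val_inj].
- by rewrite (_ : wi _ = i1); [ring|apply: val_inj].
- by rewrite (_ : wi _ = i2); [ring|apply: val_inj].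
- by rewrite (_ : wi _ = i3); [ring|apply: val_inj].
Qed.

Lemma iterz_radial_differentiable (S : sphere_diffeo R 4) m x : sphere R 4 x ->
  differentiable (iterz S m \o @radial R 4) x.
Proof. by move=> xS; apply: smooth_on_differentiable => //; exact: iterz_smooth. Qed.

Lemma iterz_cantor m x : K x -> K (iterz T m x).
Proof. by move=> [w _ <-]; rewrite iterz_point; exists (shift m w). Qed.

Lemma cantor_gt0 x : K x -> 0 < x 0 i4.
Proof. by move=> [w _ <-]; have [] := @point_ratio R w. Qed.

Lemma near_i4_gt0 x : 0 < x 0 i4 -> \forall y \near x, 0 < (y : rV) 0 i4.
Proof.
by move=> x0; exact: (@coord_continuous R 1 5 0 i4 x _ (lt_nbhsr x0)).
Qed.

(** The affine relation must hold on a neighbourhood in order to be differentiated, and the openness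
    of the box around the k-th iterate propagates it. The constants [c] stay existential because
    only the slopes survive differentiation. *)
Lemma near_iter x (k : nat) : K x -> exists c : 'I_4 -> R, \forall y \near x,
  [/\ 0 < (y : rV) 0 i4, 0 < iter k T (radial y) 0 i4
    & forall j, affine_coord (slope j ^+ k) (c j) j y (iter k T (radial y))].
Proof.
move=> Kx; have xS := cantor_sphere Kx.
elim: k => [|k [c IH]].
  exists (fun=> 0); apply: filterS (near_i4_gt0 (cantor_gt0 Kx)) => y y0.
  have yn0 : y != 0 by apply: neq0_i4; rewrite gt_eqF.
  split => // [|j]; first by rewrite mxE mulr_gt0 // invr_gt0 enorm_gt0.
  by rewrite /radial; apply: affine_coord_scale; rewrite /affine_coord expr0; ring.
have Kk := iterz_cantor k Kx.
have [i bi] : exists i, box i (iterz T k x) by exact: cantor_boxes.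
have nb : \forall y \near x, box i (iter k T (radial y)).
  have cf := differentiable_continuous (iterz_radial_differentiable T k xS).
  by apply: cf; apply: open_nbhs_nbhs; split; [exact: open_box|rewrite /= radial_id].
exists (fun j => slope j * c j + [:: - 4 * i%:R; 0; i%:R / 4; 0]`_j).
apply: filterS2 IH nb => y [y0 f0 aff] bf; rewrite iterS.
have yn0 : y != 0 by apply: neq0_i4; rewrite gt_eqF.
set z := iter k T (radial y) in f0 aff bf *.
have zS : sphere R 4 z by exact: (iterz_sphere T k (radial_sphere yn0)).
have -> : T z = radial (branch i z) by rewrite -{1}(radial_id zS) (horseshoe_box bf).
have b0 : branch i z != 0 by apply: neq0_i4; rewrite vec5E gt_eqF.
split => // [|j].
  by rewrite mxE mulr_gt0 ?invr_gt0 ?enorm_gt0 // vec5E.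
rewrite /radial; apply: affine_coord_scale.
have := affine_coord_branch i j z; have := aff j; rewrite /affine_coord.
set cj := nth _ _ _; rewrite [branch i z 0 i4]vec5E => h1 h2.
apply: (mulIf (lt0r_neq0 f0)).
have -> : branch i z 0 (wi j) * y 0 i4 * z 0 i4 = branch i z 0 (wi j) * z 0 i4 * y 0 i4 by ring.
rewrite h2 [LHS](_ : _ = slope j * (z 0 (wi j) * y 0 i4) * z 0 i4 + cj * y 0 i4 * z 0 i4 * z 0 i4); last by ring.
by rewrite h1 exprS; ring.
Qed.

(** The relation for the forward iterate, taken at the preimage, is solved for that preimage, so no
    formula for the inverse map is required. *)
Lemma near_iterz_inv (S : sphere_diffeo R 4) (d c : 'I_4 -> R) k x :
  sphere R 4 x -> 0 < x 0 i4 -> (forall j, d j != 0) ->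
  (\forall y \near iterz S (Negz k) x, [/\ 0 < (y : rV) 0 i4,
     0 < iter k.+1 S (radial y) 0 i4
   & forall j, affine_coord (d j) (c j) j y (iter k.+1 S (radial y))]) ->
  \forall y \near x, forall j,
    affine_coord (d j)^-1 (- c j / d j) j y (iterz S (Negz k) (radial y)).
Proof.
move=> xS x0 d0 hc.
have cf := differentiable_continuous (iterz_radial_differentiable S (Negz k) xS).
rewrite -[iterz S _ x](_ : iterz S (Negz k) (radial x) = _) in hc; last by rewrite radial_id.
apply: filterS2 (near_i4_gt0 x0) (cf _ hc) => y y0 [_ _ aff] j.
have yn0 : y != 0 by apply: neq0_i4; rewrite gt_eqF.
have ryS := radial_sphere yn0.
have {aff} := aff j; rewrite -[(iterz S (Negz k) \o _) y]/(iterz S (Negz k) (radial y)).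
have : iter k.+1 S (iterz S (Negz k) (radial y)) = radial y.
  rewrite -[LHS]/(iterz S k.+1%:Z (iterz S (Negz k) (radial y))) iterzD // NegzE addrN.
  by [].
have := iterz_sphere S (Negz k) ryS.
move: (iterz S (Negz k) (radial y)) => z zS Ez.
rewrite (radial_id zS) Ez /affine_coord !mxE => h.
have e0 : (enorm y)^-1 != 0 by rewrite invr_neq0 // gt_eqF // enorm_gt0.
have {}h : y 0 (wi j) * z 0 i4 = (d j * z 0 (wi j) + c j * z 0 i4) * y 0 i4.
  by apply: (mulfI e0); rewrite mulrA h; ring.
apply: (mulfI (d0 j)).
rewrite [RHS](_ : _ = y 0 (wi j) * z 0 i4 - c j * y 0 i4 * z 0 i4); last by field.
by rewrite h; ring.
Qed.

Lemma near_iterz x m : K x -> exists c : 'I_4 -> R, \forall y \near x,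
  forall j, affine_coord (slope j ^ m) (c j) j y (iterz T m (radial y)).
Proof.
move=> Kx; have xS := cantor_sphere Kx; case: m => k.
  by have [c hc] := near_iter k Kx; exists c; apply: filterS hc => y [].
have [c hc] := near_iter k.+1 (iterz_cantor (Negz k) Kx).
exists (fun j => - c j / slope j ^+ k.+1).
apply: (near_iterz_inv (d := fun j => slope j ^+ k.+1) xS (cantor_gt0 Kx) _ hc) => j.
by rewrite expf_neq0 // slope_neq0.
Qed.

Definition slopes (m : int) : 'M[R]_4 := diag_mx (\row_j (slope j ^ m)).

(** The chart conjugates the tangent map to a constant diagonal matrix; combined with
    [tangent_map_tangent] this determines it. *)
Lemma tangent_map_gnomonic x m : K x ->
  tangent_map T m x *m gnomonic_D (iterz T m x) = gnomonic_D x *m slopes m.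
Proof.
move=> Kx; have xS := cantor_sphere Kx; have [c hc] := near_iterz m Kx.
apply/row_matrixP => i; rewrite !row_mul !rowE; apply/rowP => j.
have fx : (iterz T m \o @radial R 4) x = iterz T m x by rewrite /= radial_id.
have X0 : iterz T m x 0 i4 != 0 by rewrite gt_eqF // cantor_gt0 //; exact: iterz_cantor.
have := @affine_coord_derive R (iterz T m \o @radial R 4) x (delta_mx 0 i)
  (slope j ^ m) (c j) j (iterz_radial_differentiable T m xS).
rewrite fx => -> //; last 2 first.
- by rewrite gt_eqF // cantor_gt0.
- by apply: filterS hc => y; exact.
by rewrite mul_mx_diag [RHS]mxE [X in _ = _ * X]mxE mulrC.
Qed.

Lemma tangent_map_tangent x m : K x -> tangent_map T m x *m (iterz T m x)^T = 0.
Proof.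
move=> Kx; have xS := cantor_sphere Kx; apply/row_matrixP => i; rewrite row0 row_mul rowE.
have := @derive_sphere_tangent R (iterz T m \o @radial R 4) x (delta_mx 0 i)
  (iterz_radial_differentiable T m xS).
rewrite /= radial_id //; apply.
apply: filterS (near_i4_gt0 (cantor_gt0 Kx)) => y y0.
by apply/iterz_sphere/radial_sphere/neq0_i4; rewrite gt_eqF.
Qed.

Lemma lift_tangent_map x m : K x ->
  gnomonic_lift x *m tangent_map T m x = slopes m *m gnomonic_lift (iterz T m x).
Proof.
move=> Kx; have xS := cantor_sphere Kx; have KX := iterz_cantor m Kx.
have x0 : x 0 i4 != 0 by rewrite gt_eqF // cantor_gt0.
have X0 : iterz T m x 0 i4 != 0 by rewrite gt_eqF // cantor_gt0.
have XS := cantor_sphere KX.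
apply: (gnomonic_D_inj_mx XS X0).
- by rewrite -mulmxA tangent_map_tangent // mulmx0.
- by rewrite -mulmxA gnomonic_lift_tangent // mulmx0.
- rewrite -!mulmxA tangent_map_gnomonic // gnomonic_liftK // mulmxA gnomonic_liftK //.
  by rewrite mul1mx mulmx1.
Qed.

(* Unstable (b = true) and stable (b = false) coordinate planes of the chart. *)
Definition plane (b : bool) : 'M[R]_4 := diag_mx (\row_j ((j < 2)%N == b)%:R).

(** [<<_>>] makes the 4 by 5 generating matrix square without changing its row space, which is the
    format of [invariant_splitting]. *)
Definition plane_at (b : bool) x : 'M[R]_5 := <<plane b *m gnomonic_lift x>>%MS.

Lemma planeD : plane true + plane false = 1%:M.
Proof.
apply/matrixP => i j; rewrite !mxE -mulrnDl; congr (_ *+ _).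
by case: (_ < 2)%N; rewrite /= ?addr0 ?add0r.
Qed.

Lemma planeM b b' : plane b *m plane b' = if b == b' then plane b else 0.
Proof.
rewrite mulmx_diag; apply/matrixP => i j; rewrite [LHS]mxE [X in X *+ _]mxE [X in X * _ *+ _]mxE [X in _ * X *+ _]mxE.
by case: b b' => -[] /=; rewrite !mxE; case: (i < 2)%N; rewrite /= ?mulr0 ?mul0r ?mulr1 ?mul0rn.
Qed.

Lemma plane_slopes b (k : nat) :
  plane b *m slopes (if b then - k%:Z else k%:Z) = 4 ^- k *: plane b.
Proof.
rewrite mulmx_diag; apply/matrixP => i j; rewrite !mxE mulrnAr; congr (_ *+ _).
case: b; case: i => [[|[|[|[|i]]]] h] //=; rewrite /slope /= ?mul0r ?mulr0 ?mul1r ?mulr1 //.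
- by rewrite -exprnN.
- by rewrite -exprnN.
- by rewrite -exprVn.
- by rewrite -exprVn.
Qed.

Lemma slopes_unit m : slopes m \in unitmx.
Proof.
rewrite unitmxE det_diag unitfE; apply/prodf_neq0 => j _; rewrite mxE.
by rewrite expfz_neq0 // slope_neq0.
Qed.

Lemma plane_slopesC b m : plane b *m slopes m = slopes m *m plane b.
Proof. by rewrite !mulmx_diag; congr diag_mx; apply/rowP => j; rewrite !mxE mulrC. Qed.

Lemma cantor_splitting : invariant_splitting T K (plane_at true) (plane_at false).
Proof.
move=> x Kx; have xS := cantor_sphere Kx.
have x0 : x 0 i4 != 0 by rewrite gt_eqF // cantor_gt0.
have inv b : (plane_at b x *m tangent_map T 1 x == plane_at b (T x))%MS.
  have E : plane b *m gnomonic_lift x *m tangent_map T 1 x =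
      slopes 1 *m (plane b *m gnomonic_lift (T x)).
    by rewrite -mulmxA lift_tangent_map // !mulmxA plane_slopesC.
  apply/eqmxP; apply: eqmx_trans (eqmxMr _ (genmxE _)) _; rewrite E.
  apply: eqmx_trans (eqmx_sym (genmxE _)).
  by apply: eqmxMfull; rewrite row_full_unit slopes_unit.
split => //.
- apply/andP; split.
    by rewrite addsmx_sub !genmxE; apply/andP; split; apply/sub_kermxP;
      rewrite -mulmxA gnomonic_lift_tangent // mulmx0.
  have tE : tangent x = tangent x *m gnomonic_D x *m gnomonic_lift x.
    apply: (gnomonic_D_inj_mx xS x0); first by rewrite mulmx_ker.
      by rewrite -mulmxA gnomonic_lift_tangent // mulmx0.
    by rewrite -!mulmxA gnomonic_liftK // mulmx1.
  rewrite tE -[gnomonic_lift x]mul1mx -planeD mulmxDl mulmxDr.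
  apply: addmx_sub_adds; rewrite genmxE; exact: submxMl.
- apply/andP; split; last exact: sub0mx.
  apply/rV_subP => v; rewrite sub_capmx => /andP[]; rewrite !genmxE.
  move=> /submxP[a va] /submxP[b vb].
  have h1 : v *m gnomonic_D x = a *m plane true by rewrite va -!mulmxA gnomonic_liftK // mulmx1.
  have h2 : v *m gnomonic_D x = b *m plane false by rewrite vb -!mulmxA gnomonic_liftK // mulmx1.
  have a0 : a *m plane true = 0.
    have := planeM true true; rewrite eqxx => <-; rewrite mulmxA -h1 h2 -mulmxA planeM.
    by rewrite mulmx0.
  by rewrite va mulmxA a0 mul0mx sub0mx.
Qed.

(** Pull-back of the Euclidean metric by the chart. At points of K the tangent map multiplies chart
    coordinates exactly by the slopes, so lambda = 4 and c = 1 are admissible. *)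
Definition metric x : 'M[R]_5 := gnomonic_D x *m (gnomonic_D x)^T.

Lemma quad_metric x v : (v *m metric x *m v^T) 0 0 = sqnorm (v *m gnomonic_D x).
Proof.
rewrite /metric mulmxA -mulmxA -trmx_mul [LHS]mxE.
by under eq_bigr => j _ do rewrite [X in _ * X]mxE -expr2.
Qed.

Lemma gnorm_metric x v : Defs.gnorm metric x v = enorm (v *m gnomonic_D x).
Proof. by rewrite /Defs.gnorm quad_metric. Qed.

Lemma contraction b k x v : K x -> (v <= plane_at b x)%MS ->
  let m := (if b then - k%:Z else k%:Z) in
  Defs.gnorm metric (iterz T m x) (v *m tangent_map T m x) <= 1 * 4 ^- k * Defs.gnorm metric x v.
Proof.
move=> Kx; rewrite genmxE => /submxP[u ->]; cbv zeta; set m := (if b then _ else _).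
have x0 : x 0 i4 != 0 by rewrite gt_eqF // cantor_gt0.
rewrite !gnorm_metric mul1r -!mulmxA tangent_map_gnomonic // !mulmxA.
rewrite -(mulmxA (u *m _)) gnomonic_liftK // mulmx1 -mulmxA plane_slopes -scalemxAr enormZ.
by rewrite ger0_norm // invr_ge0 exprn_ge0.
Qed.

Lemma cantor_hyperbolic : hyperbolic T K.
Proof.
exists ([set x : rV | 0 < x 0 i4] `&` sphere R 4), metric, (plane_at true), (plane_at false), 4, 1.
split => //; try lra.
- split; last exact: cantor_splitting.
  + split=> [x []//|]; exists [set x : rV | 0 < x 0 i4]; split => //.
      by rewrite openE => x /= x0; exact: near_i4_gt0.
    exact: cantor_gt0.
  + split.
    * apply: (smooth_on_open (U := [set x : rV | x 0 i4 != 0])).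
      - rewrite (_ : [set x | _] = (fun x : rV => x 0 i4 : R^o) @^-1` [set y | y != 0]) //.
        by apply: open_comp => [x _|]; [exact: coord_continuous|exact: open_neq0].
      - by move=> x [/= x0 _]; rewrite gt_eqF.
      - have oU : open [set x : rV | x 0 i4 != 0].
          rewrite (_ : [set x | _] = (fun x : rV => x 0 i4 : R^o) @^-1` [set y | y != 0]) //.
          by apply: open_comp => [x _|]; [exact: coord_continuous|exact: open_neq0].
        move=> r; apply: Cr_mx => // i j.
        have C l := CrM oU (Coo_gnomonic_D i l r) (Coo_gnomonic_D j l r).
        apply: Cr_eq (Cr_sum (index_enum _) oU C) => // x _.
        by rewrite [RHS]mxE; apply: eq_bigr => l _; rewrite [X in _ = _ * X]mxE.
    * by move=> x _; rewrite /metric trmx_mul trmxK.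
    * move=> x v [/= x0 xS] /sub_kermxP vt vn0; rewrite quad_metric.
      apply: sqnorm_gt0; apply: contra_neq vn0; apply: (gnomonic_D_inj xS) => //.
      by rewrite gt_eqF.
- by move=> k x v Kx vs; exact: (@contraction false).
- by move=> k x v Kx vs; exact: (@contraction true).
Qed.

(** The size of the restricted matrix is a rank, equal to 4 only propositionally, hence the variable
    [r]. *)
Lemma det_I_sub_conj r (M : 'M[R]_r) (Q : 'M[R]_(r, 4)) (A : 'M[R]_4) : r = 4 -> row_free Q ->
  M *m Q = Q *m A -> \det (1%:M - M) = \det (1%:M - A).
Proof.
move=> r4; subst r; rewrite row_free_unit => Qu MQ.
have -> : M = Q *m A *m invmx Q by rewrite -MQ mulmxK.
have -> : 1%:M - Q *m A *m invmx Q = Q *m (1%:M - A) *m invmx Q.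
  by rewrite mulmxBr mulmx1 mulmxBl mulmxV.
by rewrite !det_mulmx mulrAC -det_mulmx mulmxV // det1 mul1r.
Qed.

Lemma det_I_sub_cantor (m : nat) x : K x -> iter m T x = x ->
  det_I_sub T m x = ((4 ^+ m - 1) * (1 - 4 ^- m)) ^+ 2.
Proof.
move=> Kx fx; have xS := cantor_sphere Kx.
have x0 : x 0 i4 != 0 by rewrite gt_eqF // cantor_gt0.
pose W := row_base (tangent x); set f := tangent_map T m%:Z x.
have fD : f *m gnomonic_D x = gnomonic_D x *m slopes m by have := tangent_map_gnomonic m Kx; rewrite /= fx.
have ft : f *m x^T = 0 by have := tangent_map_tangent m Kx; rewrite /= fx.
have Wt : W *m x^T = 0 by apply/sub_kermxP; rewrite eq_row_base.
have Wf : (W *m f <= W)%MS.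
  by rewrite eq_row_base; apply/sub_kermxP; rewrite -mulmxA ft mulmx0.
have r4 : \rank (tangent x) = 4.
  by rewrite mxrank_ker mxrank_tr rank_rV (sphere_neq0 xS).
rewrite /det_I_sub -/f (@det_I_sub_conj _ _ (W *m gnomonic_D x) (slopes m)) //.
- have -> : 1%:M - slopes m = diag_mx (\row_j (1 - slope j ^ m%:Z)).
    by apply/matrixP => i j; rewrite !mxE -mulrnBl.
  rewrite det_diag !big_ord_recl big_ord0 !mxE /slope /= -!exprnP !exprVn; field.
  by rewrite expf_neq0 // pnatr_eq0.
- apply: inj_row_free => u; rewrite mulmxA => uD.
  apply: (row_free_inj (row_base_free (tangent x))); rewrite mul0mx.
  apply: (gnomonic_D_inj xS x0) => //.
  by rewrite -mulmxA Wt mulmx0.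
- rewrite /conjmx -/W mulmxA mulmxKpV //.
  by rewrite -!mulmxA fD.
Qed.

End Hyperbolicity.

Definition first_one (a : nat -> bool) (k : nat) :=
  (forall j, (j < k)%N -> a j = false) /\ a k.

Lemma first_one_dec a : (exists k, first_one a k) \/ forall j, a j = false.
Proof.
have [[k ak]|H] := pselect (exists k, a k); last first.
  by right => j; apply/negbTE/negP => aj; apply: H; exists j.
left; have ex : exists k, a k by exists k.
exists (ex_minn ex); case: ex_minnP => m am mmin; split => // j jm.
by apply/negbTE/negP => /mmin; rewrite leqNgt jm.
Qed.

Lemma first_one_find (s : seq bool) (a : nat -> bool) : (forall j, (j < size s)%N -> a j = nth false s j) ->
  has id s -> first_one a (find id s).
Proof.
move=> as_ hs; have fs : (find id s < size s)%N by rewrite -has_find.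
split=> [j js|]; first by rewrite as_ ?(ltn_trans js fs) //; exact: (before_find false js).
by rewrite as_ //; exact: (nth_find false hs).
Qed.

Lemma lead_has s j : has id s -> lead s j = find id s.
Proof. by elim: s => [//|[] s IH] //= hs; rewrite IH. Qed.

(** * The weight and the periodic points *)

Section Weights.
Context {F : numFieldType}.
Variables (b : nat -> F) (gam : (nat -> bool) -> F).
Hypothesis gam_false : forall a, a 0%N = false -> gam a = 1.
Hypothesis gam_first : forall (a : nat -> bool) k, a 0%N -> first_one (fun j => a j.+1) k -> gam a = b k.

(** The weight of a letter depends on the letters after it, so the induction also carries the index
    of the first [true]. *)
Lemma prod_block_weight s i (a : nat -> bool) : (forall j, (j < size s)%N -> a j = nth false s j) ->
  first_one (fun j => a (j + size s)%N) i ->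
  \prod_(0 <= k < size s) gam (fun j => a (j + k)%N) = block_weight b s i /\
  first_one a (lead s i).
Proof.
elim: s a => [|x s IH] a as_ fi.
  by rewrite big_geq //; split => //; move: fi => /=; congr first_one; apply/funext => j; rewrite addn0.
have [] := IH (fun j => a j.+1); first by move=> j js; exact: (as_ j.+1).
  by move: fi => /=; congr first_one; apply/funext => j; rewrite addnS.
move=> Ep Ef; have a0 : a 0%N = x by exact: (as_ 0%N).
rewrite /= big_nat_recl //; split; last first.
  case: x a0 {as_ fi} => a0; first by split.
  by case: Ef => h1 h2; split => // -[|j] // /h1.
congr (_ * _).
  rewrite (_ : (fun j => a (j + 0)%N) = a); last by apply/funext => j; rewrite addn0.
  by case: x a0 {as_ fi} => a0; [exact: gam_first|exact: gam_false].
rewrite -Ep; apply: eq_bigr => k _; congr gam.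
by apply/funext => j; rewrite addnS.
Qed.

(** By periodicity the sequence starts over after s, so the first [true] beyond the block has the
    index of the first one in s. *)
Lemma prod_cyclic_weight s (a : nat -> bool) : (forall j, (j < size s)%N -> a j = nth false s j) ->
  (forall j, a (j + size s)%N = a j) ->
  \prod_(0 <= k < size s) gam (fun j => a (j + k)%N) = cyclic_weight b 0 s.
Proof.
move=> as_ per; rewrite /cyclic_weight; case: ifPn => hs.
  apply: (prod_block_weight (i := lead s 0) as_ _).1.
  rewrite (_ : (fun j => _) = a); last exact/funext.
  by rewrite lead_has //; exact: first_one_find.
have a0 j : (j < size s)%N -> a j = false.
  move=> js; rewrite as_ //; apply/negbTE; move: hs; rewrite -all_predC => /all_nthP.
  exact.
by rewrite big_nat_cond big1 // => k /andP[/andP[_ ks] _]; rewrite gam_false //= a0.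
Qed.

End Weights.

Section Weight.
Context {R : realType}.
Local Notation rV := 'rV[R]_5.
Local Notation C := R[i].
Implicit Types (w : int -> bool) (x : rV) (a : nat -> bool) (r : nat).

Lemma base4_zeros a k : (forall j, (j < k)%N -> a j = false) ->
  @base4 R a = base4 (fun j => a (j + k)%N) / 4 ^+ k.
Proof.
elim: k a => [|k IH] a a0.
  by rewrite expr0 divr1; congr base4; apply/funext => j; rewrite addn0.
rewrite base4_rec a0 // add0r IH => [|j jk]; last exact: a0.
rewrite -mulrA -invfM -exprSr; congr (base4 _ / _).
by apply/funext => j; rewrite addnS.
Qed.

Lemma base4_0 a : (forall j, a j = false) -> base4 a = 0 :> R.
Proof.
move=> a0; rewrite -(@base4_unique R a (fun=> 0) 0) // => n; last by rewrite normr0.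
by rewrite a0 mul0r addr0.
Qed.

(** The cutoff is 1 where the last coordinate is at least 1/2, in particular on the invariant set,
    and 0 where it is at most 1/4, away from which the quotient u1 is smooth. [c] is 1 for the real
    part and 0 for the imaginary part. *)
Definition weight_part (c : R) (b : nat -> R) x : R :=
  c + step (4 * x 0 i4 - 1) * lacunary b plateau (x 0 i0 / x 0 i4 - 1).

Lemma annular_plateau : annular (@plateau R).
Proof. by move=> x h; apply: plateau0; lra. Qed.

Lemma weight_part_point c b w :
  weight_part c b (@point R w) = c + lacunary b plateau (ucoord w - 1).
Proof.
rewrite /weight_part; have [_ ->] := @point_ratio R w.
rewrite step1 ?mul1r // /point /radial vec5Z vec5E mulr1.
have /andP[e1 e2] := @enorm_chart_point R w.
have : 2^-1 <= (enorm (@chart_point R w))^-1 by rewrite lef_pV2 ?posrE //; lra.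
by lra.
Qed.

Lemma weight_part_false c b w : w 0 = false -> weight_part c b (@point R w) = c.
Proof.
move=> w0; rewrite weight_part_point lacunary_le0 ?addr0 //; first exact: annular_plateau.
by have := @ucoord_bounds R w; rewrite w0 /=; lra.
Qed.

Lemma weight_part_none c b w : (forall j : nat, w j.+1%:Z = false) ->
  weight_part c b (@point R w) = c.
Proof.
move=> w1; rewrite weight_part_point lacunary_le0 ?addr0 //; first exact: annular_plateau.
rewrite /ucoord base4_rec base4_0 // mul0r addr0.
by case: (future _ _) => /=; lra.
Qed.

Lemma weight_part_first c b w k : w 0 -> first_one (fun j => w j.+1%:Z) k ->
  weight_part c b (@point R w) = c + b k.
Proof.
move=> w0 [w1 wk]; rewrite weight_part_point.
have p4 : (4 : R) ^+ k != 0 by rewrite expf_neq0 // pnatr_eq0.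
(* After its leading 1, u has k digits 0 and then a 1. Rescaling by 4^(k+1) moves that 1 to the
   front, hence onto the flat part of [plateau]. *)
have : 1 <= (4 : R) ^+ k.+1 * (ucoord w - 1) <= 4 / 3.
  rewrite /ucoord base4_rec (base4_zeros (a := fun j => future w j.+1) (k := k)) //.
  rewrite /future w0 /= exprS; set t := base4 _.
  have -> : 4 * 4 ^+ k * (1 + t / 4 ^+ k / 4 - 1) = t :> R by field.
  rewrite base4_le andbT /t base4_rec /= add0n wk /=.
  by have := @base4_ge0 R (fun j => w (j.+1 + k).+1); lra.
move=> h; rewrite (@lacunary_at _ k) ?plateau1 ?mulr1 //; first exact: annular_plateau.
by lra.
Qed.

(** Two open sets cover the sphere: last coordinate above 1/8, where the quotient is smooth, and
    below 1/4, where the cutoff leaves a constant. *)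
Lemma weight_part_Cr c b r : decays r b ->
  Cr_on r (sphere R 4) (weight_part c b : rV -> R^o).
Proof.
move=> db x _; have oc (U : set R^o) : open U -> open [set y : rV | U (y 0 i4)].
  move=> oU; rewrite (_ : [set y | _] = (fun y : rV => y 0 i4 : R^o) @^-1` U) //.
  by apply: open_comp => // y _; exact: coord_continuous.
have [x8|x8] := ltP (8^-1) (x 0 i4).
  have oU : open [set y : rV | 8^-1 < y 0 i4] by apply: (oc [set u | 8^-1 < u]); exact: open_gt.
  exists [set y : rV | 8^-1 < y 0 i4], (weight_part c b); split => //.
  have C4 := @Cr_coord R 0 4 r [set y : rV | 8^-1 < y 0 i4] 0 i4.
  have C0 := @Cr_coord R 0 4 r [set y : rV | 8^-1 < y 0 i4] 0 i0.
  apply: CrD => //; first exact: Cr_cst.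
  apply: CrM => //.
    apply: (Cr_comp (U' := setT) (g := step)) => //; last exact: Coo_step.
    by apply: CrB => //; [exact: CrZ|exact: Cr_cst].
  apply: (Cr_comp (U' := setT) (g := lacunary b plateau)) => //; last first.
    by apply: Cr_lacunary => //; [exact: annular_plateau|exact: Coo_plateau].
  apply: CrB => //; last exact: Cr_cst.
  apply: CrM => //; apply: Cr_comp C4 (Cr_inv r) => // y /= y8.
  by rewrite gt_eqF //; apply: lt_trans y8; rewrite invr_gt0.
exists [set y : rV | y 0 i4 < 4^-1], (fun=> c); split.
- by apply: (oc [set u | u < 4^-1]); exact: open_lt.
- by apply: le_lt_trans x8 _; rewrite ltf_pV2 ?posrE ?ltr_nat.
- exact: Cr_cst.
- move=> y; rewrite inE => -[_ /= y4].
  by rewrite /weight_part step0 ?mul0r ?addr0 //; lra.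
Qed.

Definition weight_fun (alpha : nat -> C) x : C :=
  Complex (weight_part 1 (fun k => complex.Re (alpha k)) x)
          (weight_part 0 (fun k => complex.Im (alpha k)) x).

Lemma weight_fun_false alpha w : w 0 = false -> weight_fun alpha (point w) = 1.
Proof. by move=> w0; rewrite /weight_fun !weight_part_false. Qed.

Lemma weight_fun_none alpha w : (forall j : nat, w j.+1%:Z = false) ->
  weight_fun alpha (point w) = 1.
Proof. by move=> w1; rewrite /weight_fun !weight_part_none. Qed.

Lemma weight_fun_first alpha w k : w 0 -> first_one (fun j => w j.+1%:Z) k ->
  weight_fun alpha (point w) = 1 + alpha k.
Proof.
move=> w0 w1; rewrite /weight_fun !(weight_part_first _ _ w0 w1).
by case: (alpha k).
Qed.

Lemma weight_fun_gt0 alpha x : (forall k, -1 < alpha k) -> cantor x -> 0 < weight_fun alpha x.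
Proof.
move=> a1 [w _ <-]; case w0 : (w 0); last by rewrite weight_fun_false.
have [[k wk]|wn] := first_one_dec (fun j => w j.+1%:Z); last by rewrite weight_fun_none.
by rewrite (weight_fun_first _ w0 wk) -ltrBlDl sub0r.
Qed.

Lemma weight_fun_Cr alpha r : (1 < convergence_radius alpha)%E ->
  (r%:R%:E < lne (convergence_radius alpha) / (ln 4)%:E)%E ->
  complex_Cr_on (weight_fun alpha) r.
Proof.
move=> rho1 hr; have [dr di] := decays_radius rho1 hr.
by split; apply: weight_part_Cr.
Qed.

End Weight.

(** * Periodic points and their weighted sums *)

Section PeriodicPoints.
Context {R : realType}.
Local Notation rV := 'rV[R]_5.
Local Notation C := R[i].
Local Notation T := (@horseshoe R).
Local Notation K := (@cantor R).
Implicit Types (w : int -> bool) (s : seq bool) (x : rV).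
Local Opaque horseshoe.

Definition periodic s : int -> bool := fun j => nth false s `|(j %% (size s)%:Z)%Z|%N.

Lemma periodic_nat s (j : nat) : periodic s j = nth false s (j %% size s).
Proof. by rewrite /periodic modz_nat absz_nat. Qed.

Lemma shift_periodic s : shift (size s) (periodic s) = periodic s.
Proof. by apply/funext => j; rewrite /shift /periodic modzDr. Qed.

Lemma shift_mul w (n : int) (q : int) : shift n w = w -> shift (q * n) w = w.
Proof.
move=> wn; have wn' : shift (- n) w = w by rewrite -{1}wn shiftD addNr shift0.
elim/int_ind: q => [|q IH|q IH]; first by rewrite mul0r shift0.
  by rewrite intS mulrDl mul1r -shiftD IH.
by rewrite intS opprD mulrDl mulN1r -shiftD IH.
Qed.

Lemma periodicE w n : (0 < n)%N -> shift n w = w -> periodic (mkseq (fun j => w j%:Z) n) = w.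
Proof.
move=> n0 wn; apply/funext => j; rewrite /periodic size_mkseq.
have j0 : (0 <= j %% n)%Z by rewrite modz_ge0 // eqz_nat gt_eqF.
have jn : (j %% n < n)%Z by rewrite ltz_pmod.
rewrite nth_mkseq; last by rewrite -ltz_nat gez0_abs.
rewrite gez0_abs // -{1}(shift_mul (j %/ n)%Z wn) /shift; congr w.
by rewrite addrC -divz_eq.
Qed.

Lemma periodic_inj n : {in [pred s | size s == n.+1] &, injective periodic}.
Proof.
move=> s t; rewrite !inE => /eqP ss /eqP ts st.
apply: (@eq_from_nth _ false) => [|j js]; first by rewrite ss ts.
have := congr1 (fun w => w j%:Z) st; rewrite !periodic_nat ss ts !modn_small //.
by rewrite -ss.
Qed.

Lemma fixed_in_periodic n : fixed_in T K n.+1 =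
  (fun s : n.+1.-tuple bool => @point R (periodic s)) @` setT.
Proof.
apply/seteqP; split=> [x [[w _ <-]]|_ [s _ <-]].
  rewrite -[iter _ _ _]/(iterz T n.+1%:Z (point w)) iterz_point => /point_inj wn.
  exists [tuple of mkseq (fun j => w j%:Z) n.+1] => //.
  by congr point; exact: periodicE.
split; first by exists (periodic s).
rewrite -[iter _ _ _]/(iterz T n.+1%:Z (point (periodic s))) iterz_point.
by rewrite -{1}(size_tuple s) shift_periodic.
Qed.

Lemma sum_fixed_in n (f : rV -> C) :
  \sum_(x \in fixed_in T K n.+1) f x =
  \sum_(s : n.+1.-tuple bool) f (@point R (periodic s)).
Proof.
rewrite fixed_in_periodic fsbig_image; last first.
  move=> s t _ _ /point_inj /(periodic_inj (n := n)) h; apply: val_inj.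
  by apply: h; rewrite inE size_tuple.
rewrite (fsbigE (index_enum _)) ?index_enum_uniq //.
  by apply: eq_bigl => s; rewrite in_setT.
by move=> s _; rewrite mem_index_enum.
Qed.

End PeriodicPoints.

Section WeightedSums.
Context {R : realType}.
Local Notation C := R[i].
Local Notation T := (@horseshoe R).
Local Notation K := (@cantor R).
Local Opaque horseshoe.
Variable alpha : nat -> C.

Lemma weight_periodic (s : seq bool) :
  weight T (weight_fun alpha) (size s) (point (periodic s)) =
  cyclic_weight (fun k => 1 + alpha k) 0 s.
Proof.
(* On the invariant set the weight sees only the letters from position 0 on, as [agree] states, so
   the past may be filled with [false]. *)
pose w (a : nat -> bool) : int -> bool := fun j => if j is Posz n then a n else false.
pose gam a := weight_fun alpha (@point R (w a)).
have agree v v' : (forall j : nat, v j%:Z = v' j%:Z) ->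
    weight_fun alpha (@point R v) = weight_fun alpha (point v').
  move=> vv; case v0 : (v 0); last by rewrite !weight_fun_false // -(vv 0%N).
  have v1 : v' 0 by rewrite -(vv 0%N).
  have [[k vk]|vn] := first_one_dec (fun j => v j.+1%:Z).
    rewrite (weight_fun_first _ v0 vk) (@weight_fun_first R alpha v' k v1) //.
    by move: vk; congr first_one; apply/funext => j; exact: vv.
  by rewrite !weight_fun_none // => j; rewrite -vv.
rewrite -(@prod_cyclic_weight _ _ gam _ _ s (fun j : nat => periodic s j)).
- apply: eq_bigr => k _.
  rewrite -[iter k _ _]/(iterz T k%:Z (point (periodic s))) iterz_point.
  by apply: agree.
- by move=> a a0; exact: weight_fun_false.
- by move=> a k a0 ak; exact: weight_fun_first.
- by move=> j js; rewrite periodic_nat modn_small.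
- by move=> j; rewrite !periodic_nat modnDr.
Qed.

Lemma sum_weight n : \sum_(x \in fixed_in T K n.+1) weight T (weight_fun alpha) n.+1 x =
  cyclic_sum (fun k => 1 + alpha k) n.+1 0.
Proof.
rewrite sum_fixed_in; apply: eq_bigr => s _.
by have := weight_periodic s; rewrite size_tuple.
Qed.

Lemma inv_det_I_sub_cantor n x : fixed_in T K n.+1 x ->
  (`|det_I_sub T n.+1 x|%:C)^-1 = (4 ^- n.+1) ^+ 2 * (1 - 4 ^- n.+1) ^- 4 :> C.
Proof.
move=> [Kx fx]; rewrite (det_I_sub_cantor Kx fx) ger0_norm ?sqr_ge0 //.
have -> : ((4 ^+ n.+1 - 1) * (1 - 4 ^- n.+1)) ^+ 2 =
    (4 ^+ n.+1) ^+ 2 * (1 - 4 ^- n.+1) ^+ 4 :> R.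
  by field; rewrite expf_neq0 // pnatr_eq0.
by rewrite rmorphM !rmorphXn rmorphB rmorph1 /= fmorphV rmorphXn /= rmorph_nat invfM exprVn.
Qed.

Lemma sum_weight_det n :
  \sum_(x \in fixed_in T K n.+1)
     weight T (weight_fun alpha) n.+1 x / `|det_I_sub T n.+1 x|%:C =
  (\sum_(x \in fixed_in T K n.+1) weight T (weight_fun alpha) n.+1 x) *
  ((4 ^- n.+1) ^+ 2 * (1 - 4 ^- n.+1) ^- 4).
Proof.
rewrite (eq_fsbigr (fun x => weight T (weight_fun alpha) n.+1 x *
  ((4 ^- n.+1) ^+ 2 * (1 - 4 ^- n.+1) ^- 4))); last first.
  by move=> x /set_mem fx; rewrite inv_det_I_sub_cantor.
by rewrite !sum_fixed_in mulr_suml.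
Qed.

End WeightedSums.

Theorem proposition3p3 (R : realType) :
  exists (T : sphere_diffeo R 4) (K : set 'rV[R]_5),
    hyperbolic_basic_set T K /\
    forall (h : R[i] -> R[i]) (alpha : nat -> R[i]),
      holomorphic0 h ->
      has_expansion0 h alpha ->
      (1 < convergence_radius alpha)%E ->
      (forall k, alpha k != -1) ->
      exists g : 'rV[R]_5 -> R[i],
        [/\ [/\ has_expansion0 (zeta T K g) (zeta_series T K g),
                has_expansion0 (dyn_det T K g) (det_series T K g),
                \forall z \near (0 : R[i]^o),
                  (zeta T K g z)^-1 = 1 - 2 * z - z * (1 - z) * h z
              & \forall z \near (0 : R[i]^o),
                  (fun N => \prod_(0 <= k < N)
                     ((zeta T K g (z / 4 ^+ k.+2))^-1)
                       ^+ ((k.+1 * k.+2 * k.+3) %/ 6) : R[i]^o)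
                    @ \oo --> (dyn_det T K g z : R[i]^o)],
            forall r : nat,
              (r%:R%:E < lne (convergence_radius alpha) / (ln 4)%:E)%E ->
              complex_Cr_on g r
          & (forall k, -1 < alpha k) -> forall x, K x -> 0 < g x].
Proof.
exists (@horseshoe R), (@cantor R); split.
  split; first by split; [exact: cantor_sphere|exact: compact_cantor|exact: horseshoe_cantor].
  - exact: cantor_hyperbolic.
  - exact: cantor_locally_maximal.
  - exact: cantor_transitive.
move=> h alpha _ h0 rho1 _; exists (weight_fun alpha); split.
- exact: (zeta_det_identities h0 rho1 (sum_weight alpha) (sum_weight_det alpha)).
- by move=> r; exact: weight_fun_Cr.
- by move=> a1 x Kx; exact: weight_fun_gt0.
Qed.
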